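(* Let $\mathbb{K}$ be a field of prime characteristic $p$, let $S=\mathbb{K}[x_1,\ldots,x_n]$ with the standard grading, and let $I\subseteq S$ be a nonzero proper homogeneous ideal such that $S/I$ is $F$-pure. Then $r_I\le\dim(S/I)$. Moreover, if $I$ is Gorenstein (i.e. $S/I$ is a Gorenstein ring), then $r_I\le\mathrm{reg}(S/I)$.
   Context: $F$-purity: for a Noetherian ring $R$ of prime characteristic $p$, let $F\colon R\to R$, $r\mapsto r^p$, be the Frobenius map. $R$ is $F$-pure if for every $R$-module $M$ the map $1_M\otimes_R F\colon M\otimes_R R\to M\otimes_R R$ is injective (where the target copy of $R$ is regarded as an $R$-module via $F$). An $F$-pure ring is reduced, so in the claim $I$ is radical. Multiplicity: for a proper homogeneous ideal $J\subseteq S$ with $d=\dim(S/J)$ (Krull dimension), put $H_J(t)=\dim_{\mathbb{K}}(S_{\le t}/J_{\le t})$, where $S_{\le t}$ is the space of polynomials of degree at most $t$ and $J_{\le t}=J\cap S_{\le t}$. The Hilbert–Samuel multiplicity is $\mathrm{e}(S/J)=d!\,\lim_{t\to\infty} H_J(t)/t^{d}$. Minimum distance function: for an integer $t\ge 1$ let $\mathcal{F}_t=\{f\in S_t \mid f\notin I,\ (I:f)\neq I\}$, where $S_t$ is the degree-$t$ homogeneous component of $S$. The minimum distance function $\delta_I\colon\mathbb{N}_+\to\mathbb{Z}$ is defined by $\delta_I(t)=\mathrm{e}(S/I)-\max\{\mathrm{e}(S/(I,f))\mid f\in\mathcal{F}_t\}$ if $\mathcal{F}_t\neq\emptyset$,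 and $\delta_I(t)=\mathrm{e}(S/I)$ if $\mathcal{F}_t=\emptyset$. Regularity index: for a radical homogeneous ideal $I$, $r_I=\min\{s\in\mathbb{N}\mid \delta_I(s)=\lim_{t\to\infty}\delta_I(t)\}$. Castelnuovo–Mumford regularity: if $0\to\bigoplus_j S(-j)^{\beta_{gj}}\to\cdots\to\bigoplus_j S(-j)^{\beta_{1j}}\to S\to S/I\to 0$ is the minimal graded free resolution of $S/I$ over $S$, then $\mathrm{reg}(S/I)=\max\{j-i\mid \beta_{ij}\ne 0\}$.
   Formalization: The bounds are stated for r_I whenever the limit of δ_I exists (for I=(xy,xz), δ_I(t)=-t, so r_I is undefined), and δ_I is extended by δ_I(0)=e(S/I), so that s=0 is allowed in r_I (otherwise I=(x_1,...,x_n) would give r_I=1>0=dim(S/I)). *)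

(* Defs.v *)
From HB Require Import structures.
From mathcomp Require Import all_boot all_order all_algebra.
From mathcomp Require Import ring_quotient generic_quotient.
From mathcomp Require Import freeg mpoly.
From mathcomp Require Import boolp classical_sets reals topology normedtype.

Set Implicit Arguments.
Unset Strict Implicit.
Unset Printing Implicit Defensive.

Import Order.TTheory GRing.Theory Num.Theory numFieldNormedType.Exports.

Local Open Scope ring_scope.
Local Open Scope quotient_scope.
Local Open Scope classical_set_scope.

Section Tensor.
Variables (R : comNzRingType) (M N : lmodType R).

(* The subgroup of the free abelian group on M * N generated by the
   bilinearity relations. *)
Inductive tensor_rel : {freeg (M * N)%type / int} -> Prop :=
| tensor_rel0 : tensor_rel 0
| tensor_relB x y : tensor_rel x -> tensor_rel y -> tensor_rel (x - y)
| tensor_relDl m1 m2 n :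
    tensor_rel (<< (m1 + m2, n) >> - << (m1, n) >> - << (m2, n) >>)
| tensor_relDr m n1 n2 :
    tensor_rel (<< (m, n1 + n2) >> - << (m, n1) >> - << (m, n2) >>)
| tensor_relZ r m n :
    tensor_rel (<< (r *: m, n) >> - << (m, r *: n) >>).

Definition tensor_pred : {pred {freeg (M * N)%type / int}} :=
  fun x => `[< tensor_rel x >].

Lemma tensor_pred_zmod_closed : zmod_closed tensor_pred.
Proof.
split; first by apply/asboolP; exact: tensor_rel0.
by move=> x y /asboolP hx /asboolP hy; apply/asboolP; exact: tensor_relB.
Qed.

HB.instance Definition _ :=
  GRing.isZmodClosed.Build _ tensor_pred tensor_pred_zmod_closed.

Definition tensor : zmodType := Quotient.quot tensor_pred.

Definition tens (m : M) (n : N) : tensor := \pi_tensor << (m, n) >>.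

End Tensor.

Section TensorMap.
Variables (R : comNzRingType) (M N N' : lmodType R).

(* The map 1_M (x) f; [tens_mapD] and [tens_map_tens] characterize it when f
   is linear. *)
Definition tens_map (f : N -> N') (u : tensor M N) : tensor M N' :=
  \pi_(tensor M N') (fglift (fun x => << (x.1, f x.2) >>) (repr u)).

End TensorMap.

(* R viewed as a module over itself by restriction of scalars along the
   Frobenius map. *)
Definition frobenius_module (R : comNzRingType) (p : nat)
  (charRp : p \in [pchar R]) : Type := R.

Section FrobeniusModule.
Variables (R : comNzRingType) (p : nat) (charRp : p \in [pchar R]).
Local Notation FR := (frobenius_module charRp).

HB.instance Definition _ := GRing.Zmodule.copy FR R.

Definition frobenius_scale (r : R) (x : FR) : FR := r ^+ p * (x : R).

Lemma frobenius_scaleA a b (v : FR) :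
  frobenius_scale a (frobenius_scale b v) = frobenius_scale (a * b) v.
Proof. by rewrite /frobenius_scale exprMn mulrA. Qed.

Lemma frobenius_scale1 : left_id 1 frobenius_scale.
Proof. by move=> v; rewrite /frobenius_scale expr1n mul1r. Qed.

Lemma frobenius_scaleDr : right_distributive frobenius_scale +%R.
Proof. by move=> a u v; rewrite /frobenius_scale mulrDr. Qed.

Lemma frobenius_scaleDl (v : FR) : {morph frobenius_scale^~ v : a b / a + b}.
Proof.
move=> a b; rewrite /frobenius_scale -!(pFrobenius_autE charRp).
by rewrite pFrobenius_autD_comm ?mulrDl //; exact: mulrC.
Qed.

HB.instance Definition _ := GRing.Zmodule_isLmodule.Build R FR
  frobenius_scaleA frobenius_scale1 frobenius_scaleDr frobenius_scaleDl.

Definition frobenius (r : R^o) : FR := (r : R) ^+ p.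

Lemma frobenius_is_linear : linear frobenius.
Proof.
move=> a u v; rewrite /frobenius -(pFrobenius_autE charRp).
rewrite (pFrobenius_autD_comm charRp (mulrC _ _)) !pFrobenius_autE.
by congr (_ + _); exact: exprMn.
Qed.

HB.instance Definition _ :=
  GRing.isLinear.Build R R^o FR _ frobenius frobenius_is_linear.

End FrobeniusModule.

Section TensorMapTheory.
Variables (R : comNzRingType) (M N N' : lmodType R) (f : {linear N -> N'}).

Let g : {freeg (M * N)%type / int} -> {freeg (M * N')%type / int} :=
  fglift (fun x => << (x.1, f x.2) >>).

Let gB : zmod_morphism g. Proof. exact: lift_is_additive. Qed.

HB.instance Definition _ := GRing.isZmodMorphism.Build _ _ g gB.

Let gU m n : g << (m, n) >> = << (m, f n) >>.
Proof. by rewrite /g liftU scale1r. Qed.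

Lemma tens_map_rel x : tensor_rel x -> tensor_rel (g x).
Proof.
elim=> [|x' y' _ hx _ hy|m1 m2 n|m n1 n2|r m n].
- by rewrite raddf0; exact: tensor_rel0.
- by rewrite gB; exact: tensor_relB.
- by rewrite !gB !gU; exact: tensor_relDl.
- by rewrite !gB !gU raddfD; exact: tensor_relDr.
- by rewrite gB !gU linearZ; exact: tensor_relZ.
Qed.

Lemma tens_map_pi x :
  tens_map f (\pi_(tensor M N) x) = \pi_(tensor M N') (g x).
Proof.
apply/eqP; rewrite -Quotient.idealrBE -gB.
apply/asboolP/tens_map_rel/asboolP.
have : repr (\pi_(tensor M N) x) - x \in @tensor_pred R M N.
  by rewrite Quotient.idealrBE reprK.
by [].
Qed.

Lemma tens_mapD (u v : tensor M N) :
  tens_map f (u + v) = tens_map f u + tens_map f v.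
Proof. by rewrite -[u]reprK -[v]reprK -raddfD !tens_map_pi raddfD raddfD. Qed.

Lemma tens_map_tens (m : M) (n : N) : tens_map f (tens m n) = tens m (f n).
Proof. by rewrite [LHS]tens_map_pi gU. Qed.

End TensorMapTheory.

(* For M an R-module, the map M (x) R -> M (x) R induced by the Frobenius, the
   target being formed with the module structure of [frobenius_module]. *)
Definition fpure (R : comNzRingType) (p : nat) : Prop :=
  exists charRp : p \in [pchar R],
    forall M : lmodType R,
      injective (@tens_map R M R^o (frobenius_module charRp)
                   (@frobenius R p charRp)).

Definition prime_chain (R : comNzRingType) (d : nat) : Prop :=
  exists P : 'I_d.+1 -> prime_idealr R,
    forall i j : 'I_d.+1, (i < j)%N ->
      {subset P i <= P j} /\ ~ {subset P j <= P i}.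

(* The value is the default 0 if the lengths of prime chains are unbounded. *)
Definition krull_dim (R : comNzRingType) : nat :=
  xget 0%N [set d | prime_chain R d /\
                    forall e, prime_chain R e -> (e <= d)%N].

Definition noetherian (R : comNzRingType) : Prop :=
  forall J : idealr R, exists m, exists a : 'I_m -> R,
    forall x, x \in J <-> exists c : 'I_m -> R, x = \sum_(i < m) c i * a i.

Definition injective_module (R : comNzRingType) (E : lmodType R) : Prop :=
  forall (A B : lmodType R) (i : {linear A -> B}) (f : {linear A -> E}),
    injective i -> exists g : {linear B -> E}, forall a, g (i a) = f a.

Definition finite_injective_dim (R : comNzRingType) (M : lmodType R) : Prop :=
  exists (E : nat -> lmodType R) (eta : {linear M -> E 0%N})
         (d : forall i, {linear E i -> E i.+1}),
    [/\ forall i, injective_module (E i),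
        injective eta,
        forall x, d 0%N x = 0 <-> exists y, x = eta y,
        forall i x, d i.+1 x = 0 <-> exists y, x = d i y &
        exists k, forall i, (k < i)%N -> forall x : E i, x = 0].

(* (L, phi) is a localization of R at the complement of P; this determines it
   up to a unique isomorphism. *)
Definition is_localization (R : comNzRingType) (P : prime_idealr R)
    (L : comNzRingType) (phi : {rmorphism R -> L}) : Prop :=
  [/\ forall s, s \notin P -> exists y, phi s * y = 1,
      forall x, exists a s, s \notin P /\ x * phi s = phi a &
      forall a, phi a = 0 -> exists s, s \notin P /\ s * a = 0].

Definition gorenstein (R : comNzRingType) : Prop :=
  noetherian R /\
  forall P : prime_idealr R,
    exists (L : comNzRingType) (phi : {rmorphism R -> L}),
      is_localization P phi /\ finite_injective_dim (L^o : lmodType L).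

Section Graded.
Variables (K : fieldType) (n : nat).
Local Notation S := {mpoly K[n]}.

(* A proper ideal (properness is part of [idealr]) that contains the
   homogeneous components of its elements. *)
Definition homogeneous_ideal (I : idealr S) : Prop :=
  forall f d, f \in I -> pihomog mdeg d f \in I.

(* The images of b form a basis of S_{<= t} / J_{<= t}, which has dimension m.
   [msize f] is one more than the total degree of f, and 0 if f = 0, so
   S_{<= t} consists of the f with [msize f <= t.+1]. *)
Definition is_hilbert_dim (J : idealr S) (t m : nat) : Prop :=
  exists b : 'I_m -> S,
    (forall i, (msize (b i) <= t.+1)%N) /\
    forall f, (msize f <= t.+1)%N ->
      exists! c : 'rV[K]_m, f - \sum_(i < m) c 0 i *: b i \in J.

(* dim_K (S_{<= t} / J_{<= t}) *)
Definition hilbert_function (J : idealr S) (t : nat) : nat :=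
  xget 0%N [set m | is_hilbert_dim J t m].

Variable R : realType.

Definition multiplicity (J : idealr S) : R :=
  let d := krull_dim {ideal_quot J} in
  d`!%:R * limn (fun t => (hilbert_function J t)%:R / t%:R ^+ d : R).

(* The last condition says that the colon ideal (I : f) differs from I. *)
Definition zero_divisor_forms (I : idealr S) (t : nat) : set S :=
  [set f | [/\ f \is t.-homog for mdeg, f \notin I &
               ~ (forall g, g * f \in I <-> g \in I)]].

(* J = (I, f). As J has type [idealr], it is proper, which is automatic for
   I homogeneous and f in [zero_divisor_forms I t]. *)
Definition is_ideal_adjoin (I : idealr S) (f : S) (J : idealr S) : Prop :=
  forall g, g \in J <-> exists a, g - a * f \in I.

Definition adjoin_multiplicities (I : idealr S) (t : nat) : set R :=
  [set e | exists f (J : idealr S),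
     [/\ zero_divisor_forms I t f, is_ideal_adjoin I f J &
         e = multiplicity J]].

(* The maximum is the element of E that bounds E from above. At t = 0 the set of
   forms is empty, since nonzero constants are not zero divisors modulo I, so
   the value there is e(S/I). The function is integer-valued, seen in R. *)
Definition min_distance (I : idealr S) (t : nat) : R :=
  if pselect (zero_divisor_forms I t !=set0) then
    let E := adjoin_multiplicities I t in
    multiplicity I - xget 0 (E `&` ubound E)
  else multiplicity I.

(* r is the least natural number, 0 included, at which [min_distance] takes its
   limit value; there is none if that function diverges, e.g. to -oo when
   I = (x * y, x * z), for which the dimension of S/(I, y ^ t) drops. *)
Definition is_regularity_index (I : idealr S) (r : nat) : Prop :=
  [/\ cvgn (min_distance I),
      min_distance I r = limn (min_distance I) &
      forall s, min_distance I s = limn (min_distance I) -> (r <= s)%N].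

(* Minimal graded free resolutions of S/I: the i-th module is the direct sum
   of the S(- res_deg i k) for k < res_rank i, its elements are row vectors,
   and the i-th differential, from homological degree i+1 to i, is right
   multiplication by res_diff i. Minimality makes all generator degrees
   nonnegative, so degrees in nat lose nothing. *)
Record min_free_resolution (I : idealr S) := MinFreeResolution {
  res_rank : nat -> nat;
  res_deg : forall i, 'I_(res_rank i) -> nat;
  res_diff : forall i, 'M[S]_(res_rank i.+1, res_rank i);
  res_rank0 : res_rank 0 = 1%N;
  res_deg0 : forall k, res_deg (i := 0%N) k = 0%N;
  res_graded : forall i k l,
    {in msupp (res_diff i k l), forall m,
      (mdeg m + res_deg l)%N = res_deg k};
  res_augmentation : forall v : 'rV[S]_(res_rank 0),
    (forall k, v 0 k \in I) <-> exists w, v = w *m res_diff 0;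
  res_exact : forall i (v : 'rV[S]_(res_rank i.+1)),
    v *m res_diff i = 0 <-> exists w, v = w *m res_diff i.+1;
  res_minimal : forall i k l, mcoeff 0%MM (res_diff i k l) = 0;
  res_finite : exists g, forall i, (g < i)%N -> res_rank i = 0%N
}.

Definition betti (I : idealr S) (F : min_free_resolution I) (i j : nat) : nat :=
  #|[pred k : 'I_(res_rank F i) | res_deg k == j]|.

Definition is_cm_regularity (I : idealr S) (m : int) : Prop :=
  exists F : min_free_resolution I,
    (exists i j, betti F i j != 0%N /\ m = j%:Z - i%:Z) /\
    (forall i j, betti F i j != 0%N -> j%:Z - i%:Z <= m).

End Graded.

(* Main.v *)
(* Write A = S/I and d = dim A.  For a minimal prime P = (I : f1) of maximal dimension, a form f of
   degree s with f P in I and f notin I gives min_distance(t) = its minimum for every t >= s, since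
   (I : f x_j^(t-s)) = P; if I is not unmixed, min_distance tends to -oo.  So it suffices to bound
   the initial degree of (I : P)/I.

   F-purity means that a linear system with p-th power coefficients is solvable modulo I only if the
   system of p-th roots is.  This passes to B = (I : P) + P, of dimension e < d.  If every form of
   degree d in (I : P) were in P, then modulo e generic linear forms l, over K(u), every form x of
   degree d satisfies x^q in B + (l^q) by the pigeonhole principle, hence x in B + (l), hence
   x in P + (l), and P would have dimension at most e.

   If A is Gorenstein, let y_1, ..., y_t be a maximal homogeneous regular sequence on A.  A finite
   injective resolution of the localization yields a duality for J_k = I + (y_1^k, ..., y_t^k): if mu
   is not in an ideal a containing J_k, then some r has r a in J_k and r mu notin J_k.  Hence S/J_k
   has a one-dimensional socle, of degree at most reg + sum (k deg y_i - 1) by the free resolution.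
   Finally P + (y^k) misses a form mu of degree at least k sum deg y_i - d: otherwise Frobenius
   powers would make the top degree of S/(P + (y^(kq))) smaller than kq sum deg y_i by about q, but
   f1 times some form outside P + (y^(kq)) generates the socle of S/J_(kq).  Duality for P + (y^k)
   and mu gives r of degree at most reg with r P in J_k, hence in I when k is large. *)

Require Import Defs.
From HB Require Import structures.
From mathcomp Require Import all_boot all_order all_algebra.
From mathcomp Require Import ring_quotient generic_quotient freeg mpoly.
From mathcomp Require Import boolp classical_sets reals topology normedtype sequences.
From mathcomp Require Import ring zify.
Set Implicit Arguments.
Unset Strict Implicit.
Unset Printing Implicit Defensive.
Import Order.TTheory GRing.Theory Num.Theory numFieldNormedType.Exports.
Local Open Scope ring_scope.

(** * Ideals of a commutative ring *)

Section Ideals.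
Variable A : comNzRingType.

(** K may be finite and imperfect, and Frobenius on S/I need not split. Generic linear forms
    therefore live over K(u), and purity is used only as solvability of finite linear systems, a
    form that passes to (I : P) + P and to K(u) by writing larger systems. The dimension bound rests
    on the gap e < d: products of e linear forms fall into the ideal of q-th powers beyond degree
    e(q - 1), which stays below d q by more than any constant. Dimension and multiplicity are read
    from one cumulative Hilbert polynomial, so exact sequences become polynomial identities; Krull
    dimension is compared with it once. In the Gorenstein case the definition supplies neither a
    canonical module nor Cohen-Macaulayness. Ext(A/J, A) is handled by cocycles annihilated by J,
    and finite length of S/J_k is deduced from duality. The socle degree is bounded through Tor(S/I,
    S/(z_1, ..., z_j)) for parameters z of S that prolong the y: the socle moves from Tor_0 to
    Tor_(n-t), where it is represented in a sum of shifts of a complete intersection with known top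
    degree. *)

Definition is_ideal (J : A -> Prop) :=
  [/\ J 0, forall x y, J x -> J y -> J (x + y) & forall a x, J x -> J (a * x)].

(* Unlike [idealr], the unit ideal is allowed. *)
Record ideal := Ideal { ideal_mem :> A -> Prop; idealP : is_ideal ideal_mem }.

Definition ideal_le (J J' : ideal) := forall x, J x -> J' x.

Lemma ideal_ext (J J' : ideal) : ideal_le J J' -> ideal_le J' J -> J = J'.
Proof.
case: J J' => [J hJ] [J' hJ'] /= h h'.
have e : J = J' by apply/funext => x; apply/propext; split; [exact: h | exact: h'].
by case: _ / e hJ' {h h'} => hJ'; rewrite (Prop_irrelevance hJ hJ').
Qed.

Section Ops.
Variable J : ideal.

Lemma id0 : J 0. Proof. by case: (idealP J). Qed.
Lemma idD x y : J x -> J y -> J (x + y). Proof. by case: (idealP J) => _ + _; apply. Qed.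
Lemma idM a x : J x -> J (a * x). Proof. by case: (idealP J) => _ _; apply. Qed.
Lemma idMr a x : J x -> J (x * a). Proof. by rewrite mulrC; exact: idM. Qed.
Lemma idN x : J x -> J (- x). Proof. by rewrite -mulN1r; exact: idM. Qed.
Lemma idB x y : J x -> J y -> J (x - y). Proof. by move=> *; apply/idD/idN. Qed.
Lemma id_trans x y : J (x - y) -> J y -> J x.
Proof. by move=> h1 h2; rewrite -(subrK y x); exact: idD. Qed.
Lemma id_sym x y : J (x - y) -> J (y - x).
Proof. by move=> /idN; rewrite opprB. Qed.
Lemma id_sum I (r : seq I) (P : pred I) F : (forall i, P i -> J (F i)) -> J (\sum_(i <- r | P i) F i).
Proof. by move=> h; elim/big_rec: _ => [|i x Pi Jx]; [exact: id0 | apply/idD => //; exact: h]. Qed.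
Lemma id1 : J 1 -> forall x, J x.
Proof. by move=> h x; rewrite -[x]mulr1; exact: idM. Qed.

Lemma adj_ideal f : is_ideal (fun g => exists a, J (g - a * f)).
Proof.
split=> [|x y [a h] [b h']|a x [b h]]; first by exists 0; rewrite mul0r subr0; exact: id0.
  by exists (a + b); rewrite mulrDl opprD addrACA; exact: idD.
by exists (a * b); rewrite -mulrA -mulrBr; exact: idM.
Qed.
Definition adj f := Ideal (adj_ideal f).

Lemma col_ideal f : is_ideal (fun g => J (g * f)).
Proof.
split=> [|x y h h'|a x h]; first by rewrite mul0r; exact: id0.
  by rewrite mulrDl; exact: idD.
by rewrite -mulrA; exact: idM.
Qed.
Definition col f := Ideal (col_ideal f).

Lemma colE f g : col f g = J (g * f). Proof. by []. Qed.
Lemma adj_le f : ideal_le J (adj f).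
Proof. by move=> x Jx; exists 0; rewrite mul0r subr0. Qed.
Lemma adj_self f : adj f f.
Proof. by exists 1; rewrite mul1r subrr; exact: id0. Qed.
Lemma col_le f : ideal_le J (col f).
Proof. by move=> x Jx; rewrite colE; exact: idMr. Qed.

Lemma colI_ideal (Q : A -> Prop) : is_ideal (fun g => forall q, Q q -> J (g * q)).
Proof.
split=> [q _|x y h h' q Qq|a x h q Qq]; first by rewrite mul0r; exact: id0.
  by rewrite mulrDl; apply: idD; [exact: h | exact: h'].
by rewrite -mulrA; apply/idM/h.
Qed.
Definition colI Q := Ideal (colI_ideal Q).

End Ops.

Lemma adj_sub (J J' : ideal) f : ideal_le J J' -> J' f -> ideal_le (adj J f) J'.
Proof. by move=> h h' x [a /h Ha]; apply: id_trans Ha _; exact: idM. Qed.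

Lemma adj_mono (J J' : ideal) f : ideal_le J J' -> ideal_le (adj J f) (adj J' f).
Proof. by move=> h x [a Ha]; exists a; exact: h. Qed.

Lemma adjC (J : ideal) f g : adj (adj J f) g = adj (adj J g) f.
Proof.
have H (a b : A) : ideal_le (adj (adj J a) b) (adj (adj J b) a).
  apply: adj_sub; last by apply: adj_le; exact: adj_self.
  exact/adj_mono/adj_le.
by apply: ideal_ext; exact: H.
Qed.

Lemma addI_ideal (J J' : ideal) : is_ideal (fun g => exists2 x, J x & J' (g - x)).
Proof.
split=> [|x y [a h1 h2] [b h3 h4]|a x [b h1 h2]].
- by exists 0; rewrite ?subr0; exact: id0.
- by exists (a + b); [exact: idD | rewrite opprD addrACA; exact: idD].
- by exists (a * b); [exact: idM | rewrite -mulrBr; exact: idM].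
Qed.
Definition addI J J' := Ideal (addI_ideal J J').

Lemma addI_lel (J J' : ideal) : ideal_le J (addI J J').
Proof. by move=> x h; exists x => //; rewrite subrr; exact: id0. Qed.
Lemma addI_ler (J J' : ideal) : ideal_le J' (addI J J').
Proof. by move=> x h; exists 0; [exact: id0 | rewrite subr0]. Qed.
Definition isprime (J : ideal) :=
  ~ J 1 /\ forall a b, J (a * b) -> J a \/ J b.

Definition isradical (J : ideal) := forall a, J (a * a) -> J a.

Lemma isprime_exp (J : ideal) a k : isprime J -> J (a ^+ k) -> J a.
Proof.
move=> [h1 h2]; elim: k => [|k IH]; first by rewrite expr0.
by rewrite exprS => /h2[].
Qed.

Definition adjs (J : ideal) (s : seq A) := foldl adj J s.

Lemma adjs_le J s : ideal_le J (adjs J s).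
Proof.
elim: s J => [|a s IH] J //= x Jx; apply: IH; exact: adj_le.
Qed.

Lemma adjs_mem J s x : x \in s -> adjs J s x.
Proof.
elim: s J => [|a s IH] J //=; rewrite inE => /predU1P[->|]; last exact: IH.
by apply: adjs_le; exact: adj_self.
Qed.

Lemma adjs_sub (J J' : ideal) s : ideal_le J J' -> (forall x, x \in s -> J' x) -> ideal_le (adjs J s) J'.
Proof.
elim: s J => [|a s IH] J //= h h'; apply: IH => [|x xs].
  by apply: adj_sub => //; apply: h'; rewrite inE eqxx.
by apply: h'; rewrite inE xs orbT.
Qed.

Lemma adjs_mono (J J' : ideal) s : ideal_le J J' -> ideal_le (adjs J s) (adjs J' s).
Proof.
by move=> h; apply: adjs_sub => [x /h|x]; [exact: adjs_le | exact: adjs_mem].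
Qed.

Lemma eq_adjs (J : ideal) s1 s2 : s1 =i s2 -> adjs J s1 = adjs J s2.
Proof.
move=> e; apply: ideal_ext; apply: adjs_sub; try exact: adjs_le;
  by move=> x xs; apply: adjs_mem; rewrite ?e // -e.
Qed.

Lemma adjs_rcons J s a : adjs J (rcons s a) = adj (adjs J s) a.
Proof. by rewrite /adjs foldl_rcons. Qed.

Lemma adjsP J s x : adjs J s x <->
  exists c : 'I_(size s) -> A, J (x - \sum_i c i * s`_i).
Proof.
split; last first.
  move=> [c] /(adjs_le s) h; apply: id_trans h _; apply: id_sum => i _.
  by apply/idM/adjs_mem/mem_nth.
elim: s J x => [|a s IH] J x /=.
  by move=> Jx; exists (fun=> 0); rewrite big_ord0 subr0.
move=> /IH[c [b Jb]].
exists (fun i => oapp c b (unlift ord0 i)).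
rewrite big_ord_recl /= unlift_none /=.
under eq_bigr => i _ do rewrite liftK /=.
by rewrite [b * a + _]addrC opprD addrA.
Qed.

(** * Noetherian rings *)

Definition acc := forall J : nat -> ideal,
  (forall i, ideal_le (J i) (J i.+1)) -> exists i, ideal_le (J i.+1) (J i).

(** Dependent choice turns a counterexample into a strictly ascending chain. The condition [acc] is
    supplied for polynomial rings by [mpoly_acc] and for their localizations by [push_acc]. *)
Lemma noeth_ind (P : ideal -> Prop) : acc ->
  (forall J, (forall J', ideal_le J J' -> ~ ideal_le J' J -> P J') -> P J) -> forall J, P J.
Proof.
move=> hacc hP J0; apply: contrapT => nP0.
have step (J : {J | ~ P J}) : {J' : {J | ~ P J} | ideal_le (sval J) (sval J') /\ ~ ideal_le (sval J') (sval J)}.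
  case: J => J nPJ; apply: cid; apply: contrapT => h; apply: (nPJ); apply: hP => J' h1 h2.
  by apply: contrapT => nP'; apply: h; exists (exist _ J' nP').
pose F := fix F i := if i is i'.+1 then sval (step (F i')) else exist (fun J => ~ P J) J0 nP0.
have [i] := hacc (fun i => sval (F i)) (fun i => (svalP (step (F i))).1).
exact: (svalP (step (F i))).2.
Qed.

Lemma acc_fg : acc -> forall J : ideal, exists s : seq A, forall x, J x <->
  exists c : 'I_(size s) -> A, x = \sum_i c i * s`_i.
Proof.
move=> hacc J.
have zero_ideal : is_ideal (fun x => x = 0).
  by split=> // [x y -> ->|a x ->]; rewrite ?addr0 ?mulr0.
(* Generalizing over an ideal below [J] lets Noetherian induction add one generator at a time,
   starting from zero. *)
suff H (J0 : ideal) : ideal_le J0 J -> exists2 s, J = adjs J0 s & forall x, x \in s -> J x.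
  have [|s -> hs] := H (Ideal zero_ideal); first by move=> x ->; exact: id0.
  exists s => x; rewrite adjsP; split=> -[c] h; exists c.
    by apply/eqP; rewrite -subr_eq0; apply/eqP.
  by rewrite /= h subrr.
move: J0; apply: (noeth_ind hacc) => J0 IH h0.
have [h|/existsNP[x /not_implyP[Jx J0x]]] := pselect (ideal_le J J0).
  by exists [::] => //=; exact: ideal_ext.
have [| |s -> hs] := IH (adj J0 x) (@adj_le J0 x).
- by move=> /(_ x (adj_self _ _)).
- exact: adj_sub.
exists (x :: s) => // y; rewrite inE => /predU1P[->|/hs] //.
  by apply: adjs_le; exact: adj_self.
Qed.

End Ideals.

(** Repeatedly picking an index at which [u] is minimal on the remaining tail gives a nondecreasing
    subsequence. *)
Lemma dickson_seq (u : nat -> nat) : exists phi : nat -> nat,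
  (forall i j, (i < j)%N -> (phi i < phi j)%N) /\
  (forall i j, (i <= j)%N -> (u (phi i) <= u (phi j))%N).
Proof.
have /choice[g hg] N : exists i, (N <= i)%N /\ forall j, (N <= j)%N -> (u i <= u j)%N.
  have ex : exists v, `[< exists2 i, (N <= i)%N & u i = v >].
    by exists (u N); apply/asboolP; exists N.
  case: (ex_minnP ex) => v /asboolP[i hi <-] hv; exists i; split=> // j hj.
  by apply: hv; apply/asboolP; exists j.
pose phi := fix phi i := if i is i'.+1 then g (phi i').+1 else g 0%N.
have lt1 i : (phi i < phi i.+1)%N by case: (hg (phi i).+1).
have lt : forall i j, (i < j)%N -> (phi i < phi j)%N := homo_ltn (@ltn_trans) lt1.
exists phi; split=> // i j; rewrite leq_eqVlt => /predU1P[-> //|ij].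
by case: i ij => [|i] ij; [apply: (hg 0%N).2 | apply: (hg (phi i).+1).2; apply: lt; lia].
Qed.

Lemma dickson n (a : nat -> 'X_{1..n}) : exists i j, (i < j)%N /\ (a i <= a j)%MM.
Proof.
suff H k : exists phi : nat -> nat, (forall i j, (i < j)%N -> (phi i < phi j)%N) /\
    forall c : 'I_n, (c < k)%N -> forall i j, (i <= j)%N -> (a (phi i) c <= a (phi j) c)%N.
  have [phi [h1 h2]] := H n; exists (phi 0%N), (phi 1%N); split; first exact: h1.
  by apply/mnm_lepP => c; exact: h2.
elim: k => [|k [phi [h1 h2]]]; first by exists id.
have [kn|kn] := ltnP k n; last by exists phi; split=> // c ck; apply: h2; have := ltn_ord c; lia.
have [psi [h3 h4]] := dickson_seq (fun i => a (phi i) (Ordinal kn)).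
exists (phi \o psi); split=> [i j ij|c]; first by apply/h1/h3.
rewrite ltnS leq_eqVlt => /predU1P[ck|ck] i j ij.
  by have -> : c = Ordinal kn by [exact: val_inj]; exact: h4.
apply: h2 => //; move: ij; rewrite leq_eqVlt => /predU1P[-> //|/h3]; exact: ltnW.
Qed.

(** Hilbert's basis theorem by leading monomials: an element of [J i.+1] outside [J i] with least
    leading monomial cannot have it divisible by a leading monomial from [J i]. A strict chain would
    yield a sequence of monomials contradicting [dickson]. *)
Lemma mpoly_acc (K : fieldType) n : acc {mpoly K[n]}.
Proof.
move=> J hJ; apply: contrapT => /forallNP h.
have mono i j : (i <= j)%N -> ideal_le (J i) (J j).
  by move/subnK => <-; elim: (j - i)%N => [|k IH] x // /IH /hJ.
have /choice[f hf] i : exists f, [/\ J i.+1 f, f != 0 &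
    forall g, J i g -> g != 0 -> ~~ (mlead g <= mlead f)%MM].
  pose bad (m : 'X_{1..n}) := exists f, [/\ J i.+1 f, ~ J i f & mlead f = m].
  suff [m [f [h1 h2 h3]] hm] : exists2 m, bad m & forall m', (m' < m)%O -> ~ bad m'.
    have f0 : f != 0 by apply: contra_notN h2 => /eqP ->; exact: id0.
    exists f; split=> // g Jg g0; apply/negP => le.
    (* [q] cancels the leading term of [f], so [f - q] would be a smaller element outside [J i]. *)
    pose c := mleadc f / mleadc g; pose q := (c *: 'X_[mlead f - mlead g]) * g.
    have c0 : c != 0 by rewrite mulf_neq0 ?invr_eq0 ?mleadc_eq0.
    have Jq : J i q by exact: idM.
    have lq : mlead q = mlead f.
      by rewrite mleadM ?mleadZ ?mleadXm ?submK // scaler_eq0 negb_or c0 -mpolyC0 -msupp_eq0 msuppX.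
    have nJ : ~ J i (f - q) by move=> /id_trans /(_ Jq).
    have fq0 : f - q != 0 by apply: contra_notN nJ => /eqP ->; exact: id0.
    apply: (hm (mlead (f - q))); last first.
      by exists (f - q); split=> //; apply: idB => //; exact: hJ.
    rewrite lt_neqAle; apply/andP; split; last first.
      by rewrite -h3; apply: le_trans (mleadB_le _ _) _; rewrite lq joinxx.
    apply: contraNneq fq0 => e; rewrite -mleadc_eq0 e -h3 mcoeffB /q -scalerAl mcoeffZ.
    have -> : ('X_[mlead f - mlead g] * g)@_(mlead f) = mleadc g.
      by rewrite mulrC -[X in _@_X](submK le) mcoeffMX.
    by rewrite /c divfK ?subrr // mleadc_eq0.
  have [f /not_implyP[Jf nJf]] : exists f, ~ (J i.+1 f -> J i f).
    by apply/existsNP => hh; apply: (h i) => x; exact: hh.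
  move: (mlead f) (ex_intro _ f (And3 Jf nJf erefl) : bad (mlead f)).
  move=> m; elim/(well_founded_ind (@ltom_wf n)): m => m IH bm.
  have [[m' lt bm']|hm] := pselect (exists2 m', (m' < m)%O & bad m'); first exact: IH bm'.
  by exists m => // m' lt bm'; apply: hm; exists m'.
have [i [j [ij le]]] := dickson (fun i => mlead (f i)).
case: (hf i) => Ji i0 _; case: (hf j) => _ _ /(_ (f i)); rewrite le => H.
by have := H (mono _ _ ij _ Ji) i0.
Qed.

(** * Homogeneous ideals *)

Section Homogeneous.
Variables (K : fieldType) (n : nat).
Local Notation S := {mpoly K[n]}.
Local Notation hc := (pihomog mdeg).
Implicit Types (J : ideal S) (f g : S).

Definition hom J := forall f d, J f -> J (hc d f).

Lemma idZ J (c : K) f : J f -> J (c *: f).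
Proof. by rewrite -mul_mpolyC; exact: idM. Qed.

Lemma hc_ge d f : (msize f <= d)%N -> hc d f = 0.
Proof.
move=> h; rewrite pihomogE big_seq_cond big1 // => m /andP[/msize_mdeg_lt lt /eqP e].
by move: lt; rewrite e ltnNge h.
Qed.

Lemma msize_form d f : f \is d.-homog for mdeg -> (msize f <= d.+1)%N.
Proof.
move=> /dhomogP h; rewrite msizeE; apply/bigmax_leqP_seq => m mf _.
by rewrite (h m mf).
Qed.

Lemma msize_hc d f : (msize (hc d f) <= d.+1)%N.
Proof. exact/msize_form/pihomogP. Qed.

Lemma msize_mul_le f g s t : (msize f <= s.+1)%N -> (msize g <= t.+1)%N ->
  (msize (f * g) <= (s + t).+1)%N.
Proof.
have [->|f0] := eqVneq f 0; first by rewrite mul0r mmeasure0.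
have [->|g0] := eqVneq g 0; first by rewrite mulr0 mmeasure0.
rewrite msizeM //. move: (msize f) (msize g) => a b. lia.
Qed.

Lemma hcMf d k (a f : S) : f \is k.-homog for mdeg ->
  hc d (a * f) = if (k <= d)%N then hc (d - k) a * f else 0.
Proof.
move=> hf; rewrite {1}(pihomog_partitionE (leqnn (mmeasure mdeg a))) mulr_suml raddf_sum /=.
have E (i : nat) : hc d (hc i a * f) = if (i + k == d)%N then hc i a * f else 0.
  have h : hc i a * f \is (i + k).-homog for mdeg by apply: dhomogM => //; exact: pihomogP.
  by case: eqP => [<-|/eqP ne]; [exact: pihomog_dE | exact: pihomog_ne0 h].
under eq_bigr => i _ do rewrite E.
case: leqP => [kd|kd]; last by rewrite big1 // => i _; case: eqP => // e; lia.
have [lt|ge] := ltnP (d - k) (msize a).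
  rewrite (bigD1 (Ordinal lt)) //= subnK // eqxx big1 ?addr0 // => i /eqP ni.
  by case: eqP => // e; case: ni; apply: val_inj => /=; lia.
rewrite hc_ge // mul0r big1 // => i _; case: eqP => // e; have := ltn_ord i; lia.
Qed.

Lemma hcM_top s t (a b : S) : (msize a <= s.+1)%N -> (msize b <= t.+1)%N ->
  hc (s + t) (a * b) = hc s a * hc t b.
Proof.
move=> ha hb; rewrite {1}(pihomog_partitionE ha) mulr_suml raddf_sum /= (bigD1 ord_max) //=.
rewrite mulrC (hcMf _ _ (pihomogP _ _ _)) leq_addr addKn mulrC big1 ?addr0 // => i.
move=> /eqP ni; rewrite mulrC (hcMf _ _ (pihomogP _ _ _)).
case: leqP => // le; rewrite hc_ge ?mul0r //.
have : (i < s)%N; last by lia.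
by have := ltn_ord i; rewrite ltnS leq_eqVlt => /predU1P[e|//]; case: ni; exact: val_inj.
Qed.

Lemma id_hc J f : (forall d, J (hc d f)) -> J f.
Proof. by move=> h; rewrite (pihomog_partitionE (leqnn (msize f))); exact: id_sum. Qed.

Lemma hom_le J J' : hom J -> (forall f d, f \is d.-homog for mdeg -> J f -> J' f) -> ideal_le J J'.
Proof. by move=> hJ h f Jf; apply: id_hc => d; apply: h (pihomogP _ _ _) _; exact: hJ. Qed.

Lemma hom_notin J f : hom J -> ~ J f -> exists d, ~ J (hc d f).
Proof. by move=> hJ nJ; apply/existsNP => h; apply: nJ; exact: id_hc. Qed.

Lemma hom_adj J k f : hom J -> f \is k.-homog for mdeg -> hom (adj J f).
Proof.
move=> hJ hf g d [a /(hJ _ d)]; rewrite raddfB /= (hcMf _ _ hf).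
case: leqP => _ h; first by exists (hc (d - k) a).
by exists 0; rewrite mul0r.
Qed.

Lemma hom_col J k f : hom J -> f \is k.-homog for mdeg -> hom (col J f).
Proof.
move=> hJ hf g d; rewrite !colE => /(hJ _ (d + k)%N).
by rewrite (hcMf _ _ hf) leq_addl addnK.
Qed.

Lemma hom_addI J J' : hom J -> hom J' -> hom (addI J J').
Proof.
by move=> hJ hJ' g d [x Jx h]; exists (hc d x); [exact: hJ | rewrite -raddfB; exact: hJ'].
Qed.

Lemma hom_colI J J' : hom J -> hom J' -> hom (colI J J').
Proof.
move=> hJ hJ' g d h q Jq; rewrite (pihomog_partitionE (leqnn (msize q))) mulr_sumr.
apply: id_sum => i _; have /(hJ _ (d + i)%N) := h _ (hJ' _ i Jq).
by rewrite (hcMf _ _ (pihomogP _ _ _)) leq_addl addnK.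
Qed.

(** The top component of a product is the product of the top components. If it lies in J, so does
    one of these two factors, which is subtracted; the degrees go down. *)
Lemma hom_prime J : hom J -> ~ J 1 ->
  (forall (a b : S) d e, a \is d.-homog for mdeg -> b \is e.-homog for mdeg ->
    J (a * b) -> J a \/ J b) -> isprime J.
Proof.
move=> hJ J1 h; split=> // a b.
have [N] := ubnP (msize a + msize b); elim: N a b => // N IH a b le Jab.
have [->|a0] := eqVneq a 0; first by left; exact: id0.
have [->|b0] := eqVneq b 0; first by right; exact: id0.
have ra d (c : S) : c != 0 -> (msize c = d.+1)%N -> (msize (c - hc d c) < msize c)%N.
  move=> c0 sc; rewrite sc ltnS {1}(pihomog_partitionE (leqnn (msize c))) sc.
  rewrite big_ord_recr /= addrK; apply: leq_trans (mmeasure_sum _ _ _ _) _.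
  by apply/bigmax_leqP => i _; apply: leq_trans (msize_hc _ _) _.
have [s sa] : exists s, msize a = s.+1 by exists (msize a).-1; rewrite -mpolySpred.
have [t tb] : exists t, msize b = t.+1 by exists (msize b).-1; rewrite -mpolySpred.
have := hJ _ (s + t)%N Jab; rewrite hcM_top ?sa ?tb // => /h-/(_ _ _ (pihomogP _ _ _) (pihomogP _ _ _)).
case=> [Ja|Jb].
  have [||/id_trans /(_ Ja)|] := IH (a - hc s a) b; [|by rewrite mulrBl; apply: idB => //; exact: idMr|by left|by right].
  by rewrite -ltnS; apply: leq_trans le; rewrite ltnS ltn_add2r; exact: ra sa.
have [||Ja|/id_trans /(_ Jb) Jb'] := IH a (b - hc t b);
  [|by rewrite mulrBr; apply: idB => //; exact: idM|by left|by right].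
by rewrite -ltnS; apply: leq_trans le; rewrite ltnS ltn_add2l; exact: ra tb.
Qed.

(** * Hilbert functions *)

Definition lc m (b : 'I_m -> S) (c : 'rV[K]_m) : S := \sum_i c 0 i *: b i.

Definition indep J m (b : 'I_m -> S) := forall c, J (lc b c) -> c = 0.

Definition spans J m (b : 'I_m -> S) f := exists c, J (f - lc b c).

Lemma lcD m (b : 'I_m -> S) c d : lc b (c + d) = lc b c + lc b d.
Proof. by rewrite -big_split; apply: eq_bigr => i _; rewrite mxE scalerDl. Qed.
Lemma lcZ m (b : 'I_m -> S) k c : lc b (k *: c) = k *: lc b c.
Proof. by rewrite scaler_sumr; apply: eq_bigr => i _; rewrite mxE scalerA. Qed.
Lemma lc0 m (b : 'I_m -> S) : lc b 0 = 0.
Proof. by rewrite -(scale0r (0 : 'rV_m)) lcZ scale0r. Qed.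

Lemma spans0 J m (b : 'I_m -> S) : spans J b 0.
Proof. by exists 0; rewrite lc0 subr0; exact: id0. Qed.
Lemma spansD J m (b : 'I_m -> S) f g : spans J b f -> spans J b g -> spans J b (f + g).
Proof. by move=> [c h] [d h']; exists (c + d); rewrite lcD opprD addrACA; exact: idD. Qed.
Lemma spansZ J m (b : 'I_m -> S) k f : spans J b f -> spans J b (k *: f).
Proof. by move=> [c h]; exists (k *: c); rewrite lcZ -scalerBr; exact: idZ. Qed.
Lemma spans_sum J m (b : 'I_m -> S) I (r : seq I) (P : pred I) F :
  (forall i, P i -> spans J b (F i)) -> spans J b (\sum_(i <- r | P i) F i).
Proof. by move=> h; elim/big_rec: _ => [|i x Pi]; [exact: spans0 | apply/spansD/h]. Qed.

(** If [m' > m], the matrix expressing [b'] in terms of [b] has a nonzero left kernel vector, which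
    is a forbidden relation modulo J. *)
Lemma steinitz J m m' (b : 'I_m -> S) (b' : 'I_m' -> S) :
  indep J b' -> (forall i, spans J b (b' i)) -> (m' <= m)%N.
Proof.
move=> ind /choice[C hC]; pose M := \matrix_(i < m', j < m) C i 0 j.
rewrite leqNgt; apply/negP => lt.
have : \rank (kermx M) != 0%N by rewrite mxrank_ker; have := rank_leq_col M; lia.
rewrite mxrank_eq0 => /rowV0Pn[v /sub_kermxP vM v0].
case/negP: v0; apply/eqP/ind.
have -> : lc b' v = \sum_i v 0 i *: (b' i - lc b (C i)).
  under [RHS]eq_bigr => i _ do rewrite scalerBr.
  rewrite big_split /= sumrN -[LHS]subr0; congr (_ - _); apply/esym.
  have -> : \sum_i v 0 i *: lc b (C i) = lc b (v *m M).
    rewrite /lc; under eq_bigr => i _ do rewrite scaler_sumr.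
    rewrite exchange_big; apply: eq_bigr => j _; rewrite !mxE scaler_suml.
    by apply: eq_bigr => i _; rewrite scalerA mxE.
  by rewrite vM lc0.
by apply: id_sum => i _; exact: idZ.
Qed.

Lemma indep_spans J (s : seq S) : exists m (b : 'I_m -> S),
  [/\ forall i, b i \in s, indep J b & forall x, x \in s -> spans J b x].
Proof.
elim: s => [|x s [m [b [h1 h2 h3]]]].
  by exists 0%N, (fun=> 0); split=> // [[]//|c _]; apply/rowP => -[].
have [hx|hx] := pselect (spans J b x).
  exists m, b; split=> // [i|y]; rewrite inE ?h1 ?orbT //.
  by case/predU1P => [->//|]; exact: h3.
pose b' := fun i : 'I_m.+1 => oapp b x (unlift ord0 i).
have lcE (c : 'rV[K]_m.+1) : lc b' c = c 0 ord0 *: x + lc b (\row_j c 0 (fintype.lift ord0 j)).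
  rewrite /lc big_ord_recl /b' unlift_none; congr (_ + _).
  by apply: eq_bigr => i _; rewrite liftK mxE.
exists m.+1, b'; split=> [i|c|y].
- by rewrite /b'; case: unliftP => [j|] _; rewrite inE ?eqxx //= h1 orbT.
- rewrite lcE => Jc; have [c0|c0] := eqVneq (c 0 ord0) 0.
    move: Jc; rewrite c0 scale0r add0r => /h2 /rowP e.
    apply/rowP => i; rewrite mxE; case: (unliftP ord0 i) => [j ->|-> //].
    by have := e j; rewrite !mxE.
  case: hx; exists (- (c 0 ord0)^-1 *: \row_j c 0 (fintype.lift ord0 j)).
  rewrite lcZ scaleNr opprK; have := idZ (c 0 ord0)^-1 Jc.
  by rewrite scalerDr scalerA mulVf // scale1r.
- rewrite inE => /predU1P[->|/h3[c hc]].
    exists (delta_mx 0 ord0); rewrite lcE mxE !eqxx scale1r opprD addNKr.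
    have -> : \row_j (delta_mx 0 ord0 : 'rV[K]_m.+1) 0 (fintype.lift ord0 j) = 0 :> 'rV[K]_m.
      by apply/rowP => j; rewrite !mxE.
    by rewrite lc0 oppr0; exact: id0.
  exists (\row_i oapp (c 0) 0 (unlift ord0 i)); rewrite lcE mxE unlift_none /= scale0r add0r.
  have -> // : \row_j (\row_i oapp (c 0) 0 (unlift ord0 i)) 0 (fintype.lift ord0 j) = c.
  by apply/rowP => j; rewrite !mxE liftK.
Qed.

Definition hbasis J t m (b : 'I_m -> S) := [/\ forall i, (msize (b i) <= t.+1)%N, indep J b &
  forall f, (msize f <= t.+1)%N -> spans J b f].

Lemma hbasis_ex J t : exists m (b : 'I_m -> S), hbasis J t b.
Proof.
have [m [b [h1 h2 h3]]] := indep_spans J [seq 'X_[m] | m : 'X_{1..n < t.+1}].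
exists m, b; split=> // [i|f hf].
  by have /mapP[/= mm _ ->] := h1 i; rewrite msizeX bmdeg.
rewrite (mpolywE hf); apply: spans_sum => mm _; apply/spansZ/h3.
by apply: map_f; rewrite mem_enum.
Qed.

Definition hilb J t : nat := xget 0%N [set m | exists b : 'I_m -> S, hbasis J t b].

Lemma hilbP J t : exists b : 'I_(hilb J t) -> S, hbasis J t b.
Proof. by have [m h] := hbasis_ex J t; exact: (@xgetI _ 0%N [set m | exists b : 'I_m -> S, hbasis J t b] m h). Qed.

Lemma indep_hilb J t m (b : 'I_m -> S) : (forall i, (msize (b i) <= t.+1)%N) -> indep J b ->
  (m <= hilb J t)%N.
Proof. by have [b' [_ _ h]] := hilbP J t => h1 h2; apply: steinitz h2 _ => i; exact: h. Qed.

Lemma hbasis_hilb J t m (b : 'I_m -> S) : hbasis J t b -> hilb J t = m.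
Proof.
move=> [h1 h2 h3]; apply/eqP; rewrite eqn_leq (indep_hilb h1 h2) andbT.
by have [b' [h1' h2' h3']] := hilbP J t; apply: steinitz h2' _ => i; exact: h3.
Qed.

Lemma hilb_mono J J' t : ideal_le J J' -> (hilb J' t <= hilb J t)%N.
Proof.
by move=> le; have [b [h1 h2 _]] := hilbP J' t; apply: indep_hilb h1 _ => c /le /h2.
Qed.

Lemma hilb_homo J t t' : (t <= t')%N -> (hilb J t <= hilb J t')%N.
Proof.
move=> le; have [b [h1 h2 _]] := hilbP J t; apply: indep_hilb h2 => i.
by apply: leq_trans (h1 i) _.
Qed.

Lemma hilb_unit J t : J 1 -> hilb J t = 0%N.
Proof.
move=> /id1 J1; apply: (@hbasis_hilb _ _ _ (fun i : 'I_0 => 0)); split=> [[]//|c _|f _].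
  by apply/rowP => -[].
by exists 0.
Qed.

Lemma hilb_gt0 J t : ~ J 1 -> (0 < hilb J t)%N.
Proof.
move=> J1; apply: (@indep_hilb _ _ 1 (fun=> 1)) => [_|c]; first by rewrite msize1.
rewrite /lc big_ord1 => h; apply/rowP => i; rewrite ord1 mxE.
apply/eqP; apply: contra_notT J1 => c0.
by have := idZ (c 0 0)^-1 h; rewrite scalerA mulVf // scale1r.
Qed.

Lemma lc_cat m1 m2 (b1 : 'I_m1 -> S) (b2 : 'I_m2 -> S) c :
  lc (fun i => match split i with inl j => b1 j | inr j => b2 j end) c =
  lc b1 (lsubmx c) + lc b2 (rsubmx c).
Proof.
rewrite /lc big_split_ord; congr (_ + _); apply: eq_bigr => i _; rewrite mxE.
  by rewrite (unsplitK (inl i)).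
by rewrite (unsplitK (inr i)).
Qed.

Lemma lcM m (b : 'I_m -> S) f c : lc (fun i => b i * f) c = lc b c * f.
Proof. by rewrite mulr_suml; apply: eq_bigr => i _; rewrite scalerAl. Qed.

(* The exact sequence [S/(J:f)(-k) -> S/J -> S/(J,f)]. *)
Lemma hilb_adj J k f t : hom J -> f \is k.-homog for mdeg ->
  hilb J t = (hilb (adj J f) t + (if (k <= t)%N then hilb (col J f) (t - k) else 0))%N.
Proof.
move=> hJ hf; have [b1 [h1 h2 h3]] := hilbP (adj J f) t.
(* By homogeneity the multiplier [a] can be truncated at degree [t - k], or replaced by 0 when
   [t < k]. *)
have hcut g : (msize g <= t.+1)%N -> adj J f g ->
    exists a, J (g - a * f) /\ if (k <= t)%N then (msize a <= (t - k).+1)%N else a == 0.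
  move=> sg [a Ja]; case: leqP => [kt|kt].
    exists (\sum_(d < (t - k).+1) hc d a); split; last first.
      apply: leq_trans (mmeasure_sum _ _ _ _) _; apply/bigmax_leqP => i _.
      exact: leq_trans (msize_hc _ _) (ltn_ord i).
    apply: id_hc => d; have := hJ _ d Ja; rewrite !raddfB /= !(hcMf _ _ hf).
    case: ifP => // kd; have [le|gt] := leqP d t.
      have -> // : hc (d - k) (\sum_(i < (t - k).+1) hc i a) = hc (d - k) a.
      have lt : (d - k < (t - k).+1)%N by lia.
      rewrite raddf_sum /= (bigD1 (Ordinal lt)) //= pihomog_id big1 ?addr0 // => i /eqP ni.
      apply: pihomog_ne0 (pihomogP _ _ _); apply/eqP => e; apply: ni; exact: val_inj.
    rewrite raddf_sum /= big1 ?mul0r => [|i _]; last first.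
      by apply: pihomog_ne0 (pihomogP _ _ _); have := ltn_ord i; lia.
    by rewrite hc_ge ?sub0r ?subrr ?oppr0 => [_|]; [exact: id0 | exact: leq_trans sg _].
  exists 0; split=> //; rewrite mul0r subr0; apply: id_hc => d.
  have := hJ _ d Ja; rewrite raddfB /= (hcMf _ _ hf); case: ifP => [kd _|_]; last by rewrite subr0.
  by rewrite hc_ge; [exact: id0 | apply: leq_trans sg _; exact: leq_trans kd].
case: leqP hcut => [kt|kt] hcut; last first.
  rewrite addn0; apply: (@hbasis_hilb _ _ _ b1); split; first exact: h1.
    by move=> c Jc; apply: h2; exact: adj_le.
  move=> g sg; have [c hc] := h3 g sg; exists c.
  have [|a []] := hcut _ _ hc; last by move=> + /eqP a0; rewrite a0 mul0r subr0.
  apply: leq_trans (mmeasureD_le _ _ _) _; rewrite geq_max sg msizeN.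
  apply: leq_trans (mmeasure_sum _ _ _ _) _; apply/bigmax_leqP => i _.
  by apply: leq_trans (mmeasureZ_le _ _ _) _.
have [b2 [h4 h5 h6]] := hilbP (col J f) (t - k).
apply: (@hbasis_hilb _ _ _ (fun i => match split i with inl j => b1 j | inr j => b2 j * f end)).
split=> [i|c|g sg].
- case: split => j //; apply: leq_trans (msize_mul_le (h4 j) (msize_form hf)) _.
  by rewrite subnK.
- rewrite lc_cat (lcM b2) => h.
  have c1 : lsubmx c = 0 by apply: h2; exists (- lc b2 (rsubmx c)); rewrite mulNr opprK.
  move: h; rewrite c1 lc0 add0r => /h5 c2.
  by rewrite -[c]hsubmxK c1 c2 row_mx0.
have [c1 hc1] := h3 g sg.
have [|a [Ja sa]] := hcut _ _ hc1.
  apply: leq_trans (mmeasureD_le _ _ _) _; rewrite geq_max sg msizeN.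
  apply: leq_trans (mmeasure_sum _ _ _ _) _; apply/bigmax_leqP => i _.
  by apply: leq_trans (mmeasureZ_le _ _ _) _.
have [c2 hc2] := h6 a sa.
exists (row_mx c1 c2); rewrite lc_cat row_mxKl row_mxKr (lcM b2).
have -> : g - (lc b1 c1 + lc b2 c2 * f) = (g - lc b1 c1 - a * f) + (a - lc b2 c2) * f.
  by ring.
exact: idD.
Qed.

(** Multiplication by [f] embeds S/P into Q/P. Krull chains consist of arbitrary primes, so nothing
    is assumed homogeneous and [f] has only a degree bound. *)
Lemma hilb_prime (P Q : ideal S) f k t : isprime P -> ideal_le P Q -> Q f -> ~ P f ->
  (msize f <= k.+1)%N -> (hilb Q (t + k) + hilb P t <= hilb P (t + k))%N.
Proof.
move=> [_ pP] le Qf nPf sf.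
have [b1 [h1 h2 _]] := hilbP Q (t + k); have [b2 [h3 h4 _]] := hilbP P t.
apply: (@indep_hilb _ _ _ (fun i => match split i with inl j => b1 j | inr j => b2 j * f end)).
  by move=> i; case: split => j //; apply: msize_mul_le.
move=> c; rewrite lc_cat (lcM b2) => h.
have c1 : lsubmx c = 0.
  by apply: h2; rewrite -(addrK (lc b2 (rsubmx c) * f) (lc b1 _)); apply/idB/idM => //; exact: le.
move: h; rewrite c1 lc0 add0r => /pP[/h4 c2|//].
by rewrite -[c]hsubmxK c1 c2 row_mx0.
Qed.

End Homogeneous.

(** * Growth of polynomial sequences *)

Section Growth.
Local Open Scope classical_set_scope.
Variable R : realType.
Implicit Types p q : {poly R}.

(** Backward difference with step k: the effect on a Hilbert polynomial of factoring out a
    nonzerodivisor of degree k ([hp_adj_regular]). *)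
Definition dl (k : nat) (p : {poly R}) : {poly R} := p - (p \Po ('X - k%:R%:P)).

Lemma horner_dl k p x : (dl k p).[x] = p.[x] - p.[x - k%:R].
Proof. by rewrite /dl hornerD hornerN horner_comp !hornerE. Qed.

Lemma dlD k p q : dl k (p + q) = dl k p + dl k q.
Proof. by rewrite /dl comp_polyD opprD addrACA. Qed.

Lemma dlZ k c p : dl k (c *: p) = c *: dl k p.
Proof. by rewrite /dl comp_polyZ scalerBr. Qed.

Lemma dlXn k d : (size (dl k 'X^(d.+1)) <= d.+1)%N /\ (dl k 'X^(d.+1))`_d = k%:R * d.+1%:R.
Proof.
have -> : dl k 'X^(d.+1) = k%:R *: \sum_(i < d.+1) 'X^(d - i) * ('X - k%:R%:P) ^+ i.
  rewrite /dl comp_Xn_poly subrXX -mul_polyC; congr (_ * _); ring.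

have mon (i : 'I_d.+1) : ('X^(d - i) * ('X - k%:R%:P) ^+ i : {poly R}) \is monic.
  by rewrite monicMl ?monicXn // monic_exp // monicXsubC.
have sz (i : 'I_d.+1) : size ('X^(d - i) * ('X - k%:R%:P) ^+ i : {poly R}) = d.+1.
  rewrite size_monicM ?monicXn ?expf_neq0 ?polyXsubC_eq0 // size_polyXn size_exp_XsubC.
  by have := ltn_ord i; lia.
split.
  apply: leq_trans (size_scale_leq _ _) _; apply: leq_trans (size_sum _ _ _) _.
  by apply/bigmax_leqP => i _; rewrite sz.
rewrite coefZ coef_sum; congr (_ * _).
under eq_bigr => i _.
  have /monicP := mon i; rewrite lead_coefE sz /= => ->; over.
by rewrite sumr_const card_ord.
Qed.

Lemma size_dl k p d : (size p <= d.+1)%N -> (size (dl k p) <= d)%N.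
Proof.
elim: d p => [|d IH] p sp.
  by rewrite (size1_polyC sp) /dl comp_polyC subrr size_poly0.
have -> : p = p`_d.+1 *: 'X^(d.+1) + (p - p`_d.+1 *: 'X^(d.+1)) by rewrite addrC subrK.
rewrite dlD dlZ; apply: leq_trans (size_polyD _ _) _; rewrite geq_max; apply/andP; split.
  exact: leq_trans (size_scale_leq _ _) (dlXn _ _).1.
apply: leq_trans (IH _ _) _ => //; apply/leq_sizeP => j; rewrite leq_eqVlt => /predU1P[<-|lt].
  by rewrite coefB coefZ coefXn eqxx mulr1 subrr.
by rewrite coefB coefZ coefXn gtn_eqF // mulr0 subr0; move/leq_sizeP: sp; apply.
Qed.

Lemma coef_dl k p d : (size p <= d.+2)%N -> (dl k p)`_d = k%:R * d.+1%:R * p`_d.+1.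
Proof.
move=> sp; have {1}-> : p = p`_d.+1 *: 'X^(d.+1) + (p - p`_d.+1 *: 'X^(d.+1)) by rewrite addrC subrK.
suff h : (size (dl k (p - p`_d.+1 *: 'X^(d.+1))) <= d)%N.
  by rewrite dlD dlZ coefD coefZ (dlXn _ _).2 [X in _ + X]nth_default // addr0 mulrC.
apply: size_dl; apply/leq_sizeP => j; rewrite leq_eqVlt => /predU1P[<-|lt].
  by rewrite coefB coefZ coefXn eqxx mulr1 subrr.
by rewrite coefB coefZ coefXn gtn_eqF // mulr0 subr0; move/leq_sizeP: sp; apply.
Qed.

Lemma size_dlE k p : (0 < k)%N -> size (dl k p) = (size p).-1.
Proof.
move=> k0; case sp: (size p) => [|[|d]] /=.
- by move/eqP: sp; rewrite size_poly_eq0 => /eqP ->; rewrite /dl comp_poly0 subrr size_poly0.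
- by apply/eqP; rewrite -leqn0 size_dl ?sp.
apply/eqP; rewrite eqn_leq size_dl ?sp //= ltnNge; apply/negP => /leq_sizeP /(_ d (leqnn _)).
rewrite coef_dl ?sp // => /eqP; rewrite !mulf_eq0 !pnatr_eq0 -(negbK (k == 0)%N) -lt0n k0 /=.
by have := lead_coef_eq0 p; rewrite lead_coefE sp /= => ->; rewrite -size_poly_eq0 sp.
Qed.

(** Discrete integration, top coefficient first. It recovers the Hilbert polynomial of S/J from that
    of S/(J, x) for a linear nonzerodivisor x. *)
Lemma dl1_surj p : exists q, dl 1 q = p.
Proof.
have [d] := ubnP (size p); elim: d p => // d IH p; rewrite ltnS.
case: d IH => [|d] IH; first by rewrite leqn0 size_poly_eq0 => /eqP ->; exists 0; rewrite /dl comp_poly0 subr0.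
move=> sp; have d0 : d.+1%:R != 0 :> R by rewrite pnatr_eq0.
have [|q hq] := IH (p - dl 1 ((p`_d / d.+1%:R) *: 'X^(d.+1))).
  rewrite ltnS; apply/leq_sizeP => j; rewrite dlZ coefB coefZ leq_eqVlt => /predU1P[<-|lt].
    by rewrite (dlXn _ _).2 mul1r divfK // subrr.
  have [/leq_sizeP/(_ j lt) -> _] := dlXn 1 d.
  by rewrite mulr0 subr0; move/leq_sizeP: sp; apply.
by exists (q + (p`_d / d.+1%:R) *: 'X^(d.+1)); rewrite dlD hq subrK.
Qed.

Lemma invn_cvg0 : (fun t : nat => (t%:R : R)^-1) @ \oo --> (0 : R).
Proof. by rewrite -cvg_shiftS; exact: cvg_harmonic. Qed.

Lemma poly_cvg p d : (size p <= d.+1)%N ->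
  (fun t : nat => p.[t%:R] / t%:R ^+ d) @ \oo --> (p`_d : R).
Proof.
elim: d p => [|d IH] p sp.
  have -> : (fun t : nat => p.[t%:R] / t%:R ^+ 0) = fun=> p`_0.
    by apply/funext => t; rewrite (size1_polyC sp) hornerC coefC eqxx expr0 divr1.
  exact: cvg_cst.
pose r := p - p`_d.+1 *: 'X^(d.+1).
have sr : (size r <= d.+1)%N.
  apply/leq_sizeP => j; rewrite leq_eqVlt => /predU1P[<-|lt].
    by rewrite coefB coefZ coefXn eqxx mulr1 subrr.
  by rewrite coefB coefZ coefXn gtn_eqF // mulr0 subr0; move/leq_sizeP: sp; apply.
have h : (fun t : nat => p`_d.+1 + (r.[t%:R] / t%:R ^+ d) * t%:R^-1) @ \oo --> (p`_d.+1 + r`_d * 0 : R).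
  by apply: cvgD; [exact: cvg_cst | apply: cvgM; [exact: IH | exact: invn_cvg0]].
move: h; rewrite mulr0 addr0; apply: cvg_trans; apply: near_eq_cvg.
near=> t; have t0 : (t%:R : R) != 0.
  by rewrite pnatr_eq0 -lt0n; near: t; exact: nbhs_infty_gt.
have E : p.[t%:R] = p`_d.+1 * t%:R ^+ d.+1 + r.[t%:R].
  by rewrite /r hornerD hornerN hornerZ hornerXn addrC subrK.
by rewrite E mulrDl mulfK ?expf_neq0 // exprSr invfM mulrA.
Unshelve. all: by end_near.
Qed.

Lemma poly_le_coef p q d N : (size p <= d.+1)%N -> (size q <= d.+1)%N ->
  (forall t : nat, (N <= t)%N -> p.[t%:R] <= q.[t%:R]) -> p`_d <= q`_d.
Proof.
move=> /poly_cvg cp /poly_cvg cq h.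
apply: (ler_cvg_to cp cq); near=> t; rewrite ler_wpM2r ?invr_ge0 ?exprn_ge0 ?ler0n //.
by apply: h; near: t; exact: nbhs_infty_ge.
Unshelve. all: by end_near.
Qed.

Lemma poly_le_size p q N :
  (forall t : nat, (N <= t)%N -> 0 <= p.[t%:R] <= q.[t%:R]) -> (size p <= size q)%N.
Proof.
move=> h; rewrite leqNgt; apply/negP => lt.
have [d sp] : exists d, size p = d.+1 by exists (size p).-1; rewrite prednK // (leq_ltn_trans _ lt).
have q0 : q`_d = 0 by rewrite nth_default // -ltnS -sp.
have le1 : p`_d <= q`_d by apply: (@poly_le_coef p q d N) => [||t /h/andP[]//]; rewrite ?sp // -sp ltnW.
have le2 : 0 <= p`_d.
  have := @poly_le_coef 0 p d N; rewrite coef0 size_poly0 sp; apply=> // t /h/andP[+ _].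
  by rewrite hornerC.
have : lead_coef p == 0 by rewrite lead_coefE sp eq_le le2 andbT; move: le1; rewrite q0.
by rewrite lead_coef_eq0 -size_poly_eq0 sp.
Qed.

Lemma poly_eventually0 p N : (forall t : nat, (N <= t)%N -> p.[t%:R] = 0) -> p = 0.
Proof.
move=> h; apply/eqP; rewrite -size_poly_eq0 -leqn0 -(size_poly0 R).
by apply: (@poly_le_size _ _ N) => t /h ->; rewrite hornerC lexx.
Qed.

Lemma poly_eventually_eq p q N : (forall t : nat, (N <= t)%N -> p.[t%:R] = q.[t%:R]) -> p = q.
Proof.
move=> h; apply/eqP; rewrite -subr_eq0; apply/eqP/(@poly_eventually0 _ N) => t /h e.
by rewrite hornerD hornerN e subrr.
Qed.

(** The binomial has degree d in t. The argument is [k * t] because the elements separating a chain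
    of primes have degree up to k, so growth is controlled along multiples of k. *)
Lemma poly_ge_size p d k N : (0 < k)%N ->
  (forall t : nat, (N <= t)%N -> ('C(t + d, d))%:R <= p.[(k * t)%:R]) -> (d < size p)%N.
Proof.
move=> k0 h; have le (t : nat) : (N <= t)%N -> 'X^d.[t%:R] <= (d`!%:R *: (p \Po (k%:R *: 'X))).[t%:R].
  move=> /h {}h; rewrite hornerXn hornerZ horner_comp hornerZ hornerX -natrM.
  apply: le_trans (ler_wpM2l (ler0n _ _) h).
  rewrite -natrM -natrX ler_nat mulnC bin_ffact; elim: d {h} => // d IH.
  rewrite addnS ffactSS expnS; apply: leq_mul; [lia | exact: IH].
have : (size ('X^d : {poly R}) <= size (d`!%:R *: (p \Po (k%:R *: 'X))))%N.
  by apply: (@poly_le_size _ _ N) => t /le ->; rewrite andbT hornerXn exprn_ge0 // ler0n.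
rewrite size_polyXn => /leq_trans; apply; apply: leq_trans (size_scale_leq _ _) _.
rewrite size_comp_poly2 // size_scale ?size_polyX // pnatr_eq0; lia.
Qed.

End Growth.

(** * Hilbert polynomials *)

Section HilbertPoly.
Variables (R : realType) (K : fieldType) (n : nat).
Local Notation S := {mpoly K[n]}.
Local Notation hc := (pihomog mdeg).
Local Notation form d f := (f \is d.-homog for mdeg).
Implicit Types (J P Q : ideal S) (f g : S).

Definition is_hpoly J (p : {poly R}) :=
  exists N, forall t, (N <= t)%N -> (hilb J t)%:R = p.[t%:R].

Definition maxid : S -> Prop := fun f => f@_0 = 0.
Lemma maxid_ideal : is_ideal maxid.
Proof.
split=> [|x y hx hy|a x hx]; rewrite /maxid ?mcoeff0 //.
  by rewrite mcoeffD hx hy addr0.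
by rewrite (rmorphM (mcoeff 0%MM)) /= hx mulr0.
Qed.
Definition mI := Ideal maxid_ideal.

Lemma form0 f : form 0%N f -> f = (f@_0)%:MP.
Proof. by move=> /msize_form h; apply: msize1_polyC. Qed.

Lemma form_mI d f : form d f -> (0 < d)%N -> mI f.
Proof. by move=> hf d0; apply: (dhomog_nemf_coeff hf); rewrite /= mdeg0; lia. Qed.

Lemma formX i : form 1%N ('X_i : S).
Proof. by rewrite dhomogX /= mdeg1. Qed.

Lemma hom_mI : hom mI.
Proof.
move=> f [|d] hf; last by apply: form_mI (pihomogP _ _ _) _.
by rewrite (form0 (pihomogP mdeg 0 f)); case: (idealP mI) => + _ _; rewrite (_ : _%:MP = 0) //;
  apply/mpolyP => m; rewrite mcoeffC pihomogE raddf_sum /= big1 ?mul0r ?mcoeff0 // => m' /eqP /eqP;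
  rewrite mdeg_eq0 => /eqP ->; rewrite hf scale0r mcoeff0.
Qed.

Lemma mI_sub J : (forall i : 'I_n, J 'X_i) -> ideal_le mI J.
Proof.
move=> h f hf; rewrite (mpolyE f) big_seq; apply: id_sum => m mf; apply: idZ.
have [i mi] : exists i, m i != 0%N.
  apply/existsP; apply: contraTT mf => /existsPn h0.
  suff -> : m = 0%MM by rewrite mcoeff_msupp hf eqxx.
  by apply/mnmP => i; rewrite mnm0E; have := h0 i; rewrite negbK => /eqP.
have le : (U_(i) <= m)%MM by rewrite lep1mP.
by rewrite -(submK le) mpolyXD; exact: idM.
Qed.

Lemma id_const J f : J f -> hom J -> f@_0 != 0 -> J 1.
Proof.
move=> Jf hJ f0; have := hJ _ 0%N Jf; rewrite (form0 (pihomogP mdeg 0 f)).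
have -> : (hc 0 f)@_0 = f@_0.
  have := hom_mI (f := f - (f@_0)%:MP) 0%N; rewrite /= /maxid mcoeffB mcoeffC eqxx mulr1 subrr.
  move=> /(_ erefl); rewrite raddfB /= mcoeffB => /eqP; rewrite subr_eq0 => /eqP ->.
  have h1 : form 0%N ((f@_0)%:MP : S) by rewrite -alg_mpolyC; apply/dhomogZ/dhomog1.
  by rewrite (pihomog_dE h1) mcoeffC eqxx mulr1.
move=> /(idZ (f@_0)^-1); rewrite -mul_mpolyC -mpolyCM mulVf //.
Qed.

Lemma hom_sub_mI J : hom J -> ~ J 1 -> ideal_le J mI.
Proof. by move=> hJ J1 f Jf; apply/eqP; apply: contra_notT J1; exact: id_const. Qed.

Lemma mI1 : ~ mI 1.
Proof. by rewrite /= /maxid mcoeff1 eqxx => /eqP; rewrite oner_eq0. Qed.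

Lemma hilb_mI t : hilb mI t = 1%N.
Proof.
apply: (@hbasis_hilb _ _ _ _ _ (fun=> 1)); split=> [_|c|f _]; first by rewrite msize1.
  rewrite /lc big_ord1 /= /maxid mcoeffZ mcoeff1 eqxx mulr1 => h.
  by apply/rowP => i; rewrite ord1 mxE.
exists (\row__ f@_0); rewrite /lc big_ord1 mxE /= /maxid mcoeffB mcoeffZ mcoeff1 eqxx mulr1.
by rewrite subrr.
Qed.

Lemma not_prime_forms J : hom J -> ~ J 1 -> ~ isprime J -> exists a b d e,
  [/\ form d a, form e b, J (a * b), ~ J a & ~ J b].
Proof.
move=> hJ J1 nP; apply: contrapT => h; apply: nP; apply: hom_prime => // a b d e ha hb Jab.
by apply: contrapT => /not_orP[na nb]; apply: h; exists a, b, d, e.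
Qed.

(** Noetherian induction. If J is not prime, a form a from a failing product splits the Hilbert
    function into those of (J, a) and (J : a). If J is prime and misses a variable x, its first
    difference is the Hilbert function of (J, x), which is then integrated. *)
Lemma is_hpoly_ex J : hom J -> exists p, is_hpoly J p.
Proof.
move: J; apply: (noeth_ind (@mpoly_acc K n)) => J IH hJ.
have [J1|J1] := pselect (J 1).
  by exists 0; exists 0%N => t _; rewrite hilb_unit // hornerC.
have [pJ|/(not_prime_forms hJ J1)[a [b [d [e [ha hb Jab na nb]]]]]] := pselect (isprime J); last first.
  have [||p1 [N1 h1]] := IH (adj J a) (@adj_le _ J a).
  - by move=> /(_ a (adj_self _ _)).
  - exact: hom_adj ha.
  have [||p2 [N2 h2]] := IH (col J a) (@col_le _ J a).
  - by move=> /(_ b); rewrite colE mulrC => /(_ Jab).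
  - exact: hom_col ha.
  exists (p1 + (p2 \Po ('X - d%:R%:P))); exists (maxn N1 (N2 + d)) => t; rewrite geq_max => /andP[le1 le2].
  rewrite (hilb_adj _ hJ ha) (leq_trans _ le2) ?leq_addl // natrD h1 // h2; last by lia.
  rewrite hornerD horner_comp hornerD hornerN hornerX !hornerC natrB //; lia.
have [allx|/existsNP[i nx]] := pselect (forall i : 'I_n, J 'X_i).
  have -> : J = mI by apply: ideal_ext; [exact: hom_sub_mI | exact: mI_sub].
  by exists 1%:P; exists 0%N => t _; rewrite hilb_mI hornerC.
have [||p1 [N1 h1]] := IH (adj J 'X_i) (@adj_le _ J 'X_i).
- by move=> /(_ 'X_i (adj_self _ _)).
- exact: hom_adj (formX i).
have colJ : col J 'X_i = J.
  by apply: ideal_ext; [move=> x /pJ.2[] | exact: col_le].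
have [q hq] := dl1_surj p1.
have step t : (N1 < t)%N -> (hilb J t)%:R - q.[t%:R] = (hilb J t.-1)%:R - q.[t.-1%:R] :> R.
  case: t => // t lt; rewrite (hilb_adj t.+1 hJ (formX i)) colJ subn1 /= natrD h1; last by lia.
  rewrite -hq horner_dl [t.+1%:R]mulrSr addrK; ring.
exists (q + ((hilb J N1)%:R - q.[N1%:R])%:P); exists N1 => t /subnK <-.
rewrite hornerD hornerC; elim: (t - N1)%N => [|k IHk]; first by rewrite add0n addrC subrK.
have E : (hilb J (k.+1 + N1))%:R - q.[(k.+1 + N1)%:R] = (hilb J (k + N1))%:R - q.[(k + N1)%:R] :> R.
  by apply: step; lia.
by rewrite -[LHS](subrK q.[(k.+1 + N1)%:R]) addrC E IHk [q.[(k + N1)%:R] + _]addrC addrK.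
Qed.

Definition hp J : {poly R} := xget 0 [set p | is_hpoly J p].

Lemma hpP J : hom J -> is_hpoly J (hp J).
Proof. by move=> /is_hpoly_ex[p h]; exact: (@xgetI _ 0 [set p | is_hpoly J p] p h). Qed.

Lemma hpE J p : is_hpoly J p -> hp J = p.
Proof.
move=> h; have [N1 h1] : is_hpoly J (hp J) by exact: (@xgetI _ 0 [set p | is_hpoly J p] p h).
case: h => N2 h2; apply: (@poly_eventually_eq _ _ _ (maxn N1 N2)) => t.
by rewrite geq_max => /andP[/h1 <- /h2].
Qed.

Lemma hp_unit J : J 1 -> hp J = 0.
Proof. by move=> J1; apply: hpE; exists 0%N => t _; rewrite hilb_unit // hornerC. Qed.

Lemma hp_mI : hp mI = 1.
Proof. by apply: hpE; exists 0%N => t _; rewrite hilb_mI hornerC. Qed.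

Lemma hp_gt0 J : hom J -> ~ J 1 -> (0 < size (hp J))%N.
Proof.
move=> /hpP[N h] J1; rewrite lt0n size_poly_eq0; apply: contra_notN J1 => /eqP e.
have := h N (leqnn _); rewrite e hornerC => /eqP; rewrite pnatr_eq0 => /eqP e0.
by apply: contrapT => /(@hilb_gt0 _ _ _ N); rewrite e0.
Qed.

Lemma hp_le_size J J' : hom J -> hom J' ->
  (exists N k, forall t, (N <= t)%N -> (hilb J t <= hilb J' t + k)%N) -> ~ J' 1 ->
  (size (hp J) <= size (hp J'))%N.
Proof.
move=> hJ hJ' [N [k h]] J1; have [N1 h1] := hpP hJ; have [N2 h2] := hpP hJ'.
(* Since [hilb J' t] is positive, the factor [k.+1] absorbs the additive constant [k]. *)
have -> : size (hp J') = size (k.+1%:R *: hp J') by rewrite size_scale // pnatr_eq0.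
apply: (@poly_le_size _ _ _ (maxn N (maxn N1 N2))) => t; rewrite !geq_max => /and3P[l1 l2 l3].
rewrite hornerZ -h1 // -h2 // ler0n -natrM ler_nat; apply: leq_trans (h _ l1) _.
by have := hilb_gt0 t J1; rewrite mulSn leq_add2l => g; exact: leq_pmulr.
Qed.

Lemma hp_mono J J' : hom J -> hom J' -> ideal_le J J' -> (size (hp J') <= size (hp J))%N.
Proof.
move=> hJ hJ' le; have [J1|J1] := pselect (J 1).
  by rewrite !hp_unit // ?size_poly0 //; exact: le.
by apply: hp_le_size => //; exists 0%N, 0%N => t _; rewrite addn0; exact: hilb_mono.
Qed.

Lemma hp_coef_le J J' d k : hom J -> hom J' -> (size (hp J) <= d.+1)%N -> (size (hp J') <= d.+1)%N ->
  (forall t, (k <= t)%N -> (hilb J t <= hilb J' t)%N) -> (hp J)`_d <= (hp J')`_d.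
Proof.
move=> hJ hJ' s1 s2 h; have [N1 h1] := hpP hJ; have [N2 h2] := hpP hJ'.
apply: (@poly_le_coef _ _ _ _ (maxn k (maxn N1 N2))) => // t; rewrite !geq_max => /and3P[l1 l2 l3].
by rewrite -h1 // -h2 // ler_nat h.
Qed.

Lemma hp_coef_mono J J' d : hom J -> hom J' -> ideal_le J J' -> (size (hp J) <= d.+1)%N ->
  (hp J')`_d <= (hp J)`_d.
Proof.
move=> hJ hJ' le s; apply: (@hp_coef_le _ _ d 0%N) => // [|t _]; last exact: hilb_mono.
exact: leq_trans (hp_mono hJ hJ' le) s.
Qed.

Lemma hp_coef_ge0 J d : hom J -> (size (hp J) <= d.+1)%N -> 0 <= (hp J)`_d.
Proof.
move=> hJ s; have [N h] := hpP hJ; have := @poly_le_coef R 0 (hp J) d N.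
by rewrite coef0 size_poly0; apply=> // t /h <-; rewrite hornerC ler0n.
Qed.

Definition shift (k : nat) (p : {poly R}) : {poly R} := p \Po ('X - k%:R%:P).

Lemma dl_shift k p : dl k p = p - shift k p. Proof. by []. Qed.

Lemma size_shift k (p : {poly R}) : size (shift k p) = size p.
Proof. by rewrite /shift size_comp_poly2 // size_XsubC. Qed.

Lemma horner_shift k p (t : nat) : (k <= t)%N -> (shift k p).[t%:R] = p.[(t - k)%:R].
Proof. by move=> kt; rewrite /shift horner_comp hornerD hornerN hornerX hornerC natrB. Qed.

Lemma coef_shift k (p : {poly R}) d : (size p <= d.+1)%N -> (shift k p)`_d = p`_d.
Proof.
move=> s; have -> : shift k p = p - dl k p by rewrite dl_shift opprB addrC subrK.
by rewrite coefB [(dl _ _)`_d]nth_default ?subr0 // size_dl.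
Qed.

Lemma hp_adj J k f : hom J -> form k f -> hp J = hp (adj J f) + shift k (hp (col J f)).
Proof.
move=> hJ hf; have [N1 h1] := hpP (hom_adj hJ hf); have [N2 h2] := hpP (hom_col hJ hf).
apply: hpE; exists (maxn N1 (N2 + k)) => t; rewrite geq_max => /andP[l1 l2].
have kt : (k <= t)%N by lia.
rewrite (hilb_adj _ hJ hf) kt natrD h1 // h2; last by lia.
by rewrite hornerD horner_shift.
Qed.

Lemma hp_adj_prime J k f : hom J -> isprime J -> form k f -> ~ J f -> hp (adj J f) = dl k (hp J).
Proof.
move=> hJ pJ hf nf; have := hp_adj hJ hf.
have -> : col J f = J by apply: ideal_ext; [move=> x /pJ.2[] | exact: col_le].
by move=> e; rewrite dl_shift {1}e addrK.
Qed.

(** Hilbert functions are cumulative here, so the degree of [hp J] is the dimension of S/J itself,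
    not one less. The unit ideal has [hp J = 0] and also gets 0, which is why most bounds are stated
    on [size (hp J)]. *)
Definition hdim J := (size (hp J)).-1.

Lemma size_hdim J : hom J -> ~ J 1 -> size (hp J) = (hdim J).+1.
Proof. by move=> hJ J1; rewrite /hdim prednK // hp_gt0. Qed.

Lemma hp_lead_gt0 J : hom J -> ~ J 1 -> 0 < (hp J)`_(hdim J).
Proof.
move=> hJ J1; have s := size_hdim hJ J1; rewrite lt_neqAle hp_coef_ge0 ?s // andbT eq_sym.
by have := lead_coef_eq0 (hp J); rewrite lead_coefE s /= => ->; rewrite -size_poly_eq0 s.
Qed.

(** As J is contained in (J : f), the exact sequence of [hilb_adj] removes at most H_J(t - k). Hence
    a form lowers the dimension by at most one ([hp_adj_size]), and when it does, the new leading
    coefficient grows with its degree ([hp_adj_coef]). *)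
Lemma hp_adj_ge J k f : hom J -> form k f ->
  exists N, forall t : nat, (N <= t)%N -> 0 <= (dl k (hp J)).[t%:R] <= (hp (adj J f)).[t%:R].
Proof.
move=> hJ hf; have [N1 h1] := hpP (hom_adj hJ hf); have [N2 h2] := hpP hJ.
exists (maxn N1 (N2 + k)) => t; rewrite geq_max => /andP[l1 l2].
have kt : (k <= t)%N by lia.
rewrite dl_shift hornerD hornerN horner_shift // -h1 // -!h2; try lia.
rewrite subr_ge0 lerBlDr -natrD !ler_nat hilb_homo ?leq_subr //=.
by rewrite (hilb_adj _ hJ hf) kt leq_add2l; apply/hilb_mono/col_le.
Qed.

Lemma hp_adj_size J k f : hom J -> form k f -> (0 < k)%N -> ((size (hp J)).-1 <= size (hp (adj J f)))%N.
Proof.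
by move=> hJ hf k0; have [N h] := hp_adj_ge hJ hf; rewrite -(size_dlE _ k0); exact: poly_le_size h.
Qed.

Lemma hp_adj_coef J k f d : hom J -> form k f -> (size (hp J) <= d.+2)%N ->
  (size (hp (adj J f)) <= d.+1)%N -> k%:R * d.+1%:R * (hp J)`_d.+1 <= (hp (adj J f))`_d.
Proof.
move=> hJ hf s1 s2; have [N h] := hp_adj_ge hJ hf; rewrite -coef_dl //.
by apply: (@poly_le_coef _ _ _ d N) => [||t /h/andP[]//]; first exact: size_dl.
Qed.

End HilbertPoly.

(** * Prime filtrations and dimension *)

Section Primes.
Variables (R : realType) (K : fieldType) (n : nat).
Local Notation S := {mpoly K[n]}.
Local Notation hc := (pihomog mdeg).
Local Notation form d f := (f \is d.-homog for mdeg).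
Local Notation hp := (@hp R K n).
Local Notation hdim := (@hdim R K n).
Local Notation mI := (mI K n).
Implicit Types (J P Q q : ideal S) (f g : S).

Lemma colM J f g : col (col J f) g = col J (g * f).
Proof. by apply: ideal_ext => x; rewrite !colE mulrA. Qed.

(** Existence of homogeneous associated primes: if a b lies in (J : f) but a and b do not, then (J :
    a f) is strictly larger because it contains b, and Noetherian induction applies to a f. *)
Lemma col_prime J f d : hom J -> form d f -> ~ J f ->
  exists e h, [/\ form e h, ~ J (h * f) & isprime (col J (h * f))].
Proof.
move=> hJ; move e : (col J f) => J'; move: J' f d e.
apply: (noeth_ind (@mpoly_acc K n)) => J' IH f d e hf nf.
have hc' : hom J' by rewrite -e; exact: hom_col hf.
have J1 : ~ J' 1 by rewrite -e colE mul1r.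
have [pJ|/(not_prime_forms hc' J1)[a [b [i [j [ha hb Jab na nb]]]]]] := pselect (isprime J').
  by exists 0%N, 1; rewrite dhomog1 mul1r e.
move: Jab na nb; rewrite -e !colE => Jab na nb.
have [||e' [h [hh nh ph]]] := IH (col J (a * f)) _ _ (a * f) _ erefl (dhomogM ha hf) na.
- by move=> x; rewrite -e !colE mulrCA; exact: idM.
- by move=> /(_ b); rewrite -e !colE mulrCA mulrA => /(_ Jab).
by exists (e' + i)%N, (h * a); rewrite -mulrA; split=> //; exact: dhomogM.
Qed.

(** A prime filtration of S/J: each factor is the cyclic module (J, f)/J, a shifted copy of S/(J :
    f), and the list records these primes. *)
Inductive pfilt : ideal S -> seq (ideal S) -> Prop :=
| pfilt_unit J : J 1 -> pfilt J [::]
| pfilt_cons J f d qs : hom J -> form d f -> ~ J f -> isprime (col J f) ->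
    pfilt (adj J f) qs -> pfilt J (col J f :: qs).

Lemma pfilt_ex J : hom J -> exists qs, pfilt J qs.
Proof.
move: J; apply: (noeth_ind (@mpoly_acc K n)) => J IH hJ.
have [J1|J1] := pselect (J 1); first by exists [::]; constructor.
have [e [h [hh nh ph]]] := col_prime hJ (dhomog1 _ _ : form 0%N 1) J1.
have hf := dhomogM hh (dhomog1 _ _ : form 0%N 1).
have [||qs hqs] := IH (adj J (h * 1)) (@adj_le _ J _).
- by move=> /(_ _ (adj_self _ _)).
- exact: hom_adj hf.
by exists (col J (h * 1) :: qs); apply: pfilt_cons hf nh ph hqs.
Qed.

Lemma pfilt_in J qs q : pfilt J qs -> List.In q qs -> [/\ hom q, isprime q & ideal_le J q].
Proof.
elim=> [//|{}J f d {}qs hJ hf nf pf _ IH] /= [<-|/IH[h1 h2 h3]].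
  by split=> //; [exact: hom_col hf | exact: col_le].
by split=> // x Jx; apply/h3/adj_le.
Qed.

(** One factor [x] annihilates each step of the filtration. *)
Lemma pfilt_exp J qs x : pfilt J qs -> (forall q, List.In q qs -> q x) -> J (x ^+ size qs).
Proof.
elim=> [{}J J1 _|{}J f d {}qs hJ hf nf pf _ IH h] /=; first by rewrite expr0.
have [a Ja] : adj J f (x ^+ size qs) by apply: IH => q qin; apply: h; right.
have Jx : J (x * f) by rewrite -colE; apply: h; left.
have -> : x ^+ (size qs).+1 = x * (x ^+ size qs - a * f) + a * (x * f).
  by rewrite exprS mulrBr [x * (a * f)]mulrCA subrK.
by apply: idD; exact: idM.
Qed.

(** Hilbert polynomials add along the filtration, so the degree of [hp J] is reached by one of the
    factors. *)
Lemma pfilt_size J qs : pfilt J qs -> hom J -> ~ J 1 ->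
  exists2 q, List.In q qs & size (hp q) = size (hp J).
Proof.
elim=> [//|{}J f d {}qs hJ hf nf pf _ IH] _ J1.
have hA := hom_adj hJ hf; have hC := hom_col hJ hf.
have le1 := hp_mono R hJ hA (@adj_le _ J f); have le2 := hp_mono R hJ hC (@col_le _ J f).
have := hp_adj R hJ hf => E; have := size_polyD (hp (adj J f)) (shift d (hp (col J f))).
rewrite -E size_shift => le3.
have [eC|neC] := eqVneq (size (hp (col J f))) (size (hp J)); first by exists (col J f) => //; left.
have eA : size (hp (adj J f)) = size (hp J).
  by apply/eqP; rewrite eqn_leq le1; move: le3; rewrite leq_max => /orP[//|]; lia.
have A1 : ~ adj J f 1.
  by move=> /(hp_unit R) e; move: eA (hp_gt0 R hJ J1); rewrite e size_poly0 => <-.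
by have [q qin qs'] := IH hA A1; exists q; [right | rewrite qs'].
Qed.

Lemma pfilt_adj J qs k f s : pfilt J qs -> form k f -> hom J ->
  (forall q, List.In q qs -> (size (hp (adj q f)) <= s)%N) -> (size (hp (adj J f)) <= s)%N.
Proof.
move=> hp' hf; elim: hp' => [{}J J1 _ _|{}J g d {}qs hJ hg ng pg _ IH _ h].
  by rewrite hp_unit ?size_poly0 //; exact: adj_le.
have hA := hom_adj hJ hf.
rewrite (hp_adj R hA hg) (leq_trans (size_polyD _ _)) // geq_max size_shift adjC; apply/andP; split.
  by apply: IH => [|q qin]; [exact: hom_adj hg | apply: h; right].
apply: leq_trans (h _ (or_introl erefl)); apply: hp_mono; [|exact: hom_col hg|].
  by apply: hom_adj hf; exact: hom_col hg.
apply: adj_sub => [x|]; rewrite !colE; first exact: adj_le.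
by rewrite mulrC; apply/idM/adj_self.
Qed.

(** * Homogeneous prime avoidance *)

Lemma form_notin C q : hom C -> hom q -> ~ ideal_le C q -> exists d f, [/\ form d f, C f & ~ q f].
Proof.
move=> hC hq /existsNP[x /not_implyP[Cx /(hom_notin hq)[d nq]]].
by exists d, (hc d x); split=> //; [exact: pihomogP | exact: hC].
Qed.

Lemma avoid_one (s : seq (ideal S)) C q : hom C -> hom q -> isprime q -> ~ ideal_le C q -> ideal_le C mI ->
  (forall q', List.In q' s -> hom q' /\ ~ ideal_le q' q) ->
  exists e g, [/\ form e g, (0 < e)%N, C g, forall q', List.In q' s -> q' g & ~ q g].
Proof.
move=> hC hq pq nC Cm; elim: s => [_|q' s IH h].
  have [[|d] [f [hf Cf nf]]] := form_notin hC hq nC; last by exists d.+1, f.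
  by case: nf; rewrite (form0 hf) (Cm _ Cf) mpolyC0; exact: id0.
have [|e [g [hg e0 Cg g1 g2]]] := IH; first by move=> ? ?; apply: h; right.
have [hq' nq'] := h _ (or_introl erefl).
have [d [a [ha q'a na]]] := form_notin hq' hq nq'.
exists (d + e)%N, (a * g); split=> [||||/pq.2[]] //.
- exact: dhomogM.
- by rewrite addn_gt0 e0 orbT.
- exact: idM.
- by move=> q'' [<-|/g1 ?]; [exact: idMr | exact: idM].
Qed.

(** The ungraded argument adds f and g; here the powers [f ^+ e] and [g ^+ d] have equal degree, so
    their sum is a form. *)
Lemma prime_avoidance (qs : seq (ideal S)) C : hom C -> ideal_le C mI ->
  (forall q, List.In q qs -> [/\ hom q, isprime q & ~ ideal_le C q]) ->
  exists d f, [/\ form d f, (0 < d)%N, C f & forall q, List.In q qs -> ~ q f].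
Proof.
move=> hC Cm; have [N] := ubnP (size qs); elim: N qs => // N IH [|q s] /= le h.
  by exists 1%N, 0; split=> //; [exact: dhomog0 | exact: id0].
have [hq pq nq] := h _ (or_introl erefl).
(* A prime inside [q] is avoided together with [q], and [avoid_one] requires that none remain. *)
have [[q' q's q'q]|nsub] := pselect (exists2 q', List.In q' s & ideal_le q' q).
  have [l1 [l2 es]] := List.in_split _ _ q's.
  have [||d [f [hf d0 Cf nf]]] := IH (q :: l1 ++ l2).
  - by move: le; rewrite es /= !size_cat /=; lia.
  - move=> q0 [e0|/List.in_app_iff h0]; first by apply: h; left.
    by apply: h; right; rewrite es; apply/List.in_app_iff; case: h0; [left | right; right].
  exists d, f; split=> // q0 [<-|]; first by apply: nf; left.
  rewrite es => /List.in_app_iff[h0|[<-|h0]].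
  - by apply: nf; right; apply/List.in_app_iff; left.
  - by move=> /q'q; apply: nf; left.
  - by apply: nf; right; apply/List.in_app_iff; right.
have [||d [f [hf d0 Cf nf]]] := IH s; [lia | by move=> ? ?; apply: h; right|].
have [qf|nqf] := pselect (q f); last first.
  by exists d, f; split=> // q0 [<-|/nf].
have [|e [g [hg e0 Cg g1 g2]]] := @avoid_one s C q hC hq pq nq Cm.
  move=> q' q's; have [hq' _ _] := h q' (or_intror q's); split=> // le'.
  by apply: nsub; exists q'.
exists (d * e)%N, (f ^+ e + g ^+ d); split; last 1 first.
- move=> q0 [<-|h0] H.
    apply/g2/(isprime_exp pq (k := d)); rewrite -(addKr (f ^+ e) (g ^+ d)) addrC; apply: idB => //.
    by rewrite -(prednK e0) exprS; exact: idMr.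
  have [_ pq0 _] := h q0 (or_intror h0).
  apply/(nf q0 h0)/(isprime_exp pq0 (k := e)); rewrite -(addrK (g ^+ d) (f ^+ e)); apply: idB => //.
  by rewrite -(prednK d0) exprS; apply/idMr/g1.
- by apply: dhomogD; [exact: dhomogMn | rewrite mulnC; exact: dhomogMn].
- by rewrite muln_gt0 d0.
- by apply: idD; [rewrite -(prednK e0) exprS; exact: idMr | rewrite -(prednK d0) exprS; exact: idMr].
Qed.

(** * Chains of primes *)

(** Descending from the top prime, [hilb_prime] and Pascal's rule show that the prime j steps below
    the top leaves at least C(t + j, j) dimensions in degrees up to k t. So the length of the chain
    bounds the degree of [hp J] from below. *)
Lemma chain_size J e (P : nat -> ideal S) : hom J -> ideal_le J (P 0%N) ->
  (forall i, (i <= e)%N -> isprime (P i)) ->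
  (forall i, (i < e)%N -> ideal_le (P i) (P i.+1) /\ ~ ideal_le (P i.+1) (P i)) ->
  (e < size (hp J))%N.
Proof.
move=> hJ JP pP cP.
have /choice[f hf] i : exists f, (i < e)%N -> P i.+1 f /\ ~ P i f.
  have [ie|ie] := ltnP i e; last by exists 0.
  by have [_ /existsNP[f /not_implyP[h1 h2]]] := cP i ie; exists f.
pose k := (\max_(i < e) msize (f i)).+1.
have sf i : (i < e)%N -> (msize (f i) <= k.+1)%N.
  by move=> ie; do 2!apply: leqW; exact: (@leq_bigmax _ (fun i : 'I_e => msize (f i)) (Ordinal ie)).
have claim j : (j <= e)%N -> forall t, ('C(t + j, j) <= hilb (P (e - j)%N) (k * t))%N.
  elim: j => [|j IH] je t; first by rewrite bin0 hilb_gt0 //; case: (pP (e - 0)%N); rewrite ?leq_subr.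
  have ej : (e - j.+1 < e)%N by lia.
  have eS : (e - j = (e - j.+1).+1)%N by lia.
  have pj := pP _ (ltnW ej); have [h1 h2] := cP _ ej; have [h3 h4] := hf _ ej.
  elim: t => [|t IHt]; first by rewrite add0n binn hilb_gt0 //; case: pj.
  rewrite addSn addnS binS mulnS addnC [(k + _)%N]addnC.
  apply: leq_trans (hilb_prime (k * t)%N pj h1 h3 h4 (sf _ ej)).
  by apply: leq_add; [rewrite -eS -mulnSr -addSn; apply: IH; exact: ltnW | rewrite -addnS].
have [N hN] := hpP R hJ.
apply: (@poly_ge_size R (hp J) e k N) => // t Nt.
rewrite -hN; last by apply: leq_trans Nt _; exact: leq_pmull.
rewrite ler_nat; apply: leq_trans (hilb_mono _ JP).
by have := claim e (leqnn _) t; rewrite subnn.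
Qed.

(** The chain starts at a prime of full dimension in a filtration; a variable outside it lowers the
    dimension by exactly one, and the chain continues above. *)
Lemma prime_chain_ex J : hom J -> ~ J 1 -> exists P : nat -> ideal S,
  [/\ forall i, (i <= hdim J)%N -> isprime (P i), ideal_le J (P 0%N) &
   forall i, (i < hdim J)%N -> ideal_le (P i) (P i.+1) /\ ~ ideal_le (P i.+1) (P i)].
Proof.
move e : (hdim J) => D; elim: D J e => [|D IH] J eD hJ J1.
  have [qs hqs] := pfilt_ex hJ; have [q qin _] := pfilt_size hqs hJ J1.
  by have [h1 h2 h3] := pfilt_in hqs qin; exists (fun=> q).
have [qs hqs] := pfilt_ex hJ; have [q qin eq] := pfilt_size hqs hJ J1.
have [hq pq Jq] := pfilt_in hqs qin; have sJ := size_hdim R hJ J1.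
have [i nx] : exists i : 'I_n, ~ q 'X_i.
  apply/existsNP => /mI_sub le; have := hp_mono R (@hom_mI K n) hq le.
  by rewrite eq sJ eD hp_mI size_poly1.
have hA := hom_adj hq (@formX K n i).
have sA : size (hp (adj q 'X_i)) = D.+1 by rewrite (hp_adj_prime R hq pq (formX _ i) nx) size_dlE // eq sJ eD.
have A1 : ~ adj q 'X_i 1 by move=> /(hp_unit R) e; move: sA; rewrite e size_poly0.
have [|P [h1 h2 h3]] := IH (adj q 'X_i) _ hA A1; first by rewrite /hdim sA.
exists (fun j => if j is j'.+1 then P j' else q); split=> [[|j]||[|j]] //.
- exact: h1.
- move=> _; split; first by move=> x qx; apply/h2/adj_le.
  by move=> le; apply/nx/le/h2/adj_self.
- exact: h3.
Qed.

(** * Linear systems of parameters *)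

Lemma hp_adjs_size J (s : seq S) : hom J -> (forall f, f \in s -> exists2 k, form k f & (0 < k)%N) ->
  hom (adjs J s) /\ (size (hp J) <= size (hp (adjs J s)) + size s)%N.
Proof.
elim: s J => [|f s IH] J hJ hs /=; first by rewrite addn0.
have [k hf k0] := hs f (mem_head _ _); have hA := hom_adj hJ hf.
have [|h1 h2] := IH _ hA; first by move=> g gs; apply: hs; rewrite inE gs orbT.
split=> //; apply: leq_trans (leqSpred _) _; rewrite addnS ltnS.
exact: leq_trans (hp_adj_size R hJ hf k0) h2.
Qed.

(** For a form of degree t + 1 outside J, the colon term of [hilb_adj] jumps from 0 in degree t to
    at least 1 in degree t + 1. *)
Lemma hilb_stable J t f : hom J -> hilb J t.+1 = hilb J t -> form t.+1 f -> J f.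
Proof.
move=> hJ e hf; apply: contrapT => nf.
have := hilb_adj t.+1 hJ hf; rewrite e (hilb_adj t hJ hf) leqnn ltnn subnn addn0.
have := hilb_homo (adj J f) (leqnSn t).
have : (0 < hilb (col J f) 0)%N by apply: hilb_gt0; rewrite colE mul1r.
lia.
Qed.

Lemma hp1_primary J : hom J -> (size (hp J) <= 1)%N -> exists N, forall t f, (N <= t)%N -> form t f -> J f.
Proof.
move=> hJ s; have [N h] := hpP R hJ; exists N.+1 => -[//|t] f Nt; apply: hilb_stable => //.
apply/eqP; rewrite -(eqr_nat R) !h //; last by lia.
by rewrite (size1_polyC s) !hornerC.
Qed.

(** Linear forms on the moment curve. By the Vandermonde determinant any n of them with distinct
    parameters span all linear forms, so an ideal not containing the irrelevant one contains fewer
    than n of them. *)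
Definition lin (c : K) : S := \sum_(i < n) c ^+ i *: 'X_i.

Lemma form_lin c : form 1%N (lin c).
Proof. by apply: rpred_sum => i _; apply/dhomogZ/formX. Qed.

Lemma lin_mI J (cs : seq K) : uniq cs -> size cs = n -> (forall c, c \in cs -> J (lin c)) -> ideal_le mI J.
Proof.
move=> ucs scs h; apply: mI_sub => i.
pose V : 'M[K]_n := Vandermonde n (\row_j cs`_j).
have Vu : V \in unitmx.
  rewrite unitmxE det_Vandermonde unitfE; apply/prodf_neq0 => a _; apply/prodf_neq0 => b ab.
  by rewrite !mxE subr_eq0 nth_uniq ?scs //; lia.
have -> : 'X_i = \sum_j invmx V j i *: lin cs`_j :> S.
  have : (V *m invmx V) = 1%:M by rewrite mulmxV.
  move=> /matrixP E.
  under eq_bigr => j _ do rewrite /lin scaler_sumr.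
  rewrite exchange_big /= (bigD1 i) //= [X in _ + X]big1 ?addr0 => [|a ai].
    have := E i i; rewrite !mxE eqxx => e; rewrite -[LHS]scale1r -[1](mulr1n) -e scaler_suml.
    by apply: eq_bigr => j _; rewrite scalerA mulrC !mxE.
  have := E a i; rewrite !mxE (negPf ai) => e.
  have -> : \sum_(j < n) invmx V j i *: (cs`_j ^+ a *: 'X_a) = (\sum_j V a j * invmx V j i) *: 'X_a :> S.
    by rewrite scaler_suml; apply: eq_bigr => j _; rewrite scalerA mulrC !mxE.
  by rewrite e scale0r.
by apply: id_sum => j _; apply/idZ/h/mem_nth; rewrite scs.
Qed.

Lemma lin_avoid q : ~ ideal_le mI q -> exists bad : seq K, forall c, c \notin bad -> ~ q (lin c).
Proof.
move=> nq; apply: contrapT => /forallNP h; apply: nq.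
suff H k : exists cs, [/\ uniq cs, size cs = k & forall c, c \in cs -> q (lin c)].
  by have [cs [h1 h2 h3]] := H n; exact: lin_mI h3.
elim: k => [|k [cs [h1 h2 h3]]]; first by exists [::].
have /existsNP[c /not_implyP[nc /contrapT qc]] := h cs.
exists (c :: cs); rewrite /= nc h1 h2; split=> // c'; rewrite inE => /predU1P[->//|]; exact: h3.
Qed.

Lemma lin_avoids (qs : seq (ideal S)) : (forall q, List.In q qs -> ~ ideal_le mI q) ->
  exists bad : seq K, forall c, c \notin bad -> forall q, List.In q qs -> ~ q (lin c).
Proof.
elim: qs => [|q qs IH] h; first by exists [::].
have [|bad hb] := IH; first by move=> *; apply: h; right.
have [bad' hb'] := lin_avoid (h q (or_introl erefl)).
exists (bad' ++ bad) => c; rewrite mem_cat => /norP[nc' nc] q0 [<-|]; [exact: hb' | exact: hb].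
Qed.

(* For all but finitely many [c], the form [lin c] is a parameter modulo J. *)
Lemma lin_param J D : hom J -> (size (hp J) <= D.+2)%N ->
  exists bad : seq K, forall c, c \notin bad -> (size (hp (adj J (lin c))) <= D.+1)%N.
Proof.
move=> hJ sJ; have [qs hqs] := pfilt_ex hJ.
have [qs' hqs'] : exists qs', forall q, List.In q qs' <-> List.In q qs /\ ~ ideal_le mI q.
  elim: qs {hqs} => [|q qs [qs' h]]; first by exists [::]; split=> [|[]].
  have [le|nle] := pselect (ideal_le mI q).
    exists qs' => q0; rewrite h /=; split.
      by move=> [? ?]; split=> //; right.
    by move=> [[e|?] ne]; [case: ne; rewrite -e | split].
  exists (q :: qs') => q0 /=; rewrite h; split.
    by move=> [<-|[? ?]]; split=> //; [left | right].
  by move=> [[e|?] ne]; [left | right].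
have [|bad hb] := @lin_avoids qs'; first by move=> q /hqs'[].
exists bad => c /hb nc; apply: (pfilt_adj hqs (form_lin c) hJ) => q qin.
have [hq pq Jq] := pfilt_in hqs qin.
(* If [q] contains the irrelevant ideal, S/q has dimension 0 and the bound holds for any form. *)
have [le|nle] := pselect (ideal_le mI q).
  have hA := hom_adj hq (form_lin c).
  have := hp_mono R (@hom_mI K n) hA (fun x hx => @adj_le _ q (lin c) x (le x hx)).
  by rewrite hp_mI size_poly1 => /leq_trans; apply.
rewrite (hp_adj_prime R hq pq (form_lin c)); last by apply: nc; apply/hqs'.
by rewrite size_dlE // -subn1 leq_subLR add1n (leq_trans (hp_mono R hJ hq Jq)).
Qed.

End Primes.

(** * F-purity *)

Section QuotientModule.
Local Open Scope quotient_scope.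
Variables (A : comNzRingType) (V : lmodType A).

Record submod := Submod { submod_mem :> V -> Prop;
  submodP : [/\ submod_mem 0, forall x y, submod_mem x -> submod_mem y -> submod_mem (x - y)
             & forall a x, submod_mem x -> submod_mem (a *: x)] }.

Variable W : submod.

Definition submod_pred : {pred V} := fun x => `[< W x >].

Lemma submod_zmod_closed : zmod_closed submod_pred.
Proof.
case: (submodP W) => h1 h2 _; split; first exact/asboolP.
by move=> x y /asboolP hx /asboolP hy; apply/asboolP; exact: h2.
Qed.

HB.instance Definition _ := GRing.isZmodClosed.Build _ submod_pred submod_zmod_closed.

Definition qmod : Type := Quotient.quot submod_pred.
HB.instance Definition _ := GRing.Zmodule.on qmod.

Definition qpi (x : V) : qmod := \pi_(Quotient.quot submod_pred) x.

Lemma qpi_eq x y : qpi x = qpi y <-> W (x - y).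
Proof.
split=> [/eqP|h]; first by rewrite -Quotient.idealrBE => /asboolP.
by apply/eqP; rewrite -Quotient.idealrBE; exact/asboolP.
Qed.

Lemma qpiB : zmod_morphism qpi.
Proof. by move=> x y; rewrite /qpi raddfB. Qed.
HB.instance Definition _ := GRing.isZmodMorphism.Build V qmod qpi qpiB.

Definition qrepr (u : qmod) : V := repr (u : Quotient.quot submod_pred).

Lemma qreprK u : qpi (qrepr u) = u.
Proof. exact: reprK. Qed.

Definition qscale (a : A) (u : qmod) : qmod := qpi (a *: qrepr u).

Lemma qscaleE a x : qscale a (qpi x) = qpi (a *: x).
Proof.
apply/qpi_eq; rewrite -scalerBr; case: (submodP W) => _ _; apply.
by apply/qpi_eq; rewrite qreprK.
Qed.

Lemma qscaleA a b u : qscale a (qscale b u) = qscale (a * b) u.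
Proof. by rewrite -[u]qreprK !qscaleE scalerA. Qed.
Lemma qscale1 : left_id 1 qscale.
Proof. by move=> u; rewrite -[u]qreprK qscaleE scale1r. Qed.
Lemma qscaleDr : right_distributive qscale +%R.
Proof. by move=> a u v; rewrite -[u]qreprK -[v]qreprK -raddfD !qscaleE scalerDr raddfD. Qed.
Lemma qscaleDl u : {morph qscale^~ u : a b / a + b}.
Proof. by move=> a b; rewrite -[u]qreprK !qscaleE scalerDl raddfD. Qed.
HB.instance Definition _ := GRing.Zmodule_isLmodule.Build A qmod qscaleA qscale1 qscaleDr qscaleDl.

Lemma qpiZ a x : qpi (a *: x) = a *: qpi x.
Proof. by rewrite -qscaleE. Qed.

End QuotientModule.

Section TensorTheory.
Local Open Scope quotient_scope.
Variables (A : comNzRingType) (M N : lmodType A).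

Lemma tensor_eq (x y : {freeg (M * N)%type / int}) : tensor_rel (x - y) ->
  \pi_(tensor M N) x = \pi_(tensor M N) y.
Proof. by move=> h; apply/eqP; rewrite -Quotient.idealrBE; exact/asboolP. Qed.

Lemma tensDl (m1 m2 : M) (x : N) : tens (m1 + m2) x = tens m1 x + tens m2 x.
Proof. by rewrite /tens -raddfD; apply: tensor_eq; rewrite opprD addrA; exact: tensor_relDl. Qed.
Lemma tensDr (m : M) (x1 x2 : N) : tens m (x1 + x2) = tens m x1 + tens m x2.
Proof. by rewrite /tens -raddfD; apply: tensor_eq; rewrite opprD addrA; exact: tensor_relDr. Qed.
Lemma tensZ a (m : M) (x : N) : tens (a *: m) x = tens m (a *: x).
Proof. by apply: tensor_eq; exact: tensor_relZ. Qed.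
Lemma tens0l (x : N) : tens (0 : M) x = 0.
Proof. by apply: (addIr (tens 0 x)); rewrite -tensDl addr0 add0r. Qed.
Lemma tens0r (m : M) : tens m (0 : N) = 0.
Proof. by apply: (addIr (tens m 0)); rewrite -tensDr addr0 add0r. Qed.
Lemma tens_suml I (r : seq I) (P : pred I) (F : I -> M) (x : N) :
  tens (\sum_(i <- r | P i) F i) x = \sum_(i <- r | P i) tens (F i) x.
Proof. by apply: (big_morph (fun m => tens m x)) => [m1 m2|]; [exact: tensDl | exact: tens0l]. Qed.
Lemma tens_sumr I (r : seq I) (P : pred I) (F : I -> N) (m : M) :
  tens m (\sum_(i <- r | P i) F i) = \sum_(i <- r | P i) tens m (F i).
Proof. by apply: (big_morph (tens m)) => [m1 m2|]; [exact: tensDr | exact: tens0r]. Qed.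

End TensorTheory.

Section TensorUnit.
Local Open Scope quotient_scope.
Variables (A : comNzRingType) (M : lmodType A).

Let ev : {freeg (M * A^o)%type / int} -> zmodule M := fglift (fun x => (x.2 : A) *: x.1 : zmodule M).
Let evB : zmod_morphism ev. Proof. exact: lift_is_additive. Qed.
HB.instance Definition _ := GRing.isZmodMorphism.Build _ _ ev evB.

(** [ev] sends the tensor of [m] and [a] to [a *: m] and kills the bilinearity relations; on
    [tens m 1] it returns [m]. *)
Lemma tens_unit_inj (m : M) : tens m (1 : A^o) = 0 -> m = 0.
Proof.
have evU x : ev << x >> = ((x.2 : A) *: x.1 : M) by rewrite /ev liftU scale1r.
move=> h; have : tensor_rel (<< (m, 1 : A^o) >> - 0).
  by apply/asboolP; move: h; rewrite /tens -[0](raddf0 (\pi_(tensor M A^o))) => /eqP; rewrite -Quotient.idealrBE.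
rewrite subr0 => hrel; suff H x : tensor_rel x -> ev x = 0 by rewrite -(H _ hrel) evU scale1r.
elim=> [|y1 y2 _ hx _ hy|m1 m2 z|m0 x1 x2|a m0 z].
- by rewrite raddf0.
- by rewrite evB hx hy subrr.
- by rewrite !evB !evU /= scalerDr -addrA -opprD subrr.
- by rewrite !evB !evU /= scalerDl -addrA -opprD subrr.
- by rewrite evB !evU /= scalerA [_ * a]mulrC subrr.
Qed.

End TensorUnit.

(* Purity of Frobenius, stated with finite systems of linear equations modulo I. *)
Definition lpure (A : comNzRingType) (p : nat) (I : A -> Prop) := forall (X Y : finType) (r : X -> Y -> A) (b : X -> A),
  (exists x : Y -> A, forall i, I (\sum_j r i j ^+ p * x j - b i ^+ p)) ->
  exists y : Y -> A, forall i, I (\sum_j r i j * y j - b i).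

(** The test module is the cokernel M of the matrix r, in which the class of b vanishes exactly when
    the system is solvable. A solution of the system of p-th powers makes the tensor of this class
    with 1 vanish after Frobenius. *)
Lemma fpure_lpure (A : comNzRingType) p : fpure A p -> lpure p (fun x : A => x = 0).
Proof.
case=> charA pure X Y r b [x hx].
pose V := {ffun X -> A^o}.
pose im (y : Y -> A) : V := [ffun i => \sum_j r i j * y j].
have imP : [/\ exists y, 0 = im y, forall u v, (exists y, u = im y) -> (exists y, v = im y) -> exists y, u - v = im y
    & forall a u, (exists y, u = im y) -> exists y, a *: u = im y].
  split=> [|u v [y ->] [z ->]|a u [y ->]].
  - by exists (fun=> 0); apply/ffunP => i; rewrite !ffunE big1 // => j _; rewrite mulr0.
  - exists (fun j => y j - z j); apply/ffunP => i; rewrite !ffunE -sumrB.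
    by apply: eq_bigr => j _; rewrite mulrBr.
  - exists (fun j => a * y j); apply/ffunP => i; rewrite !ffunE [LHS]mulr_sumr.
    by apply: eq_bigr => j _; rewrite mulrCA.
pose W := @Submod A V _ imP.
pose M := qmod W.
pose bV : V := [ffun i => b i].
pose e i : V := [ffun k => (k == i)%:R].
have dec (f : X -> A) : [ffun i => f i] = \sum_i f i *: e i :> V.
  apply/ffunP => i; rewrite ffunE sum_ffunE (bigD1 i) //= !ffunE eqxx big1 => [|k ki].
    by rewrite [_ *: _]mulr1 addr0.
  by rewrite !ffunE eq_sym (negPf ki) [_ *: _]mulr0.
(* In the Frobenius module [b i *: 1] is [b i ^+ p], which the hypothesis rewrites as the sum of the
   [r i j *: x j]. Moving [r i j] back across the tensor leaves columns of r, which are zero in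
   M. *)
have key : tens (qpi W bV : M) ((1 : A) : frobenius_module charA) = 0.
  rewrite /bV dec raddf_sum tens_suml.
  have E i : tens (qpi W (b i *: e i) : M) ((1 : A) : frobenius_module charA) =
      \sum_j tens (qpi W (r i j *: e i) : M) (x j : frobenius_module charA).
    rewrite qpiZ tensZ; have -> : b i *: ((1 : A) : frobenius_module charA) =
        \sum_j r i j *: (x j : frobenius_module charA).
      rewrite [LHS]mulr1; apply/eqP; rewrite eq_sym -subr_eq0; apply/eqP; exact: hx.
    by rewrite tens_sumr; apply: eq_bigr => j _; rewrite -tensZ -qpiZ.
  under eq_bigr => i _ do rewrite E.
  rewrite exchange_big big1 //= => j _; rewrite -tens_suml -raddf_sum.
  transitivity (tens (0 : M) (x j : frobenius_module charA)); last exact: tens0l.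
  congr tens; rewrite -[RHS](raddf0 (qpi W)); apply/qpi_eq; rewrite subr0 -dec.
  exists (fun k => (k == j)%:R); apply/ffunP => i; rewrite !ffunE (bigD1 j) //= eqxx mulr1.
  by rewrite big1 ?addr0 // => k /negPf ->; rewrite mulr0.
have e1 : tens_map (@frobenius A p charA) (tens (qpi W bV : M) (1 : A^o)) = 0.
  by rewrite tens_map_tens -[RHS]key; congr tens; exact: expr1n.
have tm0 : tens_map (M := M) (@frobenius A p charA) 0 = 0.
  by apply: (addIr (tens_map (@frobenius A p charA) 0)); rewrite -tens_mapD addr0 add0r.
move: (pure M _ _ (etrans e1 (esym tm0))) => /tens_unit_inj.
rewrite -[0](raddf0 (qpi W)) => /qpi_eq; rewrite subr0 => -[y hy].
by exists y => i; move/ffunP/(_ i): hy; rewrite !ffunE => ->; rewrite subrr.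
Qed.

Section LpureQuot.
Local Open Scope quotient_scope.

Lemma lpure_quot (A : comNzRingType) (I : idealr A) p :
  lpure p (fun x : {ideal_quot I} => x = 0) -> lpure p (fun x : A => x \in I).
Proof.
move=> h X Y r b [x hx].
have piI (f : A) : (f \in I) <-> \pi_{ideal_quot I} f = 0.
  rewrite -[f in f \in I]subr0 Quotient.idealrBE -[0 in RHS](rmorph0 \pi_{ideal_quot I}).
  by split=> [/eqP|->].
have [|y hy] := h X Y (fun i j => \pi_{ideal_quot I} (r i j)) (fun i => \pi_{ideal_quot I} (b i)).
  exists (fun j => \pi_{ideal_quot I} (x j)) => i; rewrite -[RHS](proj1 (piI _) (hx i)) rmorphB rmorph_sum rmorphXn /=.
  by congr (_ - _); apply: eq_bigr => j _; rewrite rmorphM rmorphXn.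
exists (fun j => repr (y j)) => i; apply/piI; rewrite -[RHS](hy i) rmorphB rmorph_sum; congr (_ - _).
by apply: eq_bigr => j _; rewrite rmorphM; congr (_ * _); exact: reprK.
Qed.

End LpureQuot.

Section LinearPurity.
Variables (A : comNzRingType) (p : nat).
Hypothesis p_pr : prime p.
Implicit Type I : ideal A.

(** Purity is applied to the system without unknowns whose single equation is 0 = a; its p-th power
    version holds because p is at least 2. *)
Lemma lpure_radical I : lpure p I -> isradical I.
Proof.
move=> h a Iaa; have v0 (F : void -> A) : \sum_(j : void) F j = 0 by rewrite big1 // => -[].
have [|y] := h unit void (fun _ _ => 0) (fun _ => a).
  exists (fun=> 0) => _; rewrite v0 sub0r; apply: idN.
  have [q ->] : exists q, p = q.+2 by exists p.-2; have := prime_gt1 p_pr; lia.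
  by rewrite !exprS mulrA; exact: idMr.
by move=> /(_ tt); rewrite v0 sub0r => /idN; rewrite opprK.
Qed.

(** Membership in (I : g) + (I : h) is itself a linear system modulo I, with extra unknowns u and v
    for the two summands. Frobenius is compatible with it, since g u in I implies g^p u in I. *)
Lemma lpure_addI I k (g : 'I_k -> A) l (h : 'I_l -> A) : lpure p I ->
  lpure p (addI (colI I (fun x => exists s, x = g s)) (colI I (fun x => exists s, x = h s))).
Proof.
move=> hp X Y r b [x H].
have /choice[u hu] i : exists u, colI I (fun x => exists s, x = g s) u /\
    colI I (fun x => exists s, x = h s) (\sum_j r i j ^+ p * x j - b i ^+ p - u).
  by have [u ? ?] := H i; exists u.
pose v i := \sum_j r i j ^+ p * x j - b i ^+ p - u i.
(* Rows: the original equations with the two new unknowns added, then one annihilation equation for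
   each [g s] and each [h s]. *)
pose r' (i : X + (X * 'I_k + X * 'I_l)) (j : Y + (X + X)) : A :=
  match i, j with
  | inl i, inl j => r i j
  | inl i, inr (inl i') => (i' == i)%:R
  | inl i, inr (inr i') => (i' == i)%:R
  | inr (inl (i, s)), inr (inl i') => if i' == i then g s else 0
  | inr (inr (i, s)), inr (inr i') => if i' == i then h s else 0
  | _, _ => 0
  end.
pose b' (i : X + (X * 'I_k + X * 'I_l)) : A := if i is inl i then b i else 0.
have p0 : (0 < p)%N by exact: prime_gt0.
have pick (i : X) (F G : X -> A) : (forall i', i' != i -> F i' = 0) -> \sum_i' F i' * G i' = F i * G i.
  by move=> hF; rewrite (bigD1 i) //= big1 ?addr0 // => i' /hF ->; rewrite mul0r.
have z0 (T : finType) (F : T -> A) : \sum_(t : T) 0 * F t = 0 by rewrite big1 // => t _; rewrite mul0r.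
have e0 : 0 ^+ p = 0 :> A by rewrite expr0n (gtn_eqF p0).
have z0p (T : finType) (F : T -> A) : \sum_(t : T) 0 ^+ p * F t = 0.
  by rewrite expr0n (gtn_eqF p0) z0.
have [|y hy] := hp _ _ r' b'.
  exists (fun j => match j with inl j => x j | inr (inl i) => - u i | inr (inr i) => - v i end).
  case=> [i|[[i s]|[i s]]]; rewrite !big_sumType /=.
  - rewrite !(pick i) => [|i' /negPf ->|i' /negPf ->]; [|exact: e0|exact: e0].
    rewrite eqxx expr1n !mul1r /v; set s1 := \sum_j _; set s2 := b i ^+ p.
    have -> : s1 + (- u i + - (s1 - s2 - u i)) - s2 = 0 by ring.
    exact: id0.
  - rewrite z0p (pick i) => [|i' /negPf ->]; last exact: e0.
    rewrite eqxx z0p e0 add0r addr0 subr0 mulrN; apply: idN.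
    have [h1 _] := hu i; rewrite -(prednK p0) exprSr -mulrA; apply: idM; rewrite mulrC; apply: h1; by exists s.
  - rewrite !z0p (pick i) => [|i' /negPf ->]; last exact: e0.
    rewrite eqxx e0 !add0r subr0 mulrN; apply: idN.
    have [_ h1] := hu i; rewrite -(prednK p0) exprSr -mulrA; apply: idM; rewrite mulrC; apply: h1; by exists s.
exists (fun j => y (inl j)) => i; exists (- y (inr (inl i))).
  move=> _ [s ->]; have := hy (inr (inl (i, s))); rewrite !big_sumType /= !z0.
  rewrite (pick i (fun i' => if i' == i then g s else 0)) => [|i' /negPf -> //].
  by rewrite eqxx add0r addr0 subr0 mulrC mulNr => /idN.
move=> _ [s ->].
have h1 : I (y (inr (inr i)) * h s).
  have := hy (inr (inr (i, s))); rewrite !big_sumType /= !z0.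
  rewrite (pick i (fun i' => if i' == i then h s else 0)) => [|i' /negPf -> //].
  by rewrite eqxx !add0r subr0 mulrC.
have := hy (inl i); rewrite !big_sumType /= !(pick i (fun i' => (i' == i)%:R)) => [|i' /negPf -> //|i' /negPf -> //].
rewrite eqxx !mul1r => h2; set s1 := \sum_j _ in h2 *.
have -> : (s1 - b i - - y (inr (inl i))) * h s =
    (s1 + (y (inr (inl i)) + y (inr (inr i))) - b i) * h s - y (inr (inr i)) * h s.
  by ring.
by apply: idB => //; exact: idMr.
Qed.

Lemma lpure_adjs I (zs : seq A) x : lpure p I -> adjs I [seq z ^+ p | z <- zs] (x ^+ p) -> adjs I zs x.
Proof.
move=> hp /adjsP[c hc].
have sz : size [seq z ^+ p | z <- zs] = size zs by rewrite size_map.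
have [|y hy] := hp unit 'I_(size zs) (fun _ j => zs`_j) (fun _ => x).
  exists (fun j => c (cast_ord (esym sz) j)) => _; apply: id_sym.
  rewrite (_ : \sum_j _ = \sum_i c i * [seq z ^+ p | z <- zs]`_i) //.
  rewrite (reindex (cast_ord (esym sz))) /=; last first.
    by exists (cast_ord sz) => i _; exact: val_inj.
  by apply: eq_bigr => j _; rewrite (nth_map 0) ?ltn_ord // mulrC.
apply/adjsP; exists y; apply: id_sym; have := hy tt.
by under eq_bigr => j _ do rewrite mulrC.
Qed.

Lemma lpure_adjs_exp I (zs : seq A) x a : lpure p I ->
  adjs I [seq z ^+ (p ^ a) | z <- zs] (x ^+ (p ^ a)) -> adjs I zs x.
Proof.
move=> hp; elim: a => [|a IH] h.
  by move: h; rewrite expr1 (eq_map (g := id)) ?map_id // => z; rewrite expr1.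
apply/IH/(lpure_adjs hp); rewrite -map_comp -exprM -expnSr.
by rewrite (eq_map (g := fun z => z ^+ (p ^ a.+1))) // => z /=; rewrite -exprM -expnSr.
Qed.

End LinearPurity.

(** * Base change to a purely transcendental extension *)

Section BaseChange.
Variables (K F : fieldType) (fr : {rmorphism {poly K} -> F}).
Hypothesis fr_inj : forall a, fr a = 0 -> a = 0.
Hypothesis fr_frac : forall c : F, exists d a, d != 0 /\ fr d * c = fr a.
Variable n : nat.
Local Notation S := {mpoly K[n]}.
Local Notation S' := {mpoly F[n]}.
Local Notation hc := (pihomog mdeg).
Implicit Types (J : ideal S) (g : {poly S}).

Definition cst (c : K) : F := fr c%:P.
HB.instance Definition _ := GRing.RMorphism.copy cst (fr \o polyC).

Definition emb : S -> S' := map_mpoly cst.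
HB.instance Definition _ := GRing.RMorphism.copy emb (map_mpoly cst).

Lemma cst0 : cst 0 = 0. Proof. by rewrite /cst !rmorph0. Qed.

Lemma mcoeff_emb m f : (emb f)@_m = cst f@_m.
Proof. by rewrite /emb mcoeff_map_mpoly. Qed.

(** The map S[u] -> F[x] sending u to [fr 'X]. Up to a nonzero constant from K[u], every polynomial
    over F lies in its image ([clear_denom]). *)
Definition phi : {poly S} -> S' :=
  horner_morph (fun x => mulrC (fr 'X)%:MP (emb x) : GRing.comm _ _).
HB.instance Definition _ := GRing.RMorphism.copy phi
  (horner_morph (fun x => mulrC (fr 'X)%:MP (emb x) : GRing.comm _ _)).

Lemma phiM g h : phi (g * h) = phi g * phi h. Proof. exact: rmorphM. Qed.
Lemma phiB g h : phi (g - h) = phi g - phi h. Proof. exact: rmorphB. Qed.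
Lemma phiXn g k : phi (g ^+ k) = phi g ^+ k. Proof. exact: rmorphXn. Qed.
Lemma phi_sum (T : finType) (f : T -> {poly S}) : phi (\sum_i f i) = \sum_i phi (f i).
Proof. exact: rmorph_sum. Qed.
Lemma phiC (f : S) : phi f%:P = emb f. Proof. exact: horner_morphC. Qed.
Lemma phiX : phi 'X = (fr 'X)%:MP. Proof. exact: horner_morphX. Qed.

Definition amp (a : {poly K}) : {poly S} := map_poly (@mpolyC n K) a.

Lemma coef_amp a i : (amp a)`_i = (a`_i)%:MP.
Proof. by rewrite /amp coef_map. Qed.

Lemma phi_amp a : phi (amp a) = (fr a)%:MP.
Proof.
elim/poly_ind: a => [|a c IH]; first by rewrite /amp rmorph0 !rmorph0.
rewrite /amp rmorphD rmorphM /= map_polyX map_polyC /= rmorphD rmorphM /= -/(amp a) IH phiX phiC.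
by rewrite /emb map_mpolyC !rmorphD /= !rmorphM.
Qed.

Definition cf m g : {poly K} := \poly_(i < size g) (g`_i)@_m.

Lemma coef_cf m g i : (cf m g)`_i = (g`_i)@_m.
Proof. by rewrite coef_poly; case: ltnP => // le; rewrite nth_default // mcoeff0. Qed.

Lemma mcoeff_phi m g : (phi g)@_m = fr (cf m g).
Proof.
elim/poly_ind: g => [|g f IH].
  by rewrite rmorph0 mcoeff0; apply/esym; rewrite (_ : cf m 0 = 0) ?rmorph0 // ; apply/polyP => i;
    rewrite coef_cf !coef0 mcoeff0.
have -> : cf m (g * 'X + f%:P) = cf m g * 'X + (f@_m)%:P.
  apply/polyP => i; rewrite coef_cf !coefD !coefMX !coefC mcoeffD !coef_cf.
  by case: eqP => _; rewrite ?mcoeff0.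
rewrite !rmorphD !rmorphM /= phiX phiC mcoeffD; congr (_ + _); last first.
  by rewrite /emb mcoeff_map_mpoly.
by rewrite mulrC mcoeffCM IH mulrC.
Qed.

Lemma phi_inj g : phi g = 0 -> g = 0.
Proof.
move=> h; apply/polyP => i; apply/mpolyP => m; rewrite coef0 mcoeff0 -coef_cf.
by rewrite (fr_inj (a := cf m g)) ?coef0 // -mcoeff_phi h mcoeff0.
Qed.

Lemma fr_neq0 a : a != 0 -> fr a != 0.
Proof. by apply: contraNneq => /fr_inj ->. Qed.

Lemma clear_denom (T : finType) (h : T -> S') : exists2 a, a != 0 &
  exists g : T -> {poly S}, forall t, fr a *: h t = phi (g t).
Proof.
have one (x : S') : exists2 a, a != 0 & exists g, fr a *: x = phi g.
  elim/mpolyind: x => [|c m x _ _ [a a0 [g hg]]].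
    by exists 1; [exact: oner_neq0 | exists 0; rewrite scaler0 rmorph0].
  have [d [b [d0 e]]] := fr_frac c; exists (d * a); first by rewrite mulf_neq0.
  exists (amp (a * b) * 'X_[m]%:P + amp d * g).
  rewrite scalerDr rmorphD !rmorphM /= phiC !phi_amp /emb map_mpolyX -hg !mul_mpolyC !scalerA.
  by congr (_ *: _ + _ *: _); rewrite !rmorphM //= -e; ring.
have /choice[a ha] t : exists a, a != 0 /\ exists g, fr a *: h t = phi g.
  by have [a ? ?] := one (h t); exists a.
exists (\prod_t a t); first by apply/prodf_neq0 => t _; case: (ha t).
have /choice[g hg] : forall t, exists g, fr (\prod_t a t) *: h t = phi g; last by exists g.
move=> t; have [_ [g hg]] := ha t; exists (amp (\prod_(s | s != t) a s) * g).
by rewrite (bigD1 t) //= mulrC rmorphM /= -scalerA hg rmorphM /= phi_amp mul_mpolyC.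
Qed.

Definition polyJ J g := forall i, J g`_i.

Lemma polyJ0 J : polyJ J 0. Proof. by move=> i; rewrite coef0; exact: id0. Qed.
Lemma polyJD J g g' : polyJ J g -> polyJ J g' -> polyJ J (g + g').
Proof. by move=> h h' i; rewrite coefD; exact: idD. Qed.
Lemma polyJM J g g' : polyJ J g' -> polyJ J (g * g').
Proof. by move=> h i; rewrite coefM; apply: id_sum => j _; exact: idM. Qed.

(** (S/J)[u] has no K[u]-torsion: the leading coefficient of a times the highest coefficient of g
    outside J would be the only term outside J in one coefficient of the product. *)
Lemma polyJ_tors J a g : a != 0 -> polyJ J (amp a * g) -> polyJ J g.
Proof.
move=> a0 h; apply: contrapT => /existsNP[i0 n0].
have bnd i : ~ J g`_i -> (i <= size g)%N.
  by move=> ni; rewrite leqNgt; apply/negP => lt; apply: ni; rewrite nth_default ?(ltnW lt) //; exact: id0.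
have ex : exists i, `[< ~ J g`_i >] by exists i0; exact/asboolP.
have bnd' i : `[< ~ J g`_i >] -> (i <= size g)%N by move=> /asboolP /bnd.
case: (ex_maxnP ex bnd') => i /asboolP ni max.
have la : lead_coef a != 0 by rewrite lead_coef_eq0.
apply: ni; have := h ((size a).-1 + i)%N; rewrite coefM.
have lt : ((size a).-1 < ((size a).-1 + i).+1)%N by rewrite ltnS leq_addr.
rewrite (bigD1 (Ordinal lt)) //= addKn coef_amp => H.
have : J ((a`_(size a).-1)%:MP * g`_i).
  rewrite -[_ * _](addrK (\sum_(j < ((size a).-1 + i).+1 | j != Ordinal lt) (amp a)`_j * g`_((size a).-1 + i - j))).
  apply: idB => //; apply: id_sum => j nj; rewrite coef_amp.
  have [lj|lj|ej] := ltngtP j (size a).-1; last by case/eqP: nj; exact: val_inj.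
    apply: idM; apply: contrapT => nJ; have := max _ (introT (asboolP _) nJ).
    by rewrite leqNgt ltn_subRL ltn_add2r lj.
  by rewrite (nth_default 0 (s := a)) ?mpolyC0 ?mul0r //; [exact: id0 | exact: leq_trans (leqSpred _) lj].
by rewrite mul_mpolyC => /(idZ (lead_coef a)^-1); rewrite scalerA -lead_coefE mulVf // scale1r.
Qed.

(** The extension of J to F[x], encoded by clearing denominators so that [ext_phi] can compare it
    with J[u]. *)
Lemma ext_ideal J : is_ideal (fun h : S' => exists a g, [/\ a != 0, polyJ J g & fr a *: h = phi g]).
Proof.
split=> [|x y [a [g [a0 h e]]] [b [g' [b0 h' e']]]|x y [a [g [a0 h e]]]].
- by exists 1, 0; split; [exact: oner_neq0 | exact: polyJ0 | rewrite scaler0 rmorph0].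
- exists (a * b), (amp b * g + amp a * g'); split; first by rewrite mulf_neq0.
    by apply: polyJD; exact: polyJM.
  rewrite rmorphD !rmorphM /= !phi_amp !mul_mpolyC -e -e' scalerDr !scalerA.
  by rewrite [fr b * _]mulrC.
- have [b b0 [g' /(_ tt) hg]] := clear_denom (fun _ : unit => x).
  exists (b * a), (g' tt * g); split; [by rewrite mulf_neq0 | exact: polyJM |].
  by rewrite !rmorphM /= -hg -e -scalerAl -scalerAr scalerA.
Qed.
Definition ext J := Ideal (ext_ideal J).

Lemma ext_phi J g : ext J (phi g) <-> polyJ J g.
Proof.
split=> [[a [g' [a0 h e]]]|h]; last first.
  by exists 1, g; split; [exact: oner_neq0 | | rewrite rmorph1 scale1r].
apply: (polyJ_tors a0); suff -> : amp a * g = g' by [].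
apply/eqP; rewrite -subr_eq0; apply/eqP/phi_inj.
by rewrite rmorphB rmorphM /= phi_amp mul_mpolyC e subrr.
Qed.

Lemma ext_emb J (f : S) : ext J (emb f) <-> J f.
Proof.
rewrite -phiC ext_phi; split=> [/(_ 0%N)|h i]; first by rewrite coefC.
by rewrite coefC; case: eqP => // _; exact: id0.
Qed.

Lemma ext_scale J (c : F) x : c != 0 -> ext J (c *: x) -> ext J x.
Proof. by move=> c0 /(idZ c^-1); rewrite scalerA mulVf // scale1r. Qed.

Lemma ext_mono J J' : ideal_le J J' -> ideal_le (ext J) (ext J').
Proof. by move=> le x [a [g [h1 h2 h3]]]; exists a, g; split=> // i; apply: le. Qed.

Lemma hc_phi d g : hc d (phi g) = phi (\poly_(i < size g) hc d g`_i).
Proof.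
have mc (T : fieldType) (f : {mpoly T[n]}) m : (hc d f)@_m = if mdeg m == d then f@_m else 0.
  rewrite pihomogE raddf_sum /=.
  have [mf|mf] := boolP (m \in msupp f); last first.
    rewrite big_seq_cond big1 => [|m' /andP[m'f _]].
      by rewrite (memN_msupp_eq0 mf) if_same.
    by rewrite mcoeffZ mcoeffX; case: eqP => [e|]; rewrite ?mulr0 //; rewrite -e m'f in mf.
  rewrite big_mkcond (bigD1_seq m) ?msupp_uniq //= big1 ?addr0 => [|m' nm].
    by case: ifP => _; rewrite ?mcoeff0 // mcoeffZ mcoeffX eqxx mulr1.
  by case: ifP => _; rewrite ?mcoeff0 // mcoeffZ mcoeffX (negPf nm) mulr0.
have cfE m : cf m (\poly_(i < size g) hc d g`_i) = if mdeg m == d then cf m g else 0.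
  apply/polyP => i; rewrite coef_cf coef_poly.
  case: ltnP => [lt|le]; first by rewrite mc; case: ifP => _; rewrite ?coef0 ?coef_cf.
  by rewrite mcoeff0; case: ifP => _; rewrite ?coef0 // coef_cf nth_default ?mcoeff0.
by apply/mpolyP => m; rewrite mc !mcoeff_phi cfE; case: ifP; rewrite ?rmorph0.
Qed.

Lemma hom_ext J : hom J -> hom (ext J).
Proof.
move=> hJ f d [a [g [a0 h e]]]; exists a, (\poly_(i < size g) hc d g`_i); split=> //.
  by move=> i; rewrite coef_poly; case: ifP => _; [exact: hJ | exact: id0].
by rewrite -hc_phi -e linearZ.
Qed.

Lemma hilb_ext J t : hilb (ext J) t = hilb J t.
Proof.
have [b [h1 h2 h3]] := hilbP J t; apply: (@hbasis_hilb _ _ _ _ _ (emb \o b)); split=> [i|c|f sf].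
- rewrite /= msizeE; apply/bigmax_leqP_seq => m mf _; apply: leq_trans (h1 i).
  apply: msize_mdeg_lt; rewrite mcoeff_msupp; move: mf; rewrite mcoeff_msupp.
  by apply: contraNneq => e; rewrite mcoeff_emb e cst0.
- have [a a0 [g hg]] : exists2 a, a != 0 & exists g : 'I_(hilb J t) -> {poly K}, forall i, fr a * c 0 i = fr (g i).
    have /choice[d hd] i : exists d, d != 0 /\ exists b, fr d * c 0 i = fr b.
      by have [d [e [? ?]]] := fr_frac (c 0 i); exists d; split=> //; exists e.
    exists (\prod_i d i); first by apply/prodf_neq0 => i _; case: (hd i).
    have /choice[g hg] : forall i, exists g : {poly K}, fr (\prod_i d i) * c 0 i = fr g; last by exists g.
    move=> i; have [_ [e he]] := hd i; exists (\prod_(j | j != i) d j * e).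
    by rewrite (bigD1 i) //= 2!rmorphM /= -he; ring.
  move=> /(idZ (fr a)); rewrite /lc scaler_sumr.
  have -> : \sum_i fr a *: (c 0 i *: (emb \o b) i) = phi (\sum_i amp (g i) * (b i)%:P).
    by rewrite rmorph_sum; apply: eq_bigr => i _; rewrite rmorphM /= phi_amp phiC mul_mpolyC scalerA hg.
  move=> /ext_phi H; apply/rowP => i; rewrite mxE.
  have gi0 : g i = 0.
    apply/polyP => j; have := h2 (\row_i (g i)`_j) _; rewrite coef0 => E.
    have {E} /E : J (lc b (\row_i (g i)`_j)).
      have := H j; rewrite coef_sum /lc; congr (J _); apply: eq_bigr => k _.
      by rewrite mxE coefMC coef_amp mul_mpolyC.
    by move=> /rowP/(_ i); rewrite !mxE.
  by move/eqP: (hg i); rewrite gi0 rmorph0 mulf_eq0 (negPf (fr_neq0 a0)) => /eqP.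
- rewrite (mpolywE sf); apply: spans_sum => m _; apply: spansZ.
  have [|c hc] := h3 'X_[m]; first by rewrite msizeX bmdeg.
  exists (map_mx cst c); have /ext_emb := hc.
  rewrite rmorphB /= /emb map_mpolyX /lc rmorph_sum /=; congr (ext J (_ - _)).
  by apply: eq_bigr => i _; rewrite mxE /= map_mpolyZ.
Qed.

Lemma hp_ext (R : realType) J : hp R (ext J) = hp R J.
Proof.
congr (xget _ _); apply/predeqP => q.
by split=> -[N h]; exists N => t /h; rewrite hilb_ext.
Qed.

Lemma form_emb d (f : S) : f \is d.-homog for mdeg -> emb f \is d.-homog for mdeg.
Proof.
move=> /dhomogP h; apply/dhomogP => m; rewrite mcoeff_msupp => mf; apply: h.
by rewrite mcoeff_msupp; apply: contraNneq mf => e; rewrite mcoeff_emb e cst0.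
Qed.

(* Writing p-th powers on [K[u]] in terms of u ^ p reduces a system over S[u] to one over S. *)
Lemma lpure_ext J p : p \in [pchar K] -> lpure p J -> lpure p (ext J).
Proof.
move=> charp hp X Y r b [x hx].
have p0 : (0 < p)%N by exact/prime_gt0/(pcharf_prime charp).
have charP : p \in [pchar {poly S}].
  have : p \in [pchar S] by rewrite inE (pcharf_prime charp) /= -mpolyC_nat (pcharf0 charp) mpolyC0.
  by rewrite pchar_poly.
have [a a0 [g hg]] := clear_denom (fun t : X * Y + X => match t with inl ij => r ij.1 ij.2 | inr i => b i end).
have [c c0 [z hz]] := clear_denom x.
(* With r scaled by a, b by a c and x by c^p, both r^p x and b^p are scaled by (a c)^p. *)
pose rt i j := g (inl (i, j)); pose bt i := amp c * g (inr i).
pose xt j := amp (c ^+ p.-1) * z j.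
have pb i : phi (bt i) = fr (a * c) *: b i.
  by rewrite /bt phiM phi_amp -(hg (inr i)) mul_mpolyC scalerA -rmorphM mulrC.
have pr i j : phi (rt i j) = fr a *: r i j by rewrite (hg (inl (i, j))).
have px j : phi (xt j) = fr c ^+ p *: x j.
  by rewrite /xt phiM phi_amp -hz mul_mpolyC scalerA -rmorphM -exprSr (prednK p0) rmorphXn.
have ht i : polyJ J (\sum_j rt i j ^+ p * xt j - bt i ^+ p).
  apply/ext_phi; have := idZ (fr (a * c) ^+ p) (hx i); rewrite scalerBr scaler_sumr.
  congr (ext J _); rewrite phiB phi_sum phiXn pb exprZn; congr (_ - _).
  apply: eq_bigr => j _; rewrite phiM phiXn pr px exprZn.
  by rewrite -scalerAl -scalerAr !scalerA rmorphM exprMn.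
pose N := \max_(t : X * Y + (X + Y)) match t with
  inl ij => size (rt ij.1 ij.2) | inr (inl i) => size (bt i) | inr (inr j) => size (xt j) end.
have szr i j : (size (rt i j) <= N)%N by exact: (leq_bigmax (inl (i, j) : X * Y + (X + Y))).
have szb i : (size (bt i) <= N)%N by exact: (leq_bigmax (inr (inl i) : X * Y + (X + Y))).
have szx j : (size (xt j) <= N)%N by exact: (leq_bigmax (inr (inr j) : X * Y + (X + Y))).
pose M := (N + N)%N.
have frob0 : 0 ^+ p = 0 :> S by rewrite expr0n (gtn_eqF p0).
(* In characteristic p, the p-th power of a polynomial in u has only the p-th powers of its
   coefficients, in degrees divisible by p. *)
have coefXp (f : {poly S}) k : (f ^+ p)`_k = if (p %| k)%N then f`_(k %/ p) ^+ p else 0.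
  have -> : f ^+ p = (map_poly (fun v : S => v ^+ p) f) \Po 'X^p.
    elim/poly_ind: f => [|f v IH]; first by rewrite map_poly0 comp_poly0 expr0n (gtn_eqF p0).
    rewrite -(pFrobenius_autE charP) pFrobenius_autD_comm ?pFrobenius_autE; last exact: mulrC.
    rewrite exprMn IH; apply/polyP => i; rewrite !(coef_comp_poly_Xn _ _ p0).
    rewrite coefD -polyC_exp coefC coefMXn (coef_comp_poly_Xn _ _ p0) !coef_map_id0 //.
    rewrite coefD coefMX coefC.
    case: (boolP (p %| i)%N) => [/dvdnP[j ->]|np]; last first.
      rewrite (negPf (_ : i != 0)%N); last by apply: contraNneq np => ->; exact: dvdn0.
      rewrite addr0; case: ltnP => // le; rewrite ifN //; apply: contra np => h.
      by rewrite -(subnK le) dvdn_add.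
    rewrite mulnK // muln_eq0 (gtn_eqF p0) orbF.
    case: j => [|j]; first by rewrite mul0n p0 !add0r.
    rewrite mulSn ltnNge leq_addr /= addr0 addKn dvdn_mull // mulnK //.
    by rewrite addr0.
  by rewrite (coef_comp_poly_Xn _ _ p0) coef_map_id0.
(* [D] keeps the coefficients in degrees divisible by p. A factor [f ^+ p] comes out of it as the
   polynomial whose coefficients are the p-th powers of those of f. *)
pose D (f : {poly S}) : {poly S} := \poly_(i < size f) f`_(p * i)%N.
have coefD' f k : (D f)`_k = f`_(p * k)%N.
  rewrite coef_poly; case: ltnP => // le; rewrite nth_default //.
  by apply: leq_trans le _; exact: leq_pmull.
have DM f h : D (f ^+ p * h) = map_poly (fun v : S => v ^+ p) f * D h.
  apply/polyP => k; rewrite coefD' coefM coefM.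
  rewrite (eq_bigr (fun j : 'I_(p * k).+1 => if (p %| j)%N then f`_(j %/ p) ^+ p * h`_(p * k - j) else 0)); last first.
    by move=> j _; rewrite coefXp; case: ifP => // _; rewrite mul0r.
  rewrite -big_mkcond /=.
  have lt (j : 'I_k.+1) : (p * j < (p * k).+1)%N by rewrite ltnS leq_pmul2l // -ltnS.
  rewrite (reindex_onto (fun j : 'I_k.+1 => Ordinal (lt j)) (fun j => inord (j %/ p))) /=; last first.
    move=> j pj; apply: val_inj => /=; rewrite inordK; first by rewrite mulnC divnK.
    by rewrite ltnS -(leq_pmul2l p0) mulnC divnK // -ltnS.
  rewrite (eq_bigl xpredT) => [|j]; last first.
    by rewrite dvdn_mulr //=; apply/eqP; apply: val_inj; rewrite /= mulKn // inord_val.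
  by apply: eq_bigr => j _; rewrite coef_map_id0 // coefD' mulKn // mulnBr.
have conv (f h : {poly S}) k : (size h <= N)%N ->
    (f * h)`_k = \sum_(l < N) (if (l <= k)%N then f`_(k - l) else 0) * h`_l.
  move=> sh; rewrite {1}[h](_ : _ = \sum_(l < N) h`_l *: 'X^l); last first.
    rewrite -poly_def; apply/polyP => i; rewrite coef_poly; case: ltnP => // le.
    by rewrite nth_default // (leq_trans sh).
  rewrite mulr_sumr coef_sum; apply: eq_bigr => l _.
  by rewrite -scalerAr coefZ coefMXn mulrC ltnNge; case: (l <= k)%N.
(* The matrix of multiplication by [rt]: the unknowns are N coefficients for each solution, the
   equations are the coefficients in degrees below 2 N, from which on everything vanishes. *)
pose rr (i : X * 'I_M) (j : Y * 'I_N) := if (j.2 <= i.2)%N then (rt i.1 j.1)`_(i.2 - j.2) else 0.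
pose bb (i : X * 'I_M) := (bt i.1)`_i.2.
have szD j : (size (D (xt j)) <= N)%N by apply: leq_trans (szx j); exact: size_poly.
have [|y hy] := hp _ _ rr bb.
  exists (fun j : Y * 'I_N => (D (xt j.1))`_(j.2)) => -[i k]; have := ht i (p * k)%N.
  rewrite coefB coefXp dvdn_mulr // mulKn // coef_sum; congr (J (_ - _)).
  rewrite -(pair_bigA _ (fun j (l : 'I_N) => rr (i, k) (j, l) ^+ p * (D (xt j))`_l)) /=.
  apply: eq_bigr => j _; rewrite -coefD' DM conv //; apply: eq_bigr => l _.
  by rewrite /rr /=; case: ifP => _; rewrite ?frob0 // coef_map_id0.
pose yt j : {poly S} := \poly_(l < N) (if insub l is Some l' then y (j, l') else 0).
have cyt j (l : 'I_N) : (yt j)`_l = y (j, l) by rewrite coef_poly ltn_ord valK.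
have sol i : polyJ J (\sum_j rt i j * yt j - bt i).
  move=> k; rewrite coefB coef_sum; under eq_bigr => j _ do rewrite conv ?size_poly //.
  have [lt|ge] := ltnP k M; last first.
    rewrite [X in _ - X]nth_default ?subr0; last first.
      by apply: leq_trans (szb i) (leq_trans (leq_addl N N) ge).
    apply: id_sum => j _; apply: id_sum => l _; case: ifP => _; last by rewrite mul0r; exact: id0.
    rewrite nth_default ?mul0r; first exact: id0.
    apply: leq_trans (szr i j) (leq_trans _ (leq_sub2l k (ltnW (ltn_ord l)))).
    by rewrite -(leq_add2r N) subnK // (leq_trans (leq_addl N N) ge).
  have := hy (i, Ordinal lt).
  rewrite (eq_bigr (fun q => rr (i, Ordinal lt) (q.1, q.2) * y (q.1, q.2))); last by case.
  rewrite -(pair_bigA _ (fun j (l : 'I_N) => rr (i, Ordinal lt) (j, l) * y (j, l))) /=.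
  congr (J (_ - _)); apply: eq_bigr => j _; apply: eq_bigr => l _.
  by rewrite /rr /= cyt.
exists (fun j => (fr c)^-1 *: phi (yt j)) => i.
apply: (ext_scale (c := fr (a * c))); first by rewrite fr_neq0 // mulf_neq0.
have := proj2 (ext_phi J _) (sol i); congr (ext J _).
rewrite scalerBr scaler_sumr phiB phi_sum pb; congr (_ - _); apply: eq_bigr => j _.
rewrite phiM pr -scalerAl -scalerAr !scalerA rmorphM.
by rewrite mulfK ?fr_neq0.
Qed.

End BaseChange.

(** * Ideals containing all forms of large degree *)

Section Primary.
Variables (R : realType) (K : fieldType) (n : nat).
Local Notation S := {mpoly K[n]}.
Local Notation hc := (pihomog mdeg).
Local Notation form d f := (f \is d.-homog for mdeg).
Implicit Types (J : ideal S).

Lemma forms_up J D : (forall f, form D f -> J f) -> forall t f, (D <= t)%N -> form t f -> J f.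
Proof.
move=> h t f /subnK <-; elim: (t - D)%N f => [|k IH] f; first exact: h.
move=> hf; rewrite (mpolyE f) big_seq; apply: id_sum => m mf; apply: idZ.
have dm : mdeg m = (k.+1 + D)%N by move/dhomogP: hf; exact.
have [i mi] : exists i, m i != 0%N.
  apply/existsP; apply: contraPT dm => /existsPn h0.
  suff -> : m = 0%MM by rewrite mdeg0.
  by apply/mnmP => i; rewrite mnm0E; have := h0 i; rewrite negbK => /eqP.
have le : (U_(i) <= m)%MM by rewrite lep1mP.
rewrite -(submK le) mpolyXD; apply: idMr; apply: IH; rewrite dhomogX /=.
by move: dm; rewrite -{1}(submK le) mdegD mdeg1 addn1 addSn => -[->].
Qed.

Lemma hilb_stable_conv J t : (forall f, form t.+1 f -> J f) -> hilb J t.+1 = hilb J t.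
Proof.
move=> h; have [b [h1 h2 h3]] := hilbP J t; apply: (@hbasis_hilb _ _ _ _ _ b); split=> // [i|f sf].
  exact: leqW.
have [|c hc0] := h3 (\sum_(d < t.+1) hc d f).
  apply: leq_trans (mmeasure_sum _ _ _ _) _; apply/bigmax_leqP => i _.
  exact: leq_trans (msize_hc _ _) (ltn_ord i).
exists c; rewrite (pihomog_partitionE sf) big_ord_recr /= addrAC; apply: idD => //.
exact/h/pihomogP.
Qed.

Lemma primary_hp1 J D : hom J -> (forall t f, (D <= t)%N -> form t f -> J f) -> (size (hp R J) <= 1)%N.
Proof.
move=> hJ h; rewrite (@hpE R _ _ J ((hilb J D)%:R%:P)) ?size_polyC_leq1 //.
exists D => t /subnK <-; rewrite hornerC; congr (_%:R).
elim: (t - D)%N => // k <-; rewrite addSn; apply: hilb_stable_conv => f; apply: h; lia.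
Qed.

Lemma adjs_forms J e (l : 'I_e -> S) t f : hom J -> (forall i, form 1%N (l i)) -> form t.+1 f ->
  (exists c, J (f - \sum_i c i * l i)) -> exists c, (forall i, form t (c i)) /\ J (f - \sum_i c i * l i).
Proof.
move=> hJ hl hf [c Jc]; have h := hJ _ t.+1 Jc; exists (fun i => hc t (c i)); split; first by move=> i; exact: pihomogP.
move: h; rewrite pihomogB (raddf_sum (pihomog mdeg t.+1)) (pihomog_dE hf) /=.
rewrite (eq_bigr (fun i => hc t (c i) * l i)) // => i _.
by rewrite (hcMf _ _ (hl i)) subn1.
Qed.

(** Each of the j rounds writes f as a combination of the [l i] with coefficients of one degree less
    and moves these forms into the product, until the exponents add up to more than B. *)
Lemma products_top J Jk e (l : 'I_e -> S) B N : hom J -> (forall i, form 1%N (l i)) ->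
  (forall t f, (N < t)%N -> form t f -> exists c, J (f - \sum_i c i * l i)) -> ideal_le J Jk ->
  (forall al : 'I_e -> nat, (B < \sum_i al i)%N -> Jk (\prod_i l i ^+ al i)) ->
  forall j (al : 'I_e -> nat), (B < \sum_i al i + j)%N ->
  forall t f, (N + j <= t)%N -> form t f -> Jk ((\prod_i l i ^+ al i) * f).
Proof.
move=> hJ hl hN le hk; elim=> [|j IH] al hal t f; rewrite ?addn0 => ht hf.
  by apply/idMr/hk; rewrite addn0 in hal.
case: t ht hf => [|t] ht hf; first by move: ht; rewrite addnS.
have [|c [hc' hJc]] := @adjs_forms J e l t f hJ hl hf; first by apply: hN hf; lia.
apply: (id_trans (y := (\prod_i l i ^+ al i) * \sum_i c i * l i)); first by rewrite -mulrBr; exact/idM/le.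
rewrite mulr_sumr; apply: id_sum => i _.
have := IH (fun i' => (al i' + (i' == i))%N) _ t (c i) _ (hc' i).
have e1 : (\sum_(i' < e) (i' == i : nat) = 1)%N by rewrite (bigD1 i) //= eqxx big1 // => i' /negPf ->.
have e2 : \prod_(i' < e) l i' ^+ (i' == i) = l i.
  by rewrite (bigD1 i) //= eqxx expr1 big1 ?mulr1 // => i' /negPf ->.
rewrite big_split /= e1 => H.
have {H} : Jk (\prod_i0 l i0 ^+ (al i0 + (i0 == i)) * c i) by apply: H; [rewrite -addnA add1n | rewrite -ltnS -addnS].
under eq_bigr => i' _ do rewrite exprD.
by rewrite big_split /= e2 -mulrA [l i * _]mulrC.
Qed.

(** If the exponents add up to more than the sum of the [(k i).-1], one of them reaches [k i]. *)
Lemma pigeonhole J Jk e (l : 'I_e -> S) (k : 'I_e -> nat) N : hom J -> (forall i, form 1%N (l i)) ->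
  (forall t f, (N < t)%N -> form t f -> exists c, J (f - \sum_i c i * l i)) ->
  ideal_le J Jk -> (forall i, Jk (l i ^+ k i)) ->
  forall j (al : 'I_e -> nat), (\sum_i (k i).-1 < \sum_i al i + j)%N ->
  forall t f, (N + j <= t)%N -> form t f -> Jk ((\prod_i l i ^+ al i) * f).
Proof.
move=> hJ hl hN le hk; apply: (products_top hJ hl hN le) => al hal.
have [i hi] : exists i, (k i <= al i)%N.
  apply: contrapT => /forallNP h; move: hal; rewrite ltnNge => /negP[].
  by apply: leq_sum => i _; have /negP := h i; lia.
rewrite (bigD1 i) //= -(subnK hi) exprD -!mulrA mulrCA; exact: idMr.
Qed.

End Primary.

(** * Linear systems of parameters over an infinite field *)

Section InfiniteField.
Variables (R : realType) (F : fieldType) (n : nat).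
Hypothesis F_inf : forall bad : seq F, exists c, c \notin bad.

Lemma lsop J e : hom J -> (size (hp R J) <= e.+1)%N ->
  exists cs : seq F, size cs = e /\ (size (hp R (adjs J (map (@lin F n) cs))) <= 1)%N.
Proof.
elim: e J => [|e IH] J hJ s; first by exists [::].
have [bad hb] := lin_param hJ s; have [c /hb sc] := F_inf bad.
have [cs [h1 h2]] := IH _ (hom_adj hJ (form_lin n c)) sc.
by exists (c :: cs); rewrite /= h1.
Qed.

End InfiniteField.

(** * The initial degree of (I : P) for F-pure quotients *)

Section InitialDegree.
Variables (R : realType) (K F : fieldType) (fr : {rmorphism {poly K} -> F}).
Hypothesis fr_inj : forall a, fr a = 0 -> a = 0.
Hypothesis fr_frac : forall c : F, exists d a, d != 0 /\ fr d * c = fr a.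
Variables (n p : nat).
Hypothesis charK : p \in [pchar K].
Local Notation S := {mpoly K[n]}.
Local Notation hc := (pihomog mdeg).
Local Notation form d f := (f \is d.-homog for mdeg).
Local Notation ext := (ext fr_frac).

Lemma fr_inf (bad : seq F) : exists c, c \notin bad.
Proof.
apply: contrapT => /forallNP h.
have : (size [seq fr 'X^i | i <- iota 0 (size bad).+1] <= size bad)%N.
  apply: uniq_leq_size => [|c _]; last by apply/negPn/negP/h.
  rewrite map_inj_uniq ?iota_uniq // => i j e.
  have : fr ('X^i - 'X^j) = 0 by rewrite rmorphB /= e subrr.
  move=> /fr_inj/eqP; rewrite subr_eq0 => /eqP /(congr1 (fun q : {poly K} => size q)).
  by rewrite !size_polyXn => -[].
by rewrite size_map size_iota ltnn.
Qed.

Lemma init_degree (I : ideal S) k f1 D : hom I -> lpure p I -> form k f1 -> ~ I f1 ->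
  isprime (col I f1) -> size (hp R (col I f1)) = D.+1 ->
  exists t f, [/\ (t <= D)%N, form t f, colI I (col I f1) f & ~ col I f1 f].
Proof.
move=> hI pI hf1 nf1; set P := col I f1 => pP sP; set J := colI I P.
have p_pr := pcharf_prime charK.
have rad : isradical I := lpure_radical p_pr pI.
have hP : hom P := hom_col hI hf1; have hJ : hom J := hom_colI hI hP.
have Jf1 : J f1 by move=> q; rewrite mulrC.
have nPf1 : ~ P f1 by move=> /rad.
apply: contrapT => hno.
have sub t f : (t <= D)%N -> form t f -> J f -> P f.
  by move=> tD hf Jf; apply: contrapT => nPf; apply: hno; exists t, f.
pose B := addI J P; have hB : hom B := hom_addI hJ hP.
have subB t f : (t <= D)%N -> form t f -> B f -> P f.
  move=> tD hf /(hB _ t); rewrite (pihomog_dE hf) => -[x Jx Pfx].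
  have e : P (f - hc t x) by have := hP _ t Pfx; rewrite pihomogB (pihomog_dE hf).
  apply: id_trans e _.
  by apply: (sub t) => //; [exact: pihomogP | exact: hJ].
have B1 : ~ B 1 by move=> /(subB 0%N 1 isT (dhomog1 _ _)); case: pP.
(* [f1] lies in J because f1 P is in I, but not in P because I is radical; so adding J to P lowers
   the dimension. *)
have sB : (size (hp R B) <= D)%N.
  have hA := hom_adj hP hf1.
  apply: leq_trans (hp_mono R hA hB _) _.
    by apply: adj_sub; [exact: addI_ler | exact: addI_lel].
  by rewrite (hp_adj_prime R hP pP hf1 nPf1) size_dl // sP.
(* Both summands of B are colon ideals of I, by generators of P and by [f1], as [lpure_addI]
   requires. *)
have pB : lpure p B.
  have [gs hgs] := acc_fg (@mpoly_acc K n) P.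
  have eJ : J = colI I (fun x => exists s : 'I_(size gs), x = gs`_s).
    apply: ideal_ext => y hy; first by move=> _ [s ->]; apply: hy; apply/hgs;
      exists (fun i => (i == s)%:R); rewrite (bigD1 s) //= eqxx mul1r big1 ?addr0 // => i /negPf ->; rewrite mul0r.
    move=> q /hgs[c ->]; rewrite mulr_sumr; apply: id_sum => i _; rewrite mulrCA; apply: idM.
    by apply: hy; exists i.
  have eP : P = colI I (fun x => exists s : 'I_1, x = (fun _ => f1) s).
    by apply: ideal_ext => y hy; [move=> _ [_ ->] | apply: hy; exists ord0].
  by rewrite /B {1}eJ eP; exact: lpure_addI.
have sB0 := hp_gt0 R hB B1.
have [e eB] : exists e, size (hp R B) = e.+1 by exists (size (hp R B)).-1; rewrite prednK.
have eD : (e < D)%N by rewrite -eB.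
pose B' := ext B; have hB' : hom B' := @hom_ext _ _ _ fr_frac _ _ hB.
have [|cs [scs sQ]] := @lsop R F n fr_inf B' e hB'; first by rewrite (hp_ext fr_inj) eB.
pose ls := map (@lin F n) cs; have sls : size ls = e by rewrite size_map.
have fls l : l \in ls -> form 1%N l by move=> /mapP[c _ ->]; exact: form_lin.
have [hQ _] := @hp_adjs_size R F n B' ls hB' (fun l h => ex_intro2 _ _ 1%N (fls l h) isT).
have [N hN] := hp1_primary hQ sQ.
have key x : form D x -> adjs B' ls x.
  move=> hx; apply: (@lpure_adjs_exp _ p _ _ _ N) (lpure_ext fr_inj charK pB) _ => //.
  set q := (p ^ N)%N; have Nq : (N < q)%N by apply: ltn_expl; exact: prime_gt1.
  have := @pigeonhole F n B' (adjs B' [seq z ^+ q | z <- ls]) (size ls) (fun i => ls`_i) (fun _ => q) N hB'.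
  move=> /(_ _ _ (@adjs_le _ B' _) _ (D * q - N)%N (fun _ => 0%N) _ (D * q)%N (x ^+ q)).
  rewrite [\prod_(i < size ls) _]big1 ?mul1r => [|i _]; last by rewrite expr0.
  have qD : (e.+1 * q <= D * q)%N by rewrite leq_mul2r eD orbT.
  have qe : (e.+1 * q = e * q + q)%N by rewrite mulSn addnC.
  apply=> [i|t f Nt hf|i|||].
  - exact/fls/mem_nth.
  - by apply/adjsP; apply: hN hf; exact: ltnW.
  - by apply: adjs_mem; apply/mapP; exists ls`_i => //; exact: mem_nth.
  - rewrite !big_const_ord !iter_addn_0 mul0n add0n sls.
    have : (q.-1 * e <= e * q)%N by rewrite mulnC leq_mul2l leq_pred orbT.
    lia.
  - lia.
  - exact: dhomogMn.
pose P' := ext P; have hP' : hom P' := @hom_ext _ _ _ fr_frac _ _ hP.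
(* By the contradiction hypothesis, B has no forms of degree D outside P; the same then holds for
   the extensions. *)
have BP x : form D x -> B' x -> P' x.
  move=> hx [a [g [a0 h1 h2]]]; exists a, (\poly_(i < size g) hc D g`_i); split=> //.
    move=> i; rewrite coef_poly; case: ifP => _; last exact: id0.
    by apply: (subB D) => //; [exact: pihomogP | exact: hB].
  by rewrite -hc_phi -h2 linearZ /= (pihomog_dE hx).
(* The relation expressing x by the linear forms modulo B' can be taken homogeneous of degree D,
   where B' may be replaced by P'. So e linear forms cut P' down to dimension 0, against e < D. *)
have key2 x : form D x -> adjs P' ls x.
  move=> hx; have [D' eD'] : exists D', D = D'.+1 by exists D.-1; rewrite prednK // (leq_ltn_trans _ eD).
  have hx' : form D'.+1 x by rewrite -eD'.
  have [|c [hc' Bc]] := @adjs_forms F n B' _ (fun i => ls`_i) D' x hB' _ hx' (proj1 (adjsP _ _ _) (key x hx)).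
    by move=> i; exact/fls/mem_nth.
  apply/adjsP; exists c; apply: BP => //; apply: rpredB => //; apply: rpred_sum => i _.
  by rewrite eD' -addn1; apply: dhomogM => //; exact/fls/mem_nth.
have [hPl le] := @hp_adjs_size R F n P' ls hP' (fun l h => ex_intro2 _ _ 1%N (fls l h) isT).
have le1 := primary_hp1 R hPl (forms_up key2).
have : (D.+1 <= 1 + e)%N by rewrite -sP -(hp_ext fr_inj fr_frac R P) -sls; apply: leq_trans le _; rewrite leq_add2r.
lia.
Qed.

End InitialDegree.

(** * Comparison with the quotient-ring definitions *)

Section Fraction.
Local Open Scope quotient_scope.

Lemma fraction_frac (D : idomainType) (c : {fraction D}) :
  exists d a : D, d != 0 /\ tofrac d * c = tofrac a.
Proof.
elim/quotW: c => x; exists (frac x).2, (frac x).1; split; first exact: denom_ratioP.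
unlock FracField.tofrac; rewrite -[LHS]FracField.pi_mul; apply/eqP.
rewrite FracField.equivf_def /FracField.mulf /= !numden_Ratio ?mulf_neq0 ?oner_neq0 ?denom_ratioP //.
by rewrite !mul1r !mulr1 mulrC.
Qed.

End Fraction.

Section MakeIdeal.
Variables (A : comNzRingType) (J : ideal A).

(** The proof of properness is an argument so that the [idealr] structure can be attached to the
    predicate. *)
Definition proper_pred (_ : ~ J 1) : {pred A} := fun x => `[< J x >].
Variable hJ : ~ J 1.

Lemma proper_pred_closed : idealr_closed (proper_pred hJ).
Proof.
split; first exact/asboolP/id0.
  by apply/negP => /asboolP.
by move=> a u v /asboolP hu /asboolP hv; apply/asboolP/idD => //; exact: idM.
Qed.

HB.instance Definition _ := isIdealr.Build A (proper_pred hJ) proper_pred_closed.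

Definition to_idealr : idealr A := proper_pred hJ.

Lemma to_idealrE x : (x \in to_idealr) <-> J x.
Proof. by split=> [/asboolP|h]; last exact/asboolP. Qed.
End MakeIdeal.

Section MakePrime.
Variables (A : comNzRingType) (J : ideal A).

Definition prime_pred (_ : isprime J) : {pred A} := fun x => `[< J x >].
Variable hJ : isprime J.

Lemma prime_pred_closed : idealr_closed (prime_pred hJ).
Proof.
split; first exact/asboolP/id0.
  by apply/negP => /asboolP; case: hJ.
by move=> a u v /asboolP hu /asboolP hv; apply/asboolP/idD => //; exact: idM.
Qed.
HB.instance Definition _ := isIdealr.Build A (prime_pred hJ) prime_pred_closed.

Lemma prime_pred_prime : prime_idealr_closed (prime_pred hJ).
Proof. by move=> u v /asboolP /hJ.2[] h; apply/orP; [left | right]; exact/asboolP. Qed.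
HB.instance Definition _ := isPrimeIdealrClosed.Build A (prime_pred hJ) prime_pred_prime.

Definition to_prime : prime_idealr A := prime_pred hJ.

Lemma to_primeE x : (x \in to_prime) <-> J x.
Proof. by split=> [/asboolP|h]; last exact/asboolP. Qed.
End MakePrime.

Section OfIdealr.
Variables (A : comNzRingType) (I : idealr A).

Lemma of_idealr_ideal : is_ideal (fun x => x \in I).
Proof. by split=> [|x y|a x]; [exact: idealr0 | exact: rpredD | exact: idealMr]. Qed.
Definition of_idealr := Ideal of_idealr_ideal.

Lemma of_idealr1 : ~ of_idealr 1.
Proof. by rewrite /= idealr1. Qed.
End OfIdealr.

Section KrullDim.
Local Open Scope quotient_scope.
Variables (R : realType) (K : fieldType) (n : nat).
Local Notation S := {mpoly K[n]}.

Lemma pi_mem (I : idealr S) (f : S) : f \in I <-> \pi_{ideal_quot I} f = 0.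
Proof.
rewrite -[f in f \in I]subr0 Quotient.idealrBE -[0 in RHS](rmorph0 \pi_{ideal_quot I}).
by split=> [/eqP|->].
Qed.

(** Primes of the quotient are pulled back to S and bounded by [chain_size]; conversely the chain of
    [prime_chain_ex] is pushed down. The bound being attained, [krull_dim] does not take its default
    value. *)
Lemma krull_dimE (I : idealr S) : hom (of_idealr I) -> krull_dim {ideal_quot I} = hdim R (of_idealr I).
Proof.
move=> hI; pose Q : comNzRingType := {ideal_quot I}.
pose pi : {rmorphism S -> Q} := \pi_Q.
have s := size_hdim R hI (@of_idealr1 _ I).
have up e : prime_chain Q e -> (e <= hdim R (of_idealr I))%N.
  case=> P hP; rewrite -ltnS -s.
  have idP' (i : nat) : is_ideal (fun f : S => pi f \in P (inord i)).
    split=> [|x y hx hy|a x hx]; first by rewrite rmorph0 idealr0.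
      by rewrite rmorphD rpredD.
    by rewrite rmorphM idealMr.
  apply: (@chain_size R K n _ e (fun i => Ideal (idP' i)) hI).
  - by move=> f /pi_mem h /=; rewrite (_ : pi f = 0) ?idealr0.
  - move=> i _; split=> [|a b] /=; first by rewrite rmorph1 idealr1.
    by rewrite rmorphM prime_idealrM => /orP.
  - move=> i ie; have lt : ((inord i : 'I_e.+1) < (inord i.+1 : 'I_e.+1))%N by rewrite !inordK // ltnS ltnW.
    have [h1 h2] := hP _ _ lt; split=> [f /=|h]; first exact: h1.
    apply: h2 => x; have -> : x = pi (repr x) by rewrite /pi /= reprK.
    exact: h.
have ex : prime_chain Q (hdim R (of_idealr I)).
  have [P [h1 h2 h3]] := prime_chain_ex R hI (@of_idealr1 _ I); set d := hdim R _ in h1 h3 *.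
  have mono i j : (i <= j)%N -> (j <= d)%N -> ideal_le (P i) (P j).
    move=> /subnK <-; elim: (j - i)%N => [|k IH] le x Px; first by [].
    by have [h _] := h3 _ le; apply/h/IH => //; exact: ltnW.
  have idQ (i : 'I_d.+1) : is_ideal (fun q : Q => exists2 f, P i f & pi f = q).
    split=> [|x y [f hf <-] [g hg <-]|a x [f hf <-]].
    - by exists 0; [exact: id0 | exact: rmorph0].
    - by exists (f + g); [exact: idD | exact: rmorphD].
    - exists (repr a * f); first exact: idM.
      by rewrite rmorphM; congr (_ * _); exact: reprK.
  have memQ (i : 'I_d.+1) f : Ideal (idQ i) (pi f) -> P i f.
    move=> [g hg e]; apply: id_trans (hg); apply: (mono 0%N) => //; first by rewrite -ltnS.
    by apply/h2/pi_mem; rewrite rmorphB; apply/eqP; rewrite subr_eq0 eq_sym; apply/eqP.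
  have prQ (i : 'I_d.+1) : isprime (Ideal (idQ i)).
    have [p1 p2] := h1 i (ltnSE (ltn_ord i)).
    split=> [h|a b]; first by apply/p1/memQ; rewrite rmorph1.
    have -> : a = pi (repr a) by rewrite /pi /= reprK.
    have -> : b = pi (repr b) by rewrite /pi /= reprK.
    rewrite -rmorphM => /memQ/p2[h|h]; [left; by exists (repr a) | right; by exists (repr b)].
  exists (fun i => to_prime (prQ i)) => i j ij; split=> [x|h].
    move=> /to_primeE[f hf <-]; apply/to_primeE; exists f => //.
    by apply: mono hf; [exact: ltnW | rewrite -ltnS].
  have id : (i < d)%N by apply: leq_trans ij _; rewrite -ltnS.
  have [_ nsub] := h3 _ id; apply: nsub => f hf.
  have /h/to_primeE/memQ // : pi f \in to_prime (prQ j).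
  apply/to_primeE; exists f => //; apply: mono hf => //; by rewrite -ltnS.
rewrite /krull_dim; case: xgetP => [e _ [ce me]|/(_ (hdim R (of_idealr I)))[]]; last by split.
by apply/eqP; rewrite eqn_leq up // me.
Qed.

End KrullDim.

Section HilbertFunctionE.
Variables (R : realType) (K : fieldType) (n : nat).
Local Notation S := {mpoly K[n]}.

Lemma is_hilbert_dimE (J : idealr S) t m :
  is_hilbert_dim J t m <-> exists b : 'I_m -> S, hbasis (of_idealr J) t b.
Proof.
split=> -[b].
  move=> [h1 h2]; exists b; split=> // [c Jc|f /h2[c [hc _]]]; last by exists c.
  have [|c0 [_ u]] := h2 0; first by rewrite mmeasure0.
  rewrite -(u 0); last by rewrite (lc0 b : \sum_i _ = 0) subr0 idealr0.
  by apply/esym/u; rewrite sub0r rpredN.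
move=> [h1 h2 h3]; exists b; split=> // f /h3[c hc]; exists c; split=> // c' hc'.
apply/eqP; rewrite -subr_eq0; apply/eqP/h2; rewrite lcD -[- c']scaleN1r lcZ scaleN1r.
have -> : lc b c - lc b c' = (f - lc b c') - (f - lc b c) by ring.
exact: (idB (J := of_idealr J)).
Qed.

Lemma hilbert_functionE (J : idealr S) t : hilbert_function J t = hilb (of_idealr J) t.
Proof. by congr (xget _ _); apply/predeqP => m; exact: is_hilbert_dimE. Qed.

Lemma multiplicityE (J : idealr S) : hom (of_idealr J) ->
  multiplicity R J = (hdim R (of_idealr J))`!%:R * (hp R (of_idealr J))`_(hdim R (of_idealr J)).
Proof.
move=> hJ; rewrite /multiplicity (krull_dimE R hJ); congr (_ * _).
have s := size_hdim R hJ (@of_idealr1 _ J).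
apply: cvg_lim => //; have [N h] := hpP R hJ.
apply: cvg_trans (poly_cvg (d := hdim R (of_idealr J)) _); last by rewrite s.
apply: near_eq_cvg; near=> t; rewrite hilbert_functionE h //; near: t; exact: nbhs_infty_ge.
Unshelve. all: by end_near.
Qed.

End HilbertFunctionE.

(** * The minimum distance function *)

Lemma In_filter T (P : T -> Prop) (l : seq T) :
  exists l', forall x, List.In x l' <-> List.In x l /\ P x.
Proof.
elim: l => [|a l [l' h]]; first by exists [::]; split=> [|[]].
have [Pa|nPa] := pselect (P a).
  exists (a :: l') => x /=; rewrite h; split; first by move=> [<-|[? ?]]; split=> //; [left | right].
  by move=> [[?|?] ?]; [left | right].
exists l' => x; rewrite h /=; split; first by move=> [? ?]; split=> //; right.
by move=> [[e|?] e']; [case: nPa; rewrite e | split].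
Qed.

Lemma list_min (R : realType) T (l : seq T) (Pr : T -> Prop) (v : T -> R) :
  (exists x, List.In x l /\ Pr x) ->
  exists x, [/\ List.In x l, Pr x & forall y, List.In y l -> Pr y -> v x <= v y].
Proof.
elim: l => [|a l IH] [x [xl Px]] //.
have [|h] := pselect (exists x, List.In x l /\ Pr x); last first.
  exists a; have ea : a = x by case: xl => // xl; case: h; exists x.
  by rewrite ea; split=> // [|y [<-|yl] Py]; [left | | case: h; exists y].
move=> /IH[y [yl Py my]]; have [[Pa le]|nle] := pselect (Pr a /\ v a <= v y).
  exists a; split=> // [|z [<-|zl] Pz] //; first by left.
  by apply: le_trans le _; exact: my.
exists y; split=> // [|z [<-|zl] Pz]; [by right | | exact: my].
by apply/ltW; rewrite ltNge; apply/negP => le; case: nle.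
Qed.

Section MinDistance.
Local Open Scope classical_set_scope.
Variables (R : realType) (K : fieldType) (n : nat) (I : idealr {mpoly K[n]}).
Local Notation S := {mpoly K[n]}.
Local Notation hc := (pihomog mdeg).
Local Notation form d f := (f \is d.-homog for mdeg).
Local Notation hp := (@hp R K n).
Local Notation hdim := (@hdim R K n).
Local Notation I0 := (of_idealr I).
Hypothesis hI : hom I0.
Hypothesis radI : isradical I0.
Local Notation d := (hdim I0).

Lemma sizeI : size (hp I0) = d.+1.
Proof. exact/size_hdim/of_idealr1. Qed.

Lemma zdfP t f : zero_divisor_forms I t f <-> [/\ form t f, ~ I0 f & exists2 g, I0 (g * f) & ~ I0 g].
Proof.
split=> -[h1 h2 h3]; split=> //; first exact/negP.
- apply: contrapT => h; apply: h3 => g; split=> [gf|gI]; last by rewrite mulrC idealMr.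
  by apply: contrapT => ng; apply: h; exists g.
- exact/negP.
by case: h3 => g h4 ng h; apply/ng/h.
Qed.

(* As I is radical, (I : g) only depends on which primes of a filtration contain g. *)
Lemma finite_col : exists l : seq (ideal S), forall g, List.In (col I0 g) l.
Proof.
have [qs hqs] := pfilt_ex hI.
(* The finite list of all intersections of subfamilies of [s]. *)
have inter (s : seq (ideal S)) : exists l : seq (ideal S), forall Pr : ideal S -> Prop,
    exists2 J, List.In J l & forall x, J x <-> forall q, List.In q s -> Pr q -> q x.
  elim: s => [|q s [l hl]].
    have topP : is_ideal (fun _ : S => True) by [].
    by exists [:: Ideal topP] => Pr; exists (Ideal topP) => //; left.
  have capP (J : ideal S) : is_ideal (fun x : S => q x /\ J x).
    split=> [|x y [h1 h2] [h3 h4]|a x [h1 h2]]; split; try exact: id0; try exact: idD; exact: idM.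
  exists (l ++ map (fun J => Ideal (capP J)) l) => Pr.
  have [J Jl hJ] := hl Pr; have [Pq|nPq] := pselect (Pr q).
    exists (Ideal (capP J)); first by apply/List.in_app_iff; right; apply/List.in_map_iff; exists J.
    move=> x /=; rewrite hJ; split=> [[qx h] q' [<-|q's] //|h]; first exact: h.
    by split=> [|q' q's Pq']; apply: h => //; [left | right].
  exists J; first by apply/List.in_app_iff; left.
  move=> x; rewrite hJ; split=> [h q' [<-|q's]|h q' q's] //; first exact: h.
  by apply: h; right.
have [l hl] := inter qs; exists l => g.
have [J Jl hJ] := hl (fun q => ~ q g).
have -> // : col I0 g = J.
apply: ideal_ext => x; rewrite hJ colE => hx.
  move=> q qin nqg; have [_ pq Iq] := pfilt_in hqs qin.
  by case: (pq.2 _ _ (Iq _ hx)).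
suff : I0 ((x * g) ^+ size qs).
  elim: (size qs) => [|k IHk]; first by rewrite expr0 => /of_idealr1.
  case: k IHk => [|k] IHk; first by rewrite expr1.
  move=> h; apply/IHk/radI; rewrite -exprD; have -> : (k.+1 + k.+1 = k + k.+2)%N by lia.
  by rewrite exprD; exact: idM.
apply: pfilt_exp hqs _ => q qin; have [qg|nqg] := pselect (q g); first exact: idM.
by apply: idMr; exact: hx.
Qed.

Lemma zdf_prime t f : zero_divisor_forms I t f ->
  exists k g, [/\ form k g, ~ I0 g, isprime (col I0 g) & ideal_le (adj I0 f) (col I0 g)].
Proof.
move=> /zdfP[hf nf [g gf ng]]; have [k nk] := hom_notin hI ng.
have gf' : I0 (hc k g * f) by have := hI (k + t)%N gf; rewrite (hcMf _ _ hf) leq_addl addnK.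
have [e [h [hh nh ph]]] := col_prime hI (pihomogP _ k g) nk.
exists (e + k)%N, (h * hc k g); split=> //; first by apply: dhomogM => //; exact: pihomogP.
apply: adj_sub; first exact: col_le.
by rewrite colE mulrCA; apply: idM; rewrite mulrC.
Qed.

Lemma adj_proper t f : zero_divisor_forms I t f -> ~ adj I0 f 1.
Proof. by move=> /zdf_prime[k [g [_ _ pg le]]] /le; case: pg. Qed.

Lemma adjoinE f (J : idealr S) : is_ideal_adjoin I f J -> of_idealr J = adj I0 f.
Proof. by move=> h; apply: ideal_ext => x /h. Qed.

Lemma adjoin_mult t f : zero_divisor_forms I t f ->
  @adjoin_multiplicities K n R I t ((hdim (adj I0 f))`!%:R * (hp (adj I0 f))`_(hdim (adj I0 f))).
Proof.
move=> zf; have A1 := adj_proper zf; exists f, (to_idealr A1).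
have ad : is_ideal_adjoin I f (to_idealr A1) by move=> g; rewrite to_idealrE.
have [hf _ _] := zf.
split=> //; rewrite multiplicityE (adjoinE ad) //; exact: hom_adj hf.
Qed.

Lemma adjoin_multP t e : @adjoin_multiplicities K n R I t e ->
  exists2 f, zero_divisor_forms I t f & e = (hdim (adj I0 f))`!%:R * (hp (adj I0 f))`_(hdim (adj I0 f)).
Proof.
move=> [f [J [zf ad ->]]]; exists f => //; have [hf _ _] := zf.
by rewrite multiplicityE (adjoinE ad) //; exact: hom_adj hf.
Qed.

Lemma xget_max (E : set R) M : E M -> ubound E M -> xget 0 (E `&` ubound E) = M.
Proof.
move=> EM uM; case: xgetP => [x _ [Ex ux]|/(_ M)[]//].
by apply/eqP; rewrite eq_le uM // ux.
Qed.

Lemma min_distance_max t M : @adjoin_multiplicities K n R I t M -> ubound (@adjoin_multiplicities K n R I t) M ->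
  min_distance R I t = multiplicity R I - M.
Proof.
move=> EM uM; rewrite /min_distance; case: pselect => h; first by rewrite (xget_max EM uM).
by case: h; have [f zf _] := adjoin_multP EM; exists f.
Qed.

Definition unmixed := forall k g, form k g -> ~ I0 g -> isprime (col I0 g) -> size (hp (col I0 g)) = size (hp I0).

Section Unmixed.
Hypothesis unm : unmixed.

Lemma unmixed_hdim t f : zero_divisor_forms I t f -> size (hp (adj I0 f)) = d.+1.
Proof.
move=> zf; have [hf _ _] := zf; have [k [g [hg ng pg le]]] := zdf_prime zf.
have hA := hom_adj hI hf; have hC := hom_col hI hg.
apply/eqP; rewrite -sizeI eqn_leq (hp_mono R hI hA (@adj_le _ I0 f)) /=.
by rewrite -(unm hg ng pg) (hp_mono R hA hC le).
Qed.

(** In the unmixed case S/(I, f) still has dimension d, so the coefficients of degree d in [hp_adj]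
    can be compared. Thus [min_distance] minimizes the coefficient of degree d attached to (I :
    f). *)
Lemma unmixed_mult t f : zero_divisor_forms I t f ->
  (hdim (adj I0 f))`!%:R * (hp (adj I0 f))`_(hdim (adj I0 f)) = multiplicity R I - d`!%:R * (hp (col I0 f))`_d.
Proof.
move=> zf; have [hf _ _] := zf; have hA : hdim (adj I0 f) = d by rewrite {1}/hdim (unmixed_hdim zf).
have hC := hom_col hI hf.
rewrite hA multiplicityE // -mulrBr; congr (_ * _).
rewrite (hp_adj R hI hf) coefD coef_shift ?addrK // -sizeI.
exact: (hp_mono R hI hC (@col_le _ I0 f)).
Qed.

Lemma min_distance_eq k f1 s f t : form k f1 -> ~ I0 f1 -> isprime (col I0 f1) -> ~ ideal_le (col I0 f1) I0 ->
  (forall j g, form j g -> ~ I0 g -> isprime (col I0 g) -> (hp (col I0 f1))`_d <= (hp (col I0 g))`_d) ->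
  form s f -> colI I0 (col I0 f1) f -> ~ col I0 f1 f -> (s <= t)%N ->
  min_distance R I t = d`!%:R * (hp (col I0 f1))`_d.
Proof.
move=> hf1 nf1; move eP : (col I0 f1) => P pP nPI min hf Jf nPf st.
have IP : ideal_le I0 P by rewrite -eP; exact: col_le.
have hP : hom P by rewrite -eP; exact: hom_col hf1.
(* If P contained all variables, unmixedness would make S/I zero-dimensional; being radical, I would
   then contain the variables, hence P. *)
have [j nx] : exists j : 'I_n, ~ P 'X_j.
  apply/existsNP => /mI_sub mP; have sP := hp_mono R (@hom_mI K n) hP mP.
  have sI : (size (hp I0) <= 1)%N by rewrite -(unm hf1 nf1) eP // (leq_trans sP) // hp_mI size_poly1.
  have [N hN] := hp1_primary hI sI.
  have xI i : I0 'X_i.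
    have : I0 ('X_i ^+ N.+1) by apply: (hN (1 * N.+1)%N); [lia | exact/dhomogMn/formX].
    elim: (N) => [|a IH]; first by rewrite expr1.
    move=> h; apply/IH/radI; rewrite -exprD; have -> : (a.+1 + a.+1 = a + a.+2)%N by lia.
    by rewrite exprD; exact: idM.
  by apply: nPI; apply: (hom_le hP) => x _ _ Px; apply: (mI_sub xI); exact: (hom_sub_mI hP pP.1).
pose f' := f * 'X_j ^+ (t - s).
have hf' : form t f'.
  by rewrite -(subnKC st); apply: dhomogM => //; rewrite -[X in form X _]mul1n; exact/dhomogMn/formX.
have nPf' : ~ P f' by case/pP.2 => // /(isprime_exp pP).
have Jf' : colI I0 P f' by exact: idMr.
have cf' : col I0 f' = P.
  apply: ideal_ext => x hx; last by rewrite colE mulrC; exact: Jf'.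
  by case: (pP.2 _ _ (IP _ hx)).
have zf' : zero_divisor_forms I t f'.
  apply/zdfP; split=> //; first by move/IP.
  have /existsNP[x /not_implyP[Px nIx]] := nPI; exists x => //; rewrite mulrC; exact: Jf'.
have E := adjoin_mult zf'; rewrite (unmixed_mult zf') cf' in E.
rewrite (min_distance_max E); first by rewrite opprB addrC subrK.
move=> e /adjoin_multP[g zg ->]; rewrite (unmixed_mult zg) lerD2l lerN2 ler_wpM2l ?ler0n //.
have [hg ng _] := zg; have {}ng : ~ I0 g by exact/negP.
(* (I : g) lies in an associated prime (I : h g), whose coefficient is at least the minimum. *)
have [e0 [h [hh nh ph]]] := col_prime hI hg ng.
apply: le_trans (min _ _ (dhomogM hh hg) nh ph) _.
apply: hp_coef_mono; [exact: hom_col hg | exact: hom_col (dhomogM hh hg) | |].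
  by rewrite -colM; move=> x; rewrite !colE => hx; rewrite mulrAC; exact: idMr.
by rewrite -sizeI; exact: (hp_mono R hI (hom_col hI hg) (@col_le _ I0 g)).
Qed.

End Unmixed.

(** A form f in an associated prime of smaller dimension, chosen outside the primes of top
    dimension, is both a zero divisor and a parameter. Then S/(I, f^N) has dimension d - 1 and
    multiplicity at least N e(S/I), so [min_distance] is unbounded below. *)
Lemma mixed_diverges : ~ unmixed -> ~ cvgn (min_distance R I).
Proof.
move=> nunm cv; have [k [g [hg ng pg sg]]] : exists k g, [/\ form k g, ~ I0 g, isprime (col I0 g) &
    (size (hp (col I0 g)) < size (hp I0))%N].
  apply: contrapT => h; apply: nunm => k g hg ng pg; apply/eqP.
  rewrite eqn_leq (hp_mono R hI (hom_col hI hg) (@col_le _ I0 g)) leqNgt; apply/negP => lt.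
  by apply: h; exists k, g.
set P := col I0 g in pg sg; have hP : hom P := hom_col hI hg.
have [qs hqs] := pfilt_ex hI.
have [tops htops] := In_filter (fun q => size (hp q) = size (hp I0)) qs.
have [|j [f [hf j0 Pf nf]]] := @prime_avoidance K n tops P hP (hom_sub_mI hP pg.1).
  move=> q /htops[qin sq]; have [hq pq Iq] := pfilt_in hqs qin; split=> // le.
  by have := hp_mono R hP hq le; rewrite sq leqNgt sg.
have [q0 q0in sq0] := pfilt_size R hqs hI (@of_idealr1 _ I).
have q0top : List.In q0 tops by exact/htops.
have [hq0 pq0 Iq0] := pfilt_in hqs q0in.
have [d' ed] : exists d', d = d'.+1.
  by exists d.-1; rewrite prednK //; move: sg (hp_gt0 R hP pg.1); rewrite sizeI; lia.
have zf N : (0 < N)%N -> zero_divisor_forms I (j * N) (f ^+ N).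
  move=> N0; apply/zdfP; split; first exact: dhomogMn.
    by move/Iq0/(isprime_exp pq0); exact: nf.
  by exists g => //; rewrite mulrC -(prednK N0) exprSr -mulrA; exact: idM.
have sA N : (0 < N)%N -> size (hp (adj I0 (f ^+ N))) = d'.+1.
  move=> N0; have hfN := dhomogMn N hf; apply/eqP; rewrite eqn_leq; apply/andP; split.
    apply: (pfilt_adj hqs hfN hI) => q qin; have [hq pq Iq] := pfilt_in hqs qin.
    have [e|ne] := eqVneq (size (hp q)) (size (hp I0)).
      have nq : ~ q (f ^+ N) by move/(isprime_exp pq); apply/nf/htops.
      by rewrite (hp_adj_prime R hq pq hfN nq) size_dlE ?muln_gt0 ?j0 // e sizeI ed.
    apply: leq_trans (hp_mono R hq (hom_adj hq hfN) (@adj_le _ q _)) _.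
    have := hp_mono R hI hq Iq; rewrite leq_eqVlt (negPf ne) /= sizeI ed; exact.
  by have := hp_adj_size R hI hfN; rewrite sizeI ed; apply; rewrite muln_gt0 j0.
have e0 : 0 < multiplicity R I.
  by rewrite multiplicityE // mulr_gt0 ?ltr0n ?fact_gt0 // hp_lead_gt0 //; exact: of_idealr1.
have lb N : (0 < N)%N -> N%:R * multiplicity R I <=
    (hdim (adj I0 (f ^+ N)))`!%:R * (hp (adj I0 (f ^+ N)))`_(hdim (adj I0 (f ^+ N))).
  move=> N0; have hA : hdim (adj I0 (f ^+ N)) = d' by rewrite {1}/hdim sA.
  have := @hp_adj_coef R K n I0 _ _ d' hI (dhomogMn N hf).
  rewrite sizeI ed sA // => /(_ (leqnn _) (leqnn _)) le.
  rewrite hA multiplicityE // ed factS natrM.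
  apply: le_trans (ler_wpM2l (ler0n _ _) le).
  have c0 : 0 <= (hp I0)`_d'.+1 by apply: hp_coef_ge0 => //; rewrite sizeI ed.
  have -> : N%:R * (d'.+1%:R * d'`!%:R * (hp I0)`_d'.+1) = d'`!%:R * (N%:R * d'.+1%:R * (hp I0)`_d'.+1) by ring.
  rewrite ler_wpM2l ?ler0n // ler_wpM2r // ler_wpM2r ?ler0n // ler_nat.
  exact: leq_pmull.
have ub N : (0 < N)%N -> min_distance R I (j * N) <= multiplicity R I - N%:R * multiplicity R I.
  move=> N0; have [l hl] := finite_col; set t := (j * N)%N.
  (* In a fixed degree t the multiplicity of S/(I, h) depends only on (I : h), which has finitely
     many values by [finite_col]. So the maximum exists and [xget] does not fall back to 0. *)
  pose G (Q : ideal S) := let p := hp I0 - shift t (hp Q) in ((size p).-1)`!%:R * p`_(size p).-1.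
  have EG h : zero_divisor_forms I t h ->
      (hdim (adj I0 h))`!%:R * (hp (adj I0 h))`_(hdim (adj I0 h)) = G (col I0 h).
    move=> zh; have [hh _ _] := zh.
    by rewrite /G (_ : hp I0 - _ = hp (adj I0 h)) // [X in X - _](hp_adj R hI hh) addrK.
  have [|Q [Ql [h zh eQ] mQ]] := @list_min R _ l
      (fun Q => exists2 h, zero_divisor_forms I t h & Q = col I0 h) (fun Q => - G Q).
    by exists (col I0 (f ^+ N)); split=> //; exists (f ^+ N) => //; exact: zf.
  have E := adjoin_mult zh; rewrite (min_distance_max E).
    rewrite lerD2l lerN2; apply: le_trans (lb N N0) _.
    rewrite !EG //; last exact: zf.
    by rewrite -lerN2 -eQ; apply: mQ => //; exists (f ^+ N) => //; exact: zf.
  move=> e /adjoin_multP[h' zh' ->]; rewrite !EG // -lerN2 -eQ; apply: mQ => //.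
  by exists h'.
have [M [_ hM]] := cvg_seq_bounded cv.
pose B := `|M| + 1.
have hB t : - B <= min_distance R I t.
  have lt : M < B by rewrite /B ltr_pwDr // ler_norm.
  by have /= := hM B lt t Logic.I; rewrite ler_norml => /andP[].
(* This N makes e - N e smaller than -B, where e is the multiplicity of S/I. *)
have [N hN] : exists N : nat, 1 + B / multiplicity R I < N%:R.
  by exists (Num.bound (1 + B / multiplicity R I)); apply: archi_boundP;
    rewrite addr_ge0 ?ler01 ?divr_ge0 ?(ltW e0) ?addr_ge0.
have N0 : (0 < N)%N.
  rewrite -(ltr0n R); apply: lt_trans hN; rewrite ltr_pwDl // divr_ge0 ?(ltW e0) //.
  by rewrite addr_ge0.
have := le_trans (hB (j * N)%N) (ub N N0); rewrite leNgt => /negP[].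
move: hN; rewrite -ltrBrDl ltr_pdivrMr // => lt.
by rewrite -ltrN2 opprK opprB -[X in _ - X]mul1r -mulrBl.
Qed.

Lemma reg_index_le s0 r :
  (forall k f1, form k f1 -> ~ I0 f1 -> isprime (col I0 f1) -> size (hp (col I0 f1)) = size (hp I0) ->
     exists s f, [/\ (s <= s0)%N, form s f, colI I0 (col I0 f1) f & ~ col I0 f1 f]) ->
  is_regularity_index R I r -> (r <= s0)%N.
Proof.
move=> H [cv er mr].
have [unm|/mixed_diverges//] := pselect unmixed.
(* For I prime there are no zero-divisor forms, so [min_distance] is constant and r = 0. *)
have [pI|npI] := pselect (isprime I0).
  have const t : min_distance R I t = multiplicity R I.
    rewrite /min_distance; case: pselect => //= -[f /zdfP[_ nf [g gf ng]]].
    by case: (pI.2 _ _ gf).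
  suff : (r <= 0)%N by lia.
  apply: mr; rewrite (_ : min_distance R I = fun=> multiplicity R I); last exact/funext.
  by rewrite lim_cst.
have [a [b [i [j [ha hb Iab na nb]]]]] := not_prime_forms hI (@of_idealr1 _ I) npI.
have [l hl] := finite_col.
have [|P [Pl [f1 [[k hf1] nf1 pf1 eP]] minP]] := @list_min R _ l
    (fun P => exists f1, [/\ exists k, form k f1, ~ I0 f1, isprime (col I0 f1) & P = col I0 f1]) (fun P => (hp P)`_d).
  have [e [h [hh nh ph]]] := col_prime hI ha na.
  exists (col I0 (h * a)); split=> //; exists (h * a); split=> //; exists (e + i)%N; exact: dhomogM.
have nPI : ~ ideal_le (col I0 f1) I0.
  move=> le; apply: npI; have <- // : col I0 f1 = I0; apply: ideal_ext => //; exact: col_le.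
have [s [f [ss0 hf Jf nPf]]] := H _ _ hf1 nf1 pf1 (unm _ _ hf1 nf1 pf1).
have E t : (s <= t)%N -> min_distance R I t = d`!%:R * (hp (col I0 f1))`_d.
  move=> st; apply: (min_distance_eq unm hf1 nf1 pf1 nPI _ hf Jf nPf st) => k' g hg ng pg.
  by rewrite -eP; apply: minP => //; exists g; split=> //; exists k'.
apply: leq_trans ss0; apply: mr; rewrite (E s (leqnn _)); apply/esym.
apply: (@lim_near_cst _ _ _ _ _ (d`!%:R * (hp (col I0 f1))`_d)) => //.
by near=> t; apply: E; near: t; exact: nbhs_infty_ge.
Unshelve. all: by end_near.
Qed.

End MinDistance.

(** * The bound by the dimension *)

Section DimensionBound.
Variables (R : realType) (K : fieldType) (p n : nat) (I : idealr {mpoly K[n]}).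
Hypothesis charK : p \in [pchar K].
Hypothesis hI : homogeneous_ideal I.
Hypothesis SI_fpure : fpure {ideal_quot I} p.

Definition KX := {fraction {poly K}}.
Definition frX : {rmorphism {poly K} -> KX} := @tofrac {poly K}.

Lemma frX_inj a : frX a = 0 -> a = 0.
Proof. by move/eqP; rewrite tofrac_eq0 => /eqP. Qed.

Lemma frX_frac (c : KX) : exists d a, d != 0 /\ frX d * c = frX a.
Proof. exact: fraction_frac. Qed.

Lemma fpure_lpureI : lpure p (of_idealr I).
Proof. exact/lpure_quot/fpure_lpure. Qed.

Lemma fpure_radical : isradical (of_idealr I).
Proof. exact: (lpure_radical (pcharf_prime charK) fpure_lpureI). Qed.

Lemma reg_index_le_dim r : is_regularity_index R I r -> (r <= krull_dim {ideal_quot I})%N.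
Proof.
have hI' : hom (of_idealr I) by move=> f d; exact: hI.
rewrite (krull_dimE R hI') => hr; apply: (reg_index_le hI' fpure_radical _ hr).
move=> k f1 hf1 nf1 pf1 s1.
have sP : size (hp R (col (of_idealr I) f1)) = (hdim R (of_idealr I)).+1.
  by rewrite s1 size_hdim //; exact: of_idealr1.
have [t [f [h1 h2 h3 h4]]] := init_degree frX_inj frX_frac charK hI' fpure_lpureI hf1 nf1 pf1 sP.
by exists t, f.
Qed.

End DimensionBound.

(** * Noetherian local rings of finite injective dimension *)

Lemma qmod_lift (A : comNzRingType) (V M : lmodType A) (W : submod V) (f : {linear V -> M}) :
  (forall x, W x -> f x = 0) -> exists g : {linear qmod W -> M}, forall x, g (qpi W x) = f x.
Proof.
move=> h; pose g (u : qmod W) : M := f (qrepr u).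
have gE x : g (qpi W x) = f x.
  have fB : f (qrepr (qpi W x) - x) = g (qpi W x) - f x by exact: raddfB.
  by apply/eqP; rewrite -subr_eq0 -fB h //; apply/qpi_eq; rewrite qreprK.
have gl : linear g.
  by move=> a u v; rewrite -[u]qreprK -[v]qreprK -qpiZ -raddfD !gE linearP.
pose gL : {linear qmod W -> M} := HB.pack g (GRing.isLinear.Build A (qmod W) M *:%R g gl).
by exists gL.
Qed.

Section LinearSystems.
Variable A : comNzRingType.

(* A linear system over [E] is solvable as soon as it is compatible. *)
Definition solvable (E : lmodType A) := forall s r (Z : 'M[A]_(s, r)) (g : 'I_s -> E),
  (forall c : 'rV_s, c *m Z = 0 -> \sum_i c 0 i *: g i = 0) ->
  exists h : 'I_r -> E, forall i, \sum_j Z i j *: h j = g i.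

(** By compatibility, c Z |-> sum c_i g_i is well defined on the row space of Z, realized as a
    quotient of A^s. Its extension to A^r, evaluated on the unit vectors, solves the system. *)
Lemma injective_solvable E : injective_module E -> solvable E.
Proof.
move=> inj s r Z g hg.
have lf : linear (fun c : 'rV[A]_s => \sum_i c 0 i *: g i).
  move=> a u v; rewrite scaler_sumr -big_split; apply: eq_bigr => i _.
  by rewrite !mxE scalerDl scalerA.
pose f : {linear 'rV[A]_s -> E} := HB.pack (fun c : 'rV[A]_s => \sum_i c 0 i *: g i)
  (GRing.isLinear.Build A 'rV[A]_s E *:%R _ lf).
have li : linear (fun c : 'rV[A]_s => c *m Z) by move=> a u v; rewrite mulmxDl scalemxAl.
pose mulZ : {linear 'rV[A]_s -> 'rV[A]_r} := HB.pack (fun c : 'rV[A]_s => c *m Z)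
  (GRing.isLinear.Build A 'rV[A]_s 'rV[A]_r *:%R _ li).
have sW : [/\ (0 : 'rV[A]_s) *m Z = 0, forall x y : 'rV[A]_s, x *m Z = 0 -> y *m Z = 0 -> (x - y) *m Z = 0
    & forall (a : A) (x : 'rV[A]_s), x *m Z = 0 -> (a *: x) *m Z = 0].
  by split=> [|x y hx hy|a x hx]; rewrite ?mul0mx // ?mulmxBl ?hx ?hy ?subrr // -scalemxAl hx scaler0.
pose W := Submod sW.
have [f' hf'] := @qmod_lift _ _ _ W f hg.
have [m' hm'] := @qmod_lift _ _ _ W mulZ (fun x h => h).
have minj : injective m'.
  move=> u v; rewrite -[u]qreprK -[v]qreprK !hm' => e; apply/qpi_eq.
  by rewrite /= mulmxBl; apply/eqP; rewrite subr_eq0; apply/eqP.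
have [h hh] := inj _ _ m' f' minj.
exists (fun j => h (delta_mx 0 j)) => i.
have := hh (qpi W (delta_mx 0 i)); rewrite hm' hf' /= => e.
rewrite (bigD1 i) //= mxE !eqxx scale1r big1 ?addr0 in e; last first.
  by move=> k /negPf nk; rewrite mxE nk andbF scale0r.
rewrite -e -rowE [row i Z]row_sum_delta raddf_sum /=; apply: eq_bigr => j _.
by rewrite linearZ /= mxE.
Qed.

(** Induction on r: generators of the ideal of first coordinates are lifted to W, and the vectors of
    W with first coordinate 0 form a submodule with one coordinate less. *)
Lemma row_fg (accA : acc A) r (W : submod 'rV[A]_r) :
  exists m (G : 'M[A]_(m, r)), forall v, W v <-> exists c, v = c *m G.
Proof.
elim: r W => [|r IH] W; case: (submodP W) => W0 WB WZ.
  by exists 0%N, 0 => v; rewrite [v]thinmx0; split=> // _; exists 0; rewrite mulmx0.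
have WD u v : W u -> W v -> W (u + v).
  by move=> hu hv; rewrite -[v]opprK; apply/WB => //; rewrite -sub0r; exact/WB.
have WS (T : finType) (F : T -> 'rV[A]_r.+1) : (forall t, W (F t)) -> W (\sum_t F t).
  by move=> h; elim/big_ind: _ => //.
have idJ : is_ideal (fun a => exists2 v, W v & v 0 ord0 = a).
  split=> [|_ _ [u hu <-] [v hv <-]|a _ [u hu <-]].
  - by exists 0; rewrite ?mxE.
  - by exists (u + v); rewrite ?mxE //; exact: WD.
  - by exists (a *: u); rewrite ?mxE //; exact: WZ.
have [s hs] := acc_fg accA (Ideal idJ).
have /choice[w hw] (i : 'I_(size s)) : exists v, W v /\ v 0 ord0 = s`_i.
  have [|v h1 h2] := (hs s`_i).2; last by exists v.
  by exists (fun j => (j == i)%:R); rewrite (bigD1 i) //= eqxx mul1r big1 ?addr0 // => j /negPf ->; rewrite mul0r.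
have sW' : [/\ W (row_mx (0 : 'rV_1) (0 : 'rV_r)),
    forall x y : 'rV_r, W (row_mx (0 : 'rV_1) x) -> W (row_mx (0 : 'rV_1) y) -> W (row_mx (0 : 'rV_1) (x - y))
    & forall (a : A) (x : 'rV_r), W (row_mx (0 : 'rV_1) x) -> W (row_mx (0 : 'rV_1) (a *: x))].
  split=> [|x y hx hy|a x hx]; first by rewrite row_mx0.
    suff -> : row_mx (0 : 'rV_1) (x - y) = row_mx 0 x - row_mx 0 y :> 'rV[A]_(1 + r) by exact: WB.
    by rewrite opp_row_mx add_row_mx subrr.
  suff -> : row_mx (0 : 'rV_1) (a *: x) = a *: row_mx 0 x :> 'rV[A]_(1 + r) by exact: WZ.
  by rewrite scale_row_mx scaler0.
have [m [G hG]] := IH (Submod sW').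
have hw1 (c : 'rV_(size s)) : W (c *m \matrix_i w i).
  by rewrite mulmx_sum_row; apply: WS => i; rewrite rowK; apply/WZ/(hw i).1.
pose Gw : 'M_(size s, 1 + r) := \matrix_i w i.
have mulG (b : 'rV_(size s)) (c : 'rV_m) : row_mx b c *m col_mx Gw (row_mx (0 : 'cV_m) G) =
    b *m Gw + row_mx 0 (c *m G) by rewrite mul_row_col mul_mx_row mulmx0.
exists (size s + m)%N, (col_mx Gw (row_mx (0 : 'cV_m) G)) => v.
split=> [Wv|[c ->]]; last first.
  rewrite -[c]hsubmxK mulG; apply: WD => //.
  by apply/(hG (rsubmx c *m G)); exists (rsubmx c).
have [c hc] := (hs (v 0 ord0)).1 (ex_intro2 _ _ v Wv erefl).
pose c' : 'rV_(size s) := \row_i c i; pose u : 'rV_(1 + r) := v - c' *m \matrix_i w i.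
have Wu : W u by exact: WB.
have u0 : lsubmx u = 0.
  apply/rowP => j; rewrite [j]ord1 !mxE (_ : lshift r 0 = ord0); last exact: val_inj.
  rewrite hc; apply/eqP; rewrite subr_eq0; apply/eqP; apply: eq_bigr => i _.
  by rewrite !mxE (hw i).2.
have [b hb] : exists b, rsubmx u = b *m G by apply/(hG (rsubmx u)); rewrite /= -u0 hsubmxK.
exists (row_mx c' b); rewrite mulG -hb -u0 hsubmxK.
by rewrite /u addrC subrK.
Qed.

(** One generator is removed at a time. Modulo B, writing e_0 = x z' and expanding z' in the
    generators gives (1 - c'_0 x) e_0 in terms of the others, and 1 - c'_0 x is invertible. *)
Lemma nakayama (M : lmodType A) (C B : submod M) (x : A) m (e : 'I_m -> M) :
  (forall a, exists u, u * (1 - a * x) = 1) -> (forall k, C (e k)) ->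
  (forall z, C z -> exists c : 'I_m -> A, B (z - \sum_k c k *: e k)) ->
  (forall z, C z -> exists2 z', C z' & B (z - x *: z')) -> forall z, C z -> B z.
Proof.
case: (submodP B) => B0 BB BZ; move=> hx; elim: m e => [|m IH] e Ce gen sur z Cz.
  by have [c] := gen z Cz; rewrite big_ord0 subr0.
have BD u v : B u -> B v -> B (u + v).
  by move=> hu hv; rewrite -[v]opprK; apply/BB => //; rewrite -sub0r; exact/BB.
apply: (IH (fun k => e (fintype.lift ord0 k))) => // {Cz}z Cz.
have [c hc] := gen z Cz; have [z' Cz' hz'] := sur _ (Ce ord0); have [c' hc'] := gen z' Cz'.
have [u hu] := hx (c' ord0).
exists (fun k => c (fintype.lift ord0 k) + c ord0 * u * x * c' (fintype.lift ord0 k)).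
have h1 := BD _ _ hz' (BZ x _ hc'); have h2 := BD _ _ hc (BZ (c ord0 * u) _ h1).
move: h2; congr (B _); rewrite !big_ord_recl.
under [X in _ = _ - X]eq_bigr => k _ do rewrite scalerDl -scalerA.
rewrite big_split /= -scaler_sumr.
set S1 := \sum_(k < m) c _ *: _; set S2 := \sum_(k < m) c' _ *: _.
have -> : e ord0 - x *: z' + x *: (z' - (c' ord0 *: e ord0 + S2)) = (1 - c' ord0 * x) *: e ord0 - x *: S2.
  rewrite scalerBr scalerDr !scalerA addrA subrK opprD addrA scalerBl scale1r.
  by rewrite [x * _]mulrC.
have E0 : c ord0 *: e ord0 = (c ord0 * u) *: ((1 - c' ord0 * x) *: e ord0).
  by rewrite scalerA -mulrA hu mulr1.
rewrite scalerBr -E0 !scalerA !opprD !addrA; congr (_ - _).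
by rewrite addrAC subrK.
Qed.

End LinearSystems.

Section RegularSequences.
Variable A : comNzRingType.

Definition regular (J : ideal A) y := forall a, J (a * y) -> J a.

Fixpoint regseq (J : ideal A) (s : seq A) : Prop :=
  if s is y :: s' then regular J y /\ regseq (adj J y) s' else True.

Lemma zero_is_ideal : is_ideal (fun x : A => x = 0).
Proof. by split=> // [x y -> ->|a x ->]; rewrite ?addr0 ?mulr0. Qed.
Definition zeroI := Ideal zero_is_ideal.

Lemma zeroI_le (J : ideal A) : ideal_le zeroI J.
Proof. by move=> x ->; exact: id0. Qed.

End RegularSequences.

(** * Ext with values in the ring, and duality *)

Section LocalGorenstein.
Variables (A : comNzRingType) (E : nat -> lmodType A) (d : forall i, {linear E i -> E i.+1}).
Variable one : E 0%N.
Hypothesis accA : acc A.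
Hypothesis solE : forall i, solvable (E i).
Hypothesis one_inj : forall a : A, a *: one = 0 -> a = 0.
Hypothesis ex0 : forall x, d 0 x = 0 <-> exists a : A, x = a *: one.
Hypothesis exS : forall i x, d i.+1 x = 0 <-> exists y, x = d i y.
Implicit Types J : ideal A.

Lemma dd i (x : E i) : d i.+1 (d i x) = 0.
Proof. by apply/exS; exists x. Qed.

Definition killed J (M : lmodType A) (x : M) := forall a, J a -> a *: x = 0.

Lemma killed0 J (M : lmodType A) : killed J (0 : M). Proof. by move=> a _; rewrite scaler0. Qed.
Lemma killedB J (M : lmodType A) (x y : M) : killed J x -> killed J y -> killed J (x - y).
Proof. by move=> hx hy a Ja; rewrite scalerBr hx // hy // subrr. Qed.
Lemma killedZ J (M : lmodType A) r (x : M) : killed J x -> killed J (r *: x).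
Proof. by move=> hx a Ja; rewrite scalerA mulrC -scalerA hx // scaler0. Qed.
Lemma killed_d J i (x : E i) : killed J x -> killed J (d i x).
Proof. by move=> hx a Ja; rewrite -linearZ hx // linear0. Qed.
Lemma killed_le J J' (M : lmodType A) (x : M) : ideal_le J J' -> killed J' x -> killed J x.
Proof. by move=> le h a /le; exact: h. Qed.
Lemma killed_adj J y (M : lmodType A) (x : M) : killed J x -> y *: x = 0 -> killed (adj J y) x.
Proof.
move=> kx yx a [b Jb]; rewrite -(subrK (b * y) a) scalerDl kx // add0r.
by rewrite -scalerA yx scaler0.
Qed.

(** Multiplication by x embeds A/(J : x) into A/J, so a homomorphism from A/(J : x) to an injective
    module extends. The system is x h = e together with s_i h = 0 for generators s_i of J. *)
Lemma solve J i x (e : E i) : killed (col J x) e -> exists2 w, killed J w & x *: w = e.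
Proof.
move=> ke; have [s hs] := acc_fg accA J.
pose Z : 'M[A]_((size s).+1, 1) := \matrix_(i, j) (x :: s)`_i.
pose g (k : 'I_(size s).+1) : E i := if k == ord0 then e else 0.
have [|h hh] := @solE i _ _ Z g.
  move=> c cZ; rewrite (bigD1 ord0) //= big1 ?addr0 => [|k /negPf nk]; last by rewrite /g nk scaler0.
  apply: ke; rewrite colE; move/rowP/(_ ord0): cZ; rewrite !mxE big_ord_recl mxE /= => /eqP.
  rewrite addr_eq0 => /eqP ->; apply: idN; apply: id_sum => k _; apply: idM.
  rewrite mxE /=; apply/hs; exists (fun l => (l == k)%:R).
  by rewrite (bigD1 k) //= eqxx mul1r big1 ?addr0 // => l /negPf ->; rewrite mul0r.
exists (h ord0); last by have := hh ord0; rewrite big_ord1 mxE.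
move=> a /hs[c ->]; rewrite scaler_suml big1 // => k _; rewrite -scalerA.
by have := hh (fintype.lift ord0 k); rewrite big_ord1 mxE /= => ->; rewrite scaler0.
Qed.

(** Cocycles and coboundaries of the complex [E[J]], computing Ext(A/J, A). *)
Definition coc J j (x : E j) := killed J x /\ d j x = 0.
Definition cob J j : E j -> Prop :=
  if j is j'.+1 then fun x => exists2 h, killed J h & x = d j' h else fun x => x = 0.
Definition vanish j J := forall x : E j, coc J x -> cob J x.

Lemma coc_submod J j : [/\ coc J (0 : E j), forall x y : E j, coc J x -> coc J y -> coc J (x - y)
  & forall a (x : E j), coc J x -> coc J (a *: x)].
Proof.
split=> [|x y [kx dx] [ky dy]|a x [kx dx]]; split.
- exact: killed0.
- exact: linear0.
- exact: killedB.
- by rewrite linearB dx dy subrr.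
- exact: killedZ.
- by rewrite linearZ /= dx scaler0.
Qed.

Lemma cob_submod J j : [/\ cob J (0 : E j), forall x y : E j, cob J x -> cob J y -> cob J (x - y)
  & forall a (x : E j), cob J x -> cob J (a *: x)].
Proof.
case: j => [|j] /=; first by split=> // [x y -> ->|a x ->]; rewrite ?subr0 ?scaler0.
split=> [|_ _ [g kg ->] [h kh ->]|a _ [h kh ->]].
- by exists 0; [exact: killed0 | rewrite linear0].
- by exists (g - h); [exact: killedB | rewrite linearB].
- by exists (a *: h); [exact: killedZ | rewrite linearZ].
Qed.

Lemma cobZ J j a (x : E j) : cob J x -> cob J (a *: x).
Proof. by case: (cob_submod J j) => _ _; apply. Qed.

Section ExtFinite.
Variables (s r : nat).
Implicit Type Z : 'M[A]_(s, r).

(** [kill Z] is Hom(coker Z, E_j) and [mcob] its coboundaries. Cyclic modules do not suffice,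
    because syzygies enter in [ext_fg]. *)
Definition kill Z j (x : 'I_r -> E j) := forall i, \sum_t Z i t *: x t = 0.
Definition mcob Z j : ('I_r -> E j) -> Prop :=
  if j is j'.+1 then fun x => exists2 h, kill Z h & forall t, x t = d j' (h t)
  else fun x => forall t, x t = 0.
End ExtFinite.

(** Dimension shift: Ext^(j+1)(coker Z, A) is a quotient of Ext^j(coker Y, A), where the rows of Y
    generate the syzygies of the rows of Z; and Hom(coker Z, A) is a submodule of A^r. *)
Lemma ext_fg j r s (Z : 'M[A]_(s, r)) : exists m (e : 'I_m -> 'I_r -> E j),
  (forall k, kill Z (e k) /\ forall t, d j (e k t) = 0) /\
  forall x, kill Z x -> (forall t, d j (x t) = 0) ->
    exists c : 'I_m -> A, mcob Z (fun t => x t - \sum_k c k *: e k t).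
Proof.
elim: j r s Z => [|j IH] r s Z.
  have sW : [/\ Z *m (0 : 'rV[A]_r)^T = 0, forall u v : 'rV[A]_r, Z *m u^T = 0 -> Z *m v^T = 0 -> Z *m (u - v)^T = 0
      & forall (a : A) (u : 'rV[A]_r), Z *m u^T = 0 -> Z *m (a *: u)^T = 0].
    split=> [|u v hu hv|a u hu]; first by rewrite trmx0 mulmx0.
      by rewrite linearB /= mulmxBr hu hv subrr.
    by rewrite linearZ /= -scalemxAr hu scaler0.
  have [m [G hG]] := row_fg accA (Submod sW).
  exists m, (fun k t => G k t *: one); split=> [k|x kx dx].
    split=> [i|t]; last by apply/ex0; exists (G k t).
    have : Z *m (row k G)^T = 0 by apply/(hG (row k G)); exists (delta_mx 0 k); rewrite rowE.
    move/colP/(_ i); rewrite !mxE => e.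
    rewrite -[RHS](scale0r one) -e scaler_suml; apply: eq_bigr => t _.
    by rewrite !mxE scalerA.
  have /choice[a ha] t : exists a : A, x t = a *: one by apply/ex0.
  have [c hc] : exists c, \row_t a t = c *m G.
    apply/(hG (\row_t a t)) => /=; apply/colP => i; rewrite !mxE; apply: one_inj.
    rewrite -[RHS](kx i) scaler_suml; apply: eq_bigr => t _.
    by rewrite !mxE ha scalerA.
  exists (fun k => c 0 k) => t; apply/eqP; rewrite subr_eq0; apply/eqP.
  rewrite ha; move/rowP/(_ t): hc; rewrite !mxE => ->; rewrite scaler_suml.
  by apply: eq_bigr => k _; rewrite scalerA.
have sW : [/\ (0 : 'rV[A]_s) *m Z = 0, forall x y : 'rV[A]_s, x *m Z = 0 -> y *m Z = 0 -> (x - y) *m Z = 0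
    & forall (a : A) (x : 'rV[A]_s), x *m Z = 0 -> (a *: x) *m Z = 0].
  by split=> [|x y hx hy|a x hx]; rewrite ?mul0mx // ?mulmxBl ?hx ?hy ?subrr // -scalemxAl hx scaler0.
have [s' [Y hY]] := row_fg accA (Submod sW).
have YZ : Y *m Z = 0.
  apply/row_matrixP => k; rewrite row_mul row0.
  by apply/(hY (row k Y)); exists (delta_mx 0 k); rewrite rowE.
have lift i (g : 'I_s -> E i) : kill Y g -> exists h : 'I_r -> E i, forall l, \sum_t Z l t *: h t = g l.
  move=> kg; apply: solE => c /(hY c)[b ->].
  under eq_bigr => l _ do rewrite mxE scaler_suml.
  rewrite exchange_big big1 //= => k _.
  transitivity (b 0 k *: (\sum_l Y k l *: g l)); last by rewrite (kg k) scaler0.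
  rewrite scaler_sumr.
  by apply: eq_bigr => l _; rewrite scalerA.
have dZ i (h : 'I_r -> E i) l : d i (\sum_t Z l t *: h t) = \sum_t Z l t *: d i (h t).
  by rewrite raddf_sum; apply: eq_bigr => t _; rewrite /= linearZ.
have [m [e' [he' ge']]] := IH _ _ Y.
have /choice[H hH] k : exists H : 'I_r -> E j, forall l, \sum_t Z l t *: H t = e' k l.
  by apply: lift; case: (he' k).
exists m, (fun k t => d j (H k t)); split=> [k|x kx dx].
  split=> [l|t]; last exact: dd.
  by rewrite -dZ hH; case: (he' k).
have /choice[h hh] t : exists h, x t = d j h by apply/exS.
pose g l := \sum_t Z l t *: h t.
have kg : kill Y g.
  move=> k; under eq_bigr => l _ do rewrite scaler_sumr.
  rewrite exchange_big big1 //= => t _; under eq_bigr => l _ do rewrite scalerA.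
  by rewrite -scaler_suml; move/matrixP/(_ k t): (YZ); rewrite !mxE => ->; rewrite scale0r.
have dg l : d j (g l) = 0.
  by rewrite /g dZ -[RHS](kx l); apply: eq_bigr => t _; rewrite hh.
have [c hc] := ge' g kg dg.
(* The coboundary by which g differs from a combination of the generators is lifted along Z to
   cocycles w, which can be subtracted from h without changing d h. *)
have [w hw dw] : exists2 w : 'I_r -> E j, forall l, g l - \sum_k c k *: e' k l = \sum_t Z l t *: w t &
    forall t, d j (w t) = 0.
  case: (j) e' H h g c hc he' hH kg dg {hh ge' IH} => [|j'] e' H h g c hc he' hH kg dg.
    exists (fun=> 0) => [l|t]; last exact: linear0.
    by rewrite hc big1 // => t _; rewrite scaler0.
  case: hc => g' kg' eg'; have [h' hh'] := lift _ _ kg'.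
  by exists (fun t => d j' (h' t)) => [l|t]; [rewrite eg' -hh' dZ | exact: dd].
exists c, (fun t => h t - w t - \sum_k c k *: H k t) => [l|t].
  under eq_bigr => t _ do rewrite !scalerBr scaler_sumr.
  rewrite !sumrB -/(g l) -hw subKr exchange_big /=.
  apply/eqP; rewrite subr_eq0; apply/eqP/eq_bigr => k _; rewrite -hH scaler_sumr.
  by apply: eq_bigr => t _; rewrite !scalerA mulrC.
rewrite hh 2!linearB /= dw subr0 (raddf_sum (d j)); congr (_ - _); apply: eq_bigr => k _.
by rewrite /= linearZ.
Qed.

(** Ext^j(A/J, A) vanishes for j > t, and Ext^t(A/J, A) is a copy of A/J generated by the class of
    [eps]. *)
Definition state J t := (forall j, (t < j)%N -> vanish j J) /\ exists eps : E t, [/\ coc J eps,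
  forall x, coc J x -> exists r, cob J (x - r *: eps) & forall r, cob J (r *: eps) -> J r].

Lemma state_zero : state (zeroI A) 0.
Proof.
split=> [[//|j] _ x [_ /exS[y ->]]|]; first by exists y => // a ->; rewrite scale0r.
exists one; split=> [|x [_ /ex0[r ->]]|r] /=; last exact: one_inj.
  by split=> [a ->|]; [rewrite scale0r | apply/ex0; exists 1; rewrite scale1r].
by exists r; rewrite subrr.
Qed.

(** Long exact sequence of multiplication by y on A/J: the new generator is the image of [eps] under
    the connecting map, that is d h with y h = eps. *)
Lemma state_adj J t y : regular J y -> state J t -> state (adj J y) t.+1.
Proof.
move=> reg [van [eps [[ke de] gen free]]].
have div i (e : E i) : killed J e -> exists2 w, killed J w & y *: w = e.
  by move=> ke'; apply: solve; apply: killed_le ke' => l; exact: reg.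
have cob_div (x : E t) : cob J x -> exists w : E t, [/\ killed J w, d t w = 0 & y *: w = x].
  case: (t) x => [x ->|t' x /= [h kh ->]]; first by exists 0; rewrite linear0 scaler0; split=> //; exact: killed0.
  have [w kw <-] := div _ _ kh; exists (d t' w); rewrite linearZ dd; split=> //; exact: killed_d.
have kadj (M : lmodType A) (x : M) : killed (adj J y) x -> killed J x /\ y *: x = 0.
  by move=> h; split; [apply: killed_le h; exact: adj_le | apply: h; exact: adj_self].
have [h kh yh] := div _ _ ke.
split=> [[//|[//|j]] tj x [/kadj[kx yx] dx]|].
  have [g kg eg] := van j.+2 (ltnW tj) x (conj kx dx).
  have [|g' kg' eg'] := van j.+1 tj (y *: g).
    by split; [exact: killedZ | rewrite linearZ /= -eg yx].
  have [w kw ew] := div _ _ kg'; exists (g - d j w); last by rewrite linearB /= dd subr0.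
  apply: killed_adj; first by apply: killedB => //; exact: killed_d.
  by rewrite scalerBr eg' -ew linearZ subrr.
exists (d t h); split=> [|x [/kadj[kx yx] dx]|r [g /kadj[kg yg] eg]].
- split; last exact: dd.
  by apply: killed_adj; [exact: killed_d | rewrite -linearZ yh].
- have [g kg eg] := van t.+1 (ltnSn _) x (conj kx dx).
  have [|r /cob_div[w [kw dw yw]]] := gen (y *: g).
    by split; [exact: killedZ | rewrite linearZ /= -eg yx].
  exists r, (g - r *: h - w); last by rewrite eg 2!linearB /= dw subr0 [d t (r *: h)]linearZ.
  apply: killed_adj; first by apply: killedB => //; apply: killedB => //; exact: killedZ.
  by rewrite !scalerBr yw scalerA mulrC -scalerA yh subrr.
have [|s cs] := gen (r *: h - g).
  by split; [apply: killedB => //; exact: killedZ | rewrite linearB linearZ /= eg subrr].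
have := cobZ y cs; have -> : y *: (r *: h - g - s *: eps) = (r - y * s) *: eps.
  by rewrite !scalerBr yg subr0 scalerBl -yh !scalerA [y * r]mulrC.
move=> /free Js.
by exists s; rewrite mulrC.
Qed.

Lemma state_adjs J t ys : regseq J ys -> state J t -> state (adjs J ys) (t + size ys).
Proof.
elim: ys J t => [|y ys IH] J t /=; first by rewrite addn0.
by move=> [ry rs] st; rewrite -addSnnS; apply: IH => //; exact: state_adj.
Qed.

Section Duality.
Variable mm : ideal A.
Hypothesis mm1 : ~ mm 1.
Hypothesis mm_unit : forall a, ~ mm a -> exists u, u * a = 1.
Variable N : nat.
Hypothesis bndE : forall i, (N < i)%N -> forall x : E i, x = 0.
Variables (J : ideal A) (t : nat) (sigma : A).
Hypothesis hstate : state J t.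
Hypothesis nsigma : ~ J sigma.
Hypothesis ssigma : forall a, mm a -> J (a * sigma).

Lemma unit_sub a x : mm x -> exists u, u * (1 - a * x) = 1.
Proof.
move=> mx; apply: mm_unit => h; apply: mm1; rewrite -(subrK (a * x) 1).
by apply: idD => //; exact: idM.
Qed.

(** Noetherian induction reduces Ext(A/a, A) to prime a. For the maximal ideal, [sigma] embeds A/a
    into A/J, for which vanishing is part of [state]; the other primes are treated by Nakayama. *)
Lemma vanish_step j : (t < j.+1)%N -> (forall J', vanish j.+2 J') -> forall J', vanish j.+1 J'.
Proof.
move=> tj V; apply: (noeth_ind accA) => a IH.
(* If x w is a cocycle, then d w is a cocycle killed by (a, x), and vanishing one degree higher
   corrects w to a cocycle. *)
have descent x (e w : E j.+1) : killed a w -> x *: w = e -> d j.+1 e = 0 ->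
    exists w', [/\ killed a w', d j.+1 w' = 0 & x *: w' = e].
  move=> kw xw de; have [|h kh eh] := V (adj a x) (d j.+1 w).
    split; last exact: dd.
    by apply: killed_adj; [exact: killed_d | rewrite -linearZ /= xw].
  exists (w - h); split; last by rewrite scalerBr xw (kh x) ?subr0 //; exact: adj_self.
    by apply: killedB => //; apply: killed_le kh; exact: adj_le.
  by rewrite linearB /= eh subrr.
have [a1|na1] := pselect (a 1).
  move=> e [ke _]; exists 0; first exact: killed0.
  by rewrite linear0 -[e]scale1r ke.
(* If a is not prime, A/a is an extension of A/(a, x) by A/(a : x), both covered by the induction
   hypothesis. *)
have [pa|npa] := pselect (isprime a); last first.
  have [x [b [ab nx nb]]] : exists x b, [/\ a (x * b), ~ a x & ~ a b].
    apply: contrapT => h; apply: npa; split=> // x b ab.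
    have [?|nx] := pselect (a x); [by left | right]; apply: contrapT => nb; apply: h.
    by exists x, b.
  have Vc : vanish j.+1 (col a x).
    apply: IH; first exact: col_le.
    by move/(_ b); rewrite colE mulrC => /(_ ab).
  have Va : vanish j.+1 (adj a x).
    by apply: IH; [exact: adj_le | move/(_ x (adj_self _ _))].
  move=> e [ke de]; have [|h kh eh] := Vc (x *: e).
    split; last by rewrite linearZ /= de scaler0.
    by move=> l; rewrite colE => hl; rewrite scalerA ke.
  have [h' kh' xh'] := solve kh.
  have [|h2 kh2 eh2] := Va (e - d j h').
    split; last by rewrite linearB /= de dd subrr.
    apply: killed_adj; first by apply: killedB => //; exact: killed_d.
    by rewrite scalerBr eh -xh' linearZ subrr.
  exists (h2 + h'); last by rewrite linearD /= -eh2 subrK.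
  move=> l al; rewrite scalerDr kh' // addr0; apply: kh2; exact: adj_le.
have [am|/existsNP[x /not_implyP[mx nax]]] := pselect (ideal_le mm a).
  move=> e [ke de]; have ke' : killed mm e by exact: killed_le ke.
  have [|w kw sw] := @solve J _ sigma e.
    move=> l; rewrite colE => hl; apply: ke'; apply: contrapT => /mm_unit[u ul].
    by apply: nsigma; rewrite -[sigma]mul1r -ul -mulrA; exact: idM.
  have [|h kh eh] := V (adj J sigma) (d j.+1 w).
    split; last exact: dd.
    by apply: killed_adj; [exact: killed_d | rewrite -linearZ /= sw].
  have [|g kg eg] := hstate.1 j.+1 tj (w - h).
    split; last by rewrite linearB /= eh subrr.
    by apply: killedB => //; apply: killed_le kh; exact: adj_le.
  exists (sigma *: g).
    move=> l al; have ml : mm l.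
      by apply: contrapT => /mm_unit[u ul]; apply: na1; rewrite -ul; exact: idM.
    by rewrite scalerA kg //; exact: ssigma.
  rewrite linearZ /= -eg scalerBr sw kh ?subr0 //; exact: adj_self.
(* Here a is a prime missing some x of the maximal ideal. Multiplication by x is surjective on the
   finitely generated module Ext^(j+1)(A/a, A), which therefore vanishes. *)
have [s hs] := acc_fg accA a.
pose Z : 'M[A]_(size s, 1) := \matrix_(i, _) s`_i.
have killE i (y : 'I_1 -> E i) : kill Z y <-> killed a (y ord0).
  split=> [h l /hs[c ->]|h k]; last first.
    rewrite big_ord1 mxE; apply: h; apply/hs; exists (fun i => (i == k)%:R).
    by rewrite (bigD1 k) //= eqxx mul1r big1 ?addr0 // => l /negPf ->; rewrite mul0r.
  rewrite scaler_suml big1 // => k _; rewrite -scalerA.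
  by have := h k; rewrite big_ord1 mxE => ->; rewrite scaler0.
have [m [e [he gen]]] := ext_fg j.+1 Z.
apply: (@nakayama _ _ (Submod (coc_submod a j.+1)) (Submod (cob_submod a j.+1)) x m (fun k => e k ord0)).
- by move=> b; exact: unit_sub.
- by move=> k; case: (he k) => /killE h1 h2; split.
- move=> z [kz dz]; have [||c [h kh eh]] := gen (fun=> z); [exact/killE | by [] |].
  by exists c, (h ord0); [exact/killE | exact: eh].
move=> z [kz dz]; have [|w kw xw] := @solve a _ x z.
  by apply: killed_le kz => l; rewrite colE => /pa.2[].
have [w' [h1 h2 h3]] := descent x z w kw xw dz.
by exists w' => //; rewrite h3 subrr; case: (cob_submod a j.+1).
Qed.

(** Descending induction from the degree where the resolution stops. *)
Lemma vanishing j J' : (t < j)%N -> vanish j J'.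
Proof.
move=> tj; have [k hk] : exists k, (N < j + k)%N by exists N.+1; lia.
elim: k j tj J' hk => [|k IH] [//|j] tj J' h.
  move=> x _; rewrite (bndE _ x); last by rewrite addn0 in h.
  by case: (cob_submod J' j.+1).
by apply: vanish_step => // J2; apply: IH; [exact: ltnW | rewrite addSnnS].
Qed.

(** Multiplication by mu embeds A/(a : mu) into A/a, and by [vanishing] Ext^t(-, A) turns this into
    a surjection. The socle class [sigma *: eps], killed by (a : mu), is thus mu v with v a cocycle
    killed by a; writing the class of v in Ext^t(A/J, A) as r eps gives r mu = sigma modulo J. *)
Lemma duality (a : ideal A) mu : ideal_le J a -> ~ a mu ->
  exists2 r, (forall x, a x -> J (x * r)) & ~ J (r * mu).
Proof.
move=> Ja nmu; have [van [eps [[ke de] gen free]]] := hstate.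
pose e := sigma *: eps.
have ke' : killed (col a mu) e.
  move=> l hl; rewrite scalerA ke //; apply: ssigma.
  by apply: contrapT => /mm_unit[u ul]; apply: nmu; rewrite -[mu]mul1r -ul -mulrA; exact: idM.
have [w kw mw] := solve ke'.
have [|h kh eh] := @vanishing t.+1 (adj a mu) (ltnSn t) (d t w).
  split; last exact: dd.
  by apply: killed_adj; [exact: killed_d | rewrite -linearZ /= mw linearZ /= de scaler0].
pose v := w - h.
have kv : killed a v by apply: killedB => //; apply: killed_le kh; exact: adj_le.
have dv : d t v = 0 by rewrite linearB /= eh subrr.
have mv : mu *: v = e by rewrite scalerBr mw kh ?subr0 //; exact: adj_self.
have [|r cr] := gen v; first by split=> //; exact: killed_le kv.
have J0 x : x *: v = 0 -> J (x * r).
  move=> xv; apply: free; have := cobZ (- x) cr.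
  by rewrite scaleNr scalerBr xv scalerA sub0r opprK.
exists r => [x ax|Jr]; first by apply: J0; exact: kv.
apply: nsigma; rewrite -(subrK (r * mu) sigma); apply: idD => //; apply: free.
by have := cobZ mu cr; rewrite scalerBr mv scalerA [mu * r]mulrC -scalerBl.
Qed.

End Duality.
End LocalGorenstein.

(** * From the localization at the irrelevant ideal back to polynomials *)

Section HomogeneousLocal.
Variables (K : fieldType) (n : nat).
Local Notation S := {mpoly K[n]}.
Local Notation hc := (pihomog mdeg).
Local Notation form d f := (f \is d.-homog for mdeg).
Local Notation mI := (mI K n).
Implicit Types J : ideal S.

Lemma mI_prime : isprime mI.
Proof.
split; first exact: mI1.
move=> a b; rewrite /= /maxid (rmorphM (mcoeff 0%MM)) => /eqP.
by rewrite mulf_eq0 => /orP[] /eqP; [left | right].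
Qed.

(* Homogeneous ideals are contracted from the localization at the irrelevant ideal. *)
Lemma hom_saturated J s x : hom J -> ~ mI s -> J (s * x) -> J x.
Proof.
move=> hJ ns Jsx; apply: id_hc; elim/ltn_ind => d IH.
have h0 : hc 0 s = (s@_0)%:MP.
  rewrite (form0 (pihomogP mdeg 0 s)); congr (_%:MP).
  have := hom_mI (f := s - (s@_0)%:MP) 0%N; rewrite /= /maxid mcoeffB mcoeffC eqxx mulr1 subrr.
  move=> /(_ erefl); rewrite raddfB /= mcoeffB => /eqP; rewrite subr_eq0 => /eqP ->.
  have h1 : form 0%N ((s@_0)%:MP : S) by rewrite -alg_mpolyC; apply/dhomogZ/dhomog1.
  by rewrite (pihomog_dE h1) mcoeffC eqxx mulr1.
have := hJ _ d Jsx; rewrite {1}(pihomog_partitionE (leqnn (msize x))) mulr_sumr raddf_sum /=.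
have [le|lt] := leqP (msize x) d; first by rewrite hc_ge // => _; exact: id0.
rewrite (bigD1 (Ordinal lt)) //= (hcMf _ _ (pihomogP _ _ _)) leqnn subnn h0 => H.
suff : J ((s@_0)%:MP * hc d x).
  rewrite mul_mpolyC => /(idZ (s@_0)^-1); rewrite scalerA mulVf ?scale1r //.
  by apply/eqP.
rewrite -[_ * _](addrK (\sum_(i < msize x | i != Ordinal lt) hc d (s * hc i x))).
apply: idB => //; apply: id_sum => i /eqP ni; rewrite (hcMf _ _ (pihomogP _ _ _)).
case: leqP => // le; last exact: id0.
apply/idM/IH; move: le; rewrite leq_eqVlt => /predU1P[e|//].
by case: ni; exact: val_inj.
Qed.

Lemma hom_adjs J s : hom J -> (forall f, f \in s -> exists k, form k f) -> hom (adjs J s).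
Proof.
elim: s J => [|a s IH] J //= hJ h; have [k ha] := h a (mem_head _ _).
apply: IH => [|f fs]; first exact: hom_adj ha.
by apply: h; rewrite inE fs orbT.
Qed.

Section Push.
Variables (I0 : ideal S) (L : comNzRingType) (psi : {rmorphism S -> L}).
Hypothesis hI0 : hom I0.
Hypothesis psi_unit : forall s, ~ mI s -> exists y, psi s * y = 1.
Hypothesis psi_frac : forall x, exists a s, ~ mI s /\ x * psi s = psi a.
Hypothesis psi_ker : forall a, psi a = 0 -> exists s, ~ mI s /\ I0 (s * a).
Hypothesis psiI0 : forall a, I0 a -> psi a = 0.

(** The extension of J to L, the localization of S/I0 at the irrelevant ideal; [push_psi] recovers a
    homogeneous J above I0 from it. *)
Lemma push_ideal J : is_ideal (fun x : L => exists a s, [/\ ~ mI s, J a & x * psi s = psi a]).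
Proof.
have nM s t : ~ mI s -> ~ mI t -> ~ mI (s * t) by move=> ns nt /mI_prime.2[].
split=> [|x y [a [s [ns Ja e]]] [b [t [nt Jb e']]]|x y [a [s [ns Ja e]]]].
- by exists 0, 1; split; [exact: mI1 | exact: id0 | rewrite mul0r rmorph0].
- exists (a * t + b * s), (s * t); split; [exact: nM | by apply: idD; exact: idMr |].
  by rewrite rmorphD !rmorphM -e -e'; ring.
- have [b [t [nt e']]] := psi_frac x.
  exists (b * a), (t * s); split; [exact: nM | exact: idM |].
  by rewrite !rmorphM -e -e'; ring.
Qed.
Definition push J := Ideal (push_ideal J).

Lemma push_psi J a : hom J -> ideal_le I0 J -> push J (psi a) <-> J a.
Proof.
move=> hJ IJ; split=> [[b [s [ns Jb e]]]|Ja]; last first.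
  by exists a, 1; split; [exact: mI1 | | rewrite rmorph1 mulr1].
have : psi (a * s - b) = 0 by rewrite rmorphB rmorphM e subrr.
move=> /psi_ker[t [nt /IJ Jt]]; apply: (hom_saturated hJ ns); rewrite mulrC.
by apply: id_trans Jb; exact: (hom_saturated hJ nt).
Qed.

Lemma pushE (x : L) : exists a y, x = psi a * y /\ forall J : ideal L, J x <-> J (psi a).
Proof.
have [a [s [ns e]]] := psi_frac x; have [y hy] := psi_unit ns.
have ex : x = psi a * y by rewrite -e -mulrA hy mulr1.
exists a, y; split=> // J; split=> [Jx|Ja]; first by rewrite -e; exact: idMr.
by rewrite ex; exact: idMr.
Qed.

Lemma push_acc : acc L.
Proof.
move=> J hJ; have idP i : is_ideal (fun a => J i (psi a)).
  by split=> [|x y|a x]; [rewrite rmorph0; exact: id0 | rewrite rmorphD; exact: idD | rewrite rmorphM; exact: idM].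
have [i hi] := @mpoly_acc K n (fun i => Ideal (idP i)) (fun i x => hJ i (psi x)).
exists i => x; have [a [_ [_ ax]]] := pushE x.
by rewrite !ax; exact: hi.
Qed.

Lemma push_adj J y : hom J -> ideal_le I0 J -> adj (push J) (psi y) = push (adj J y).
Proof.
move=> hJ IJ; apply: ideal_ext.
  apply: adj_sub => [x [a [s [ns Ja e]]]|]; first by exists a, s; split=> //; exact: adj_le.
  by exists y, 1; split; [exact: mI1 | exact: adj_self | rewrite rmorph1 mulr1].
move=> x [a [s [ns [b Jb] e]]]; have [z hz] := psi_unit ns.
have -> : x = psi a * z by rewrite -e -mulrA hz mulr1.
apply: idMr; exists (psi b); rewrite -rmorphM -rmorphB.
by exists (a - b * y), 1; split; [exact: mI1 | | rewrite rmorph1 mulr1].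
Qed.

Lemma push_zero : zeroI L = push I0.
Proof.
apply: ideal_ext; first exact: zeroI_le.
move=> x [a [s [ns Ia e]]]; have [z hz] := psi_unit ns.
by rewrite /= -[x]mulr1 -hz mulrA e psiI0 // mul0r.
Qed.

Lemma push_regular J y : hom J -> ideal_le I0 J -> regular J y -> regular (push J) (psi y).
Proof.
move=> hJ IJ reg x h; have [a [z [ex ax]]] := pushE x; apply/ax/(push_psi _ hJ IJ)/reg/(push_psi _ hJ IJ).
rewrite rmorphM.
exact: (proj1 (ax (col (push J) (psi y))) h).
Qed.

Lemma push_regseq J ys : hom J -> ideal_le I0 J -> (forall f, f \in ys -> exists k, form k f) ->
  regseq J ys -> regseq (push J) (map psi ys) /\ adjs (push J) (map psi ys) = push (adjs J ys).
Proof.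
elim: ys J => [|y ys IH] J //= hJ IJ hys [ry rys]; have [k hy] := hys y (mem_head _ _).
rewrite push_adj //; have [||f fs||h1 ->] := IH (adj J y).
- exact: hom_adj hy.
- by move=> x /IJ; exact: adj_le.
- by apply: hys; rewrite inE fs orbT.
- by [].
by do !split=> //; exact: push_regular.
Qed.

Lemma push_duality ys sigma (a : ideal S) mu : finite_injective_dim (L^o : lmodType L) -> ~ I0 1 ->
  (forall f, f \in ys -> exists k, form k f) -> regseq I0 ys ->
  ~ adjs I0 ys sigma -> (forall x, mI x -> adjs I0 ys (x * sigma)) ->
  hom a -> ideal_le (adjs I0 ys) a -> ~ a mu ->
  exists2 r, (forall x, a x -> adjs I0 ys (x * r)) & ~ adjs I0 ys (r * mu).
Proof.
move=> [E [eta [d [inj etainj ex0 exS [N bnd]]]]] I1 hys rys nsig ssig ha Ja nmu.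
have hJ := hom_adjs hI0 hys; have IJ : ideal_le I0 (adjs I0 ys) := @adjs_le _ I0 ys.
have [rL eL] := push_regseq hI0 (fun x h => h) hys rys; rewrite -push_zero in rL eL.
pose one : E 0%N := eta (1 : L).
have etaE (x : L) : eta x = x *: one.
  by rewrite /one -linearZ; congr (eta _); rewrite /GRing.scale /= mulr1.
have oi (x : L) : x *: one = 0 -> x = 0.
  by rewrite -etaE => h; apply: etainj; rewrite h linear0.
have e0 x : d 0%N x = 0 <-> exists c : L, x = c *: one.
  by rewrite ex0; split=> -[y ->]; exists y; rewrite etaE.
have mIJ : ideal_le (adjs I0 ys) mI.
  apply: (hom_sub_mI hJ) => /id1 h; exact/nsig/h.
have IM : ideal_le I0 mI by move=> x /IJ /mIJ.
have mm1 : ~ push mI 1 by rewrite -(rmorph1 psi) => /(push_psi _ (@hom_mI K n) IM); exact: mI1.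
have mmu x : ~ push mI x -> exists u, u * x = 1.
  have [b [s [ns e]]] := psi_frac x => nx.
  have nb : ~ mI b by move=> mb; apply: nx; exists b, s.
  have [z hz] := psi_unit nb; exists (psi s * z); rewrite mulrAC mulrC -hz -e; ring.
have st := state_adjs push_acc (fun i => injective_solvable (inj i)) exS rL (state_zero oi e0 exS).
have [||||r hr nr] := @duality L E d one push_acc (fun i => injective_solvable (inj i)) oi e0 exS (push mI)
  mm1 mmu N bnd _ _ (psi sigma) st _ _ (push a) (psi mu).
- by rewrite eL => /(push_psi _ hJ IJ).
- move=> x [b [s [ns mb e]]]; have [z hz] := psi_unit ns.
  have -> : x * psi sigma = psi (b * sigma) * z by rewrite rmorphM -e -[x in LHS]mulr1 -hz; ring.
  by apply: idMr; rewrite eL; apply/(push_psi _ hJ IJ)/ssig.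
- by rewrite eL => x [b [s [ns Jb e]]]; exists b, s; split=> //; exact: Ja.
- by move/(push_psi _ ha (fun x h => Ja _ (IJ x h))).
rewrite eL in hr nr; have [b [z [er br]]] := pushE r; exists b => [x ax|Jb].
  apply/(push_psi _ hJ IJ); rewrite rmorphM mulrC.
  have /br : col (push (adjs I0 ys)) (psi x) r; last by [].
  by rewrite colE mulrC; apply: hr; apply/(push_psi _ ha) => // y /IJ /Ja.
apply: nr; rewrite -colE; apply/br; rewrite colE -rmorphM; exact/(push_psi _ hJ IJ).
Qed.

End Push.

Lemma gorenstein_duality (I : idealr S) ys sigma (a : ideal S) mu :
  let J := adjs (of_idealr I) ys in
  gorenstein {ideal_quot I} -> hom (of_idealr I) ->
  (forall f, f \in ys -> exists k, form k f) -> regseq (of_idealr I) ys ->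
  ~ J sigma -> (forall x, mI x -> J (x * sigma)) -> hom a -> ideal_le J a -> ~ a mu ->
  exists2 r, (forall x, a x -> J (x * r)) & ~ J (r * mu).
Proof.
move=> J [_ gor] hI hys rys nsig ssig ha Ja nmu.
pose Q : comNzRingType := {ideal_quot I}; pose pi : {rmorphism S -> Q} := \pi_Q%qT.
have surj q : exists f, pi f = q by exists (repr q); exact: reprK.
have pi0 f : of_idealr I f <-> pi f = 0 := pi_mem I f.
have IM : ideal_le (of_idealr I) mI by apply: (hom_sub_mI hI); exact: of_idealr1.
have idPQ : is_ideal (fun q : Q => exists2 f, mI f & pi f = q).
  split=> [|_ _ [f hf <-] [g hg <-]|q _ [f hf <-]].
  - by exists 0; [exact: id0 | rewrite rmorph0].
  - by exists (f + g); [exact: idD | rewrite rmorphD].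
  - by have [g <-] := surj q; exists (g * f); [exact: idM | rewrite rmorphM].
pose PQ := Ideal idPQ.
have PQE f : PQ (pi f) <-> mI f.
  split=> [[g mg e]|]; last by exists f.
  by apply: id_trans mg; apply/IM/pi0; rewrite rmorphB e subrr.
have pPQ : isprime PQ.
  split; first by rewrite -(rmorph1 pi) => /PQE; exact: mI1.
  move=> x y; have [f <-] := surj x; have [g <-] := surj y.
  by rewrite -rmorphM => /PQE /mI_prime.2[] h; [left | right]; apply/PQE.
have [L [phi [[uni frac ker] fid]]] := gor (to_prime pPQ).
have nP f : pi f \notin to_prime pPQ <-> ~ mI f.
  by split=> [/negP h /PQE/to_primeE//|h]; apply/negP => /to_primeE /PQE.
pose psi : {rmorphism S -> L} := phi \o pi.
apply: (@push_duality (of_idealr I) L psi) ssig ha Ja nmu => //.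
- by move=> s /nP /uni.
- move=> x; have [q [q' [nq e]]] := frac x.
  have [b hb] := surj q; have [s hs] := surj q'.
  by exists b, s; split; [apply/nP; rewrite hs | rewrite /= hs hb].
- move=> b /ker[q [nq e]]; have [s hs] := surj q.
  by exists s; split; [apply/nP; rewrite hs | apply/pi0; rewrite rmorphM hs].
- by move=> b /pi0 e; rewrite /= e rmorph0.
- exact: of_idealr1.
Qed.

End HomogeneousLocal.

(** * Homogeneous regular sequences *)

Section GradedRegular.
Variables (R : realType) (K : fieldType) (n : nat).
Local Notation S := {mpoly K[n]}.
Local Notation hc := (pihomog mdeg).
Local Notation form d f := (f \is d.-homog for mdeg).
Local Notation mI := (mI K n).
Local Notation hp := (@hp R K n).
Implicit Types (J q : ideal S) (ys zs : seq S).

Definition posform (f : S) := exists2 k, form k f & (0 < k)%N.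
Definition posforms ys := forall f, f \in ys -> posform f.

Lemma posforms_cons y ys : posforms (y :: ys) <-> posform y /\ posforms ys.
Proof.
split=> [h|[h1 h2] f]; last by rewrite inE => /predU1P[->|/h2].
by split=> [|f fs]; apply: h; rewrite inE ?eqxx ?fs ?orbT.
Qed.

Lemma hom_adj_pos J y : hom J -> posform y -> hom (adj J y).
Proof. by move=> hJ [k hy _]; exact: hom_adj hy. Qed.

Lemma hom_adjs_pos J ys : hom J -> posforms ys -> hom (adjs J ys).
Proof. by move=> hJ h; apply: hom_adjs => // f /h[k hf _]; exists k. Qed.

Lemma graded_nakayama J C y : hom C -> posform y -> hom J ->
  (forall f, C f -> exists2 g, C g & J (f - g * y)) -> ideal_le C J.
Proof.
move=> hC [k hy k0] hJ h; apply: (hom_le hC) => f d; elim/ltn_ind: d f => d IH f hf Cf.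
have [g Cg /(hJ _ d)] := h f Cf; rewrite raddfB /= (pihomog_dE hf) (hcMf _ _ hy).
case: leqP => [kd|_]; last by rewrite subr0.
move=> H; apply: id_trans H _; apply: idMr; apply: (IH (d - k)%N); [lia | exact: pihomogP |].
exact: hC.
Qed.

(** The elements killed by y modulo J form an ideal C contained in J + x C, so C = J by graded
    Nakayama. *)
Lemma regular_swap J x y : hom J -> posform x -> posform y ->
  regular J x -> regular (adj J x) y -> regular J y /\ regular (adj J y) x.
Proof.
move=> hJ px py rx ry; have rJy : regular J y.
  have hC : hom (col J y) by case: py => k hy _; exact: hom_col hy.
  move=> f; apply: (graded_nakayama hC px hJ) => g Cg.
  have [a Ja] : adj J x g by apply: ry; exact: adj_le.
  exists a => //; rewrite colE; apply: rx; rewrite mulrAC -[_ * _](subKr (g * y)).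
  by apply: idB => //; rewrite -mulrBl; exact: idMr.
split=> // a [b Jb]; have [c Jc] : adj J x b.
  by apply: ry; exists a; rewrite -opprB; exact: idN.
exists c; apply: rx; rewrite mulrBl -(subrK (b * y) (a * x)) -addrA; apply: idD => //.
have -> : b * y - c * y * x = (b - c * x) * y by ring.
exact: idMr.
Qed.

Definition no_socle J := forall f, (forall x, mI x -> J (x * f)) -> J f.

Lemma regular_no_socle J v : posform v -> regular J v -> no_socle J.
Proof.
move=> [k hv k0] rv f h; apply: rv; rewrite mulrC; apply: h; exact: form_mI hv k0.
Qed.

(** If some multiple of f outside J lies in (J, g), then (J : f) equals the prime (J : g). Otherwise
    f has the same annihilator modulo (J, g), and the filtration is followed one step further. *)
Lemma pfilt_assoc J qs f : pfilt J qs -> isprime (col J f) -> List.In (col J f) qs.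
Proof.
move=> hq; elim: hq f => [{}J J1 f [] []|{}J g d {}qs hJ hg ng pg _ IH f pf].
  by rewrite colE mul1r; exact: id1.
have [[a [na [b Jb]]]|h] := pselect (exists a, ~ J (a * f) /\ adj J g (a * f)).
  left; have e1 : col J f = col J (a * f).
    apply: ideal_ext => x; rewrite !colE => hx; first by rewrite mulrCA; exact: idM.
    by case: (pf.2 x a) => //; rewrite colE -mulrA.
  have e2 : col J (a * f) = col (col J g) b.
    rewrite colM; apply: ideal_ext => x; rewrite !colE => hx.
      by apply: id_trans hx; apply: id_sym; rewrite -mulrBr; exact: idM.
    by apply: id_trans hx; rewrite -mulrBr; exact: idM.
  have nb : ~ col J g b.
    by rewrite colE => hb; apply: na; exact: id_trans hb.
  rewrite e1 e2; apply: ideal_ext; first exact: col_le.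
  by move=> x; rewrite colE => /pg.2[].
right; have e : col J f = col (adj J g) f.
  apply: ideal_ext => x; rewrite !colE => hx; first exact: adj_le.
  by apply: contrapT => nx; apply: h; exists x.
by rewrite e; apply: IH; rewrite -e.
Qed.

(** A zero divisor lies in an associated prime, and these all occur in a prime filtration. Without
    socle none of them contains the irrelevant ideal. *)
Lemma regular_primes J : hom J -> no_socle J -> exists qs,
  (forall q, List.In q qs -> [/\ hom q, isprime q & ~ ideal_le mI q]) /\
  forall k v, form k v -> (forall q, List.In q qs -> ~ q v) -> regular J v.
Proof.
move=> hJ ns; have [qs hqs] := pfilt_ex hJ.
have [qs' hqs'] := In_filter (fun q => ~ ideal_le mI q) qs.
exists qs'; split=> [q /hqs'[qin nq]|k v hv nv a av]; first by case: (pfilt_in hqs qin).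
apply: contrapT => na; have hC := hom_col hJ hv.
have [d nd] := hom_notin hJ na; have Cd : J (hc d a * v) by exact: hC av.
have [e [h [hh nh ph]]] := col_prime hJ (pihomogP _ _ _) nd.
apply: (nv (col J (h * hc d a))); last first.
  by rewrite colE mulrCA [v * _]mulrC; exact: idM.
apply/hqs'; split; first exact: pfilt_assoc.
by move=> le; apply: nh; apply: ns => x /le.
Qed.

Definition depth_ge t J := exists ys, [/\ size ys = t, posforms ys & regseq J ys].

Lemma depth_geS t J y : posform y -> regular J y -> depth_ge t (adj J y) -> depth_ge t.+1 J.
Proof.
move=> py ry [ys [sy pys rys]]; exists (y :: ys); split=> //=; first by rewrite sy.
exact/posforms_cons.
Qed.

Lemma depth_no_socle t J : depth_ge t.+1 J -> no_socle J.
Proof.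
by case=> -[|y ys] [] // _ /posforms_cons[py _] [ry _]; exact: regular_no_socle ry.
Qed.

Lemma regular_form (Js qs0 : seq (ideal S)) : (forall J, List.In J Js -> hom J /\ no_socle J) ->
  (forall q, List.In q qs0 -> [/\ hom q, isprime q & ~ ideal_le mI q]) ->
  exists v, [/\ posform v, forall J, List.In J Js -> regular J v & forall q, List.In q qs0 -> ~ q v].
Proof.
move=> hJs h0; have [qs [h1 h2]] : exists qs, (forall q, List.In q qs -> [/\ hom q, isprime q & ~ ideal_le mI q]) /\
    forall k v, form k v -> (forall q, List.In q qs -> ~ q v) -> forall J, List.In J Js -> regular J v.
  elim: Js hJs => [|J Js IH] hJs; first by exists [::].
  have [hJ nJ] := hJs J (or_introl erefl).
  have [qs [h1 h2]] := regular_primes hJ nJ.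
  have [|qs' [h3 h4]] := IH; first by move=> ? ?; apply: hJs; right.
  exists (qs ++ qs'); split=> [q /List.in_app_iff[/h1|/h3]//|k v hv nv J' [<-|J'in]].
    by apply: (h2 k) => // q qin; apply: nv; apply/List.in_app_iff; left.
  by apply: (h4 k) => // q qin; apply: nv; apply/List.in_app_iff; right.
have [|d [v [hv d0 _ nv]]] := prime_avoidance (qs := qs ++ qs0) (@hom_mI K n) (fun x h => h).
  by move=> q /List.in_app_iff[/h1|/h0].
exists v; split; first by exists d.
  by apply: h2 hv _ => q qin; apply/nv/List.in_app_iff; left.
by move=> q qin; apply/nv/List.in_app_iff; right.
Qed.

(** The given regular sequence starts with some w unrelated to z. A form v regular modulo both (J,
    w) and (J, z) mediates: induction for v on (J, w) gives the depth of (J, v), and induction for z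
    on (J, v) gives that of (J, z). *)
Lemma depth_drop t J z : hom J -> posform z -> regular J z -> depth_ge t.+1 J -> depth_ge t (adj J z).
Proof.
elim: t J z => [|t IH] J z hJ pz rz hd; first by exists [::].
case: (hd) => -[|w ws] [] // [sw] /posforms_cons[pw pws] [rw rws].
have hw := hom_adj_pos hJ pw; have hz := hom_adj_pos hJ pz.
have dw : depth_ge t.+1 (adj J w) by exists ws.
have nsw := depth_no_socle dw.
have mw : mI w by case: pw => k hk k0; exact: form_mI hk k0.
(* A socle element f modulo z satisfies w f = g z modulo J, and then g is annihilated by the
   irrelevant ideal modulo (J, w). *)
have nsz : no_socle (adj J z).
  move=> f hf; have [g Jg] := hf w mw.
  have [h Jh] : adj J w g.
    apply: nsw => x mx; have [h Jh] := hf x mx; exists h; apply: rz.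
    have -> : (x * g - h * w) * z = w * (x * f - h * z) - x * (w * f - g * z) by ring.
    by apply: idB; exact: idM.
  exists h; apply: rw; have -> : (f - h * z) * w = (w * f - g * z) + z * (g - h * w) by ring.
  by apply: idD => //; exact: idM.
have [|//|v [pv rv _]] := @regular_form [:: adj J w; adj J z] [::].
  by move=> J' [<-|[<-|[]]].
have rvw : regular (adj J w) v by apply: rv; left.
have rvz : regular (adj J z) v by apply: rv; right; left.
have [rJv rwv] := regular_swap hJ pw pv rw rvw.
have [_ rzv] := regular_swap hJ pz pv rz rvz.
have dv : depth_ge t.+1 (adj J v).
  by apply: (depth_geS pw rwv); rewrite adjC; exact: IH hw pv rvw dw.
apply: (depth_geS pv rvz); rewrite adjC; exact: IH (hom_adj_pos hJ pv) pz rzv dv.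
Qed.

Lemma hp_adj_regular J k f : hom J -> form k f -> regular J f -> hp (adj J f) = dl k (hp J).
Proof.
move=> hJ hf rf; have := hp_adj R hJ hf.
have -> : col J f = J by apply: ideal_ext; [exact: rf | exact: col_le].
by move=> e; rewrite dl_shift {1}e addrK.
Qed.

(** Depth is at most dim S/(J : f) for every form f outside J, in particular for associated primes.
    Once factors w are cancelled from f, passing to (J, w) lowers depth and dimension by one
    each. *)
Lemma depth_unmixed t J f e : hom J -> depth_ge t J -> form e f -> ~ J f -> (t < size (hp (col J f)))%N.
Proof.
elim: t J f e => [|t IH] J f e hJ hd; first by move=> hf nf; apply: hp_gt0;
  [exact: hom_col hf | rewrite colE mul1r].
case: (hd) => -[|w ws] [] // [sw] /posforms_cons[[k hw k0] pws] [rw rws].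
have hA := hom_adj hJ hw; have dw : depth_ge t (adj J w) by exists ws.
elim/ltn_ind: e f => e IHe f hf nf.
have [[a /(hJ _ e)]|nA] := pselect (adj J w f).
  rewrite raddfB /= (pihomog_dE hf) (hcMf _ _ hw); case: (leqP k e) => [ke Ja|_]; last by rewrite subr0.
  have na : ~ J (hc (e - k) a) by move=> h; apply: nf; apply: id_trans Ja _; exact: idMr.
  have -> : col J f = col J (hc (e - k) a).
    apply: ideal_ext => x; rewrite !colE => hx.
      apply: rw; rewrite -mulrA; apply: id_trans hx; apply: id_sym.
      by rewrite -mulrBr; exact: idM.
    by apply: id_trans (idMr w hx); rewrite -mulrA -mulrBr; exact: idM.
  by apply: (IHe (e - k)%N) => //; [lia | exact: pihomogP].
have hC := hom_col hJ hf; have hCw := hom_adj hC hw.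
have := IH _ _ _ hA dw hf nA => lt.
have le : ideal_le (adj (col J f) w) (col (adj J w) f).
  apply: adj_sub; first by move=> x; rewrite !colE; exact: adj_le.
  by rewrite colE; apply: idMr; exact: adj_self.
have := leq_trans lt (hp_mono R hCw (hom_col hA hf) le).
rewrite (hp_adj_regular hC hw) => [|x]; first by rewrite size_dlE // => h; rewrite -ltn_predRL.
by rewrite !colE mulrAC; exact: rw.
Qed.

(** If z were a zero divisor, it would lie in an associated prime q with dim S/q greater than the
    number of remaining forms, yet these cut S/q down to dimension 0. *)
Lemma depth_regseq J zs : hom J -> depth_ge (size zs) J -> posforms zs ->
  (size (hp (adjs J zs)) <= 1)%N -> regseq J zs.
Proof.
elim: zs J => [|z zs IH] J //= hJ hd /posforms_cons[pz pzs] s1.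
have rz : regular J z.
  have [k hz k0] := pz; move=> a az; apply: contrapT => na; have hC := hom_col hJ hz.
  have [d nd] := hom_notin hJ na; have Cd : J (hc d a * z) by exact: hC az.
  have [e [h [hh nh ph]]] := col_prime hJ (pihomogP _ _ _) nd.
  have hha := dhomogM hh (pihomogP mdeg d a).
  have := depth_unmixed hJ hd hha nh; set q := col J _ => lt.
  have hq : hom q by exact: hom_col hha.
  have qz : q z by rewrite colE mulrCA [z * _]mulrC; exact: idM.
  have [hq' le] := hp_adjs_size R hq pzs.
  have : (size (hp (adjs q zs)) <= 1)%N.
    apply: leq_trans s1; apply: hp_mono => //.
      by apply: hom_adjs_pos => //; exact: hom_adj_pos.
    apply: adjs_sub => [|x]; last exact: adjs_mem.
    by move=> x hx; apply: adjs_le; move: x hx; apply: adj_sub => //; exact: col_le.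
  move=> s2; move: (leq_trans le (leq_add s2 (leqnn _))); rewrite add1n => le'.
  by have := leq_trans lt le'; rewrite ltnn.
split=> //; apply: IH => //; first exact: hom_adj_pos.
exact: depth_drop.
Qed.

Lemma varI_ideal (l : seq 'I_n) :
  is_ideal (fun f : S => forall m : 'X_{1..n}, (forall i, i \in l -> m i = 0%N) -> f@_m = 0).
Proof.
split=> [m _|x y hx hy m hm|a x hx m hm]; first by rewrite mcoeff0.
  by rewrite mcoeffD hx // hy // addr0.
rewrite mcoeffM big1 // => k /eqP e; rewrite hx ?mulr0 // => i il.
by have := hm i il; move/mnmP/(_ i): e; rewrite mnmDE => -> /eqP; rewrite addn_eq0 => /andP[_ /eqP].
Qed.
Definition varI l := Ideal (varI_ideal l).

Lemma varI_nil : varI [::] = zeroI S.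
Proof.
apply: ideal_ext => [x h|]; last exact: zeroI_le.
by apply/mpolyP => m; rewrite h // mcoeff0.
Qed.

Lemma varI_rcons l j : adj (varI l) 'X_j = varI (rcons l j).
Proof.
apply: ideal_ext.
  apply: adj_sub => [x hx m hm|m hm]; first by apply: hx => i il; apply: hm; rewrite mem_rcons inE il orbT.
  rewrite mcoeffX; case: eqP => // e; have := hm j; rewrite mem_rcons mem_head -e mnm1E eqxx.
  by move=> /(_ isT).
move=> f hf; rewrite (mpolyE f) big_seq; apply: id_sum => m mf; apply: idZ.
have [mj|mj] := eqVneq (m j) 0%N; last first.
  have le : (U_(j) <= m)%MM by rewrite lep1mP.
  by rewrite -(submK le) mpolyXD; apply/idM/adj_self.
apply: adj_le => m' hm'; rewrite mcoeffX; case: eqP => // e.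
move: mf; rewrite mcoeff_msupp hf ?eqxx // => i; rewrite mem_rcons inE => /predU1P[->|il] //.
by rewrite e; exact: hm'.
Qed.

Lemma varI_regular l j : j \notin l -> regular (varI l) 'X_j.
Proof.
move=> jl a h m hm; rewrite -(mcoeffMX a U_(j) m); apply: h => i il.
by rewrite mnmDE hm // mnm1E; case: eqP => // e; rewrite e il in jl.
Qed.

Lemma var_regseq l l' : uniq (l ++ l') -> regseq (varI l) [seq 'X_i | i <- l'].
Proof.
elim: l' l => [|j l' IH] l //=; rewrite -cat_rcons => u; split; last by rewrite varI_rcons; exact: IH.
apply: varI_regular; move: u; rewrite cat_uniq rcons_uniq; by case/and3P => /andP[].
Qed.

Lemma depth_zero : depth_ge n (zeroI S).
Proof.
exists [seq 'X_i | i <- enum 'I_n]; split; first by rewrite size_map size_enum_ord.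
  by move=> f /mapP[i _ ->]; exists 1%N => //; exact: formX.
rewrite -varI_nil; apply: var_regseq; exact: enum_uniq.
Qed.

Lemma hom_zeroI : hom (zeroI S).
Proof. by move=> f d ->; rewrite /= raddf0. Qed.

Lemma size_hp_zero : size (hp (zeroI S)) = n.+1.
Proof.
apply/eqP; rewrite eqn_leq; apply/andP; split; last first.
  have := @depth_unmixed n (zeroI S) 1 0%N hom_zeroI depth_zero (dhomog1 _ _).
  have -> : col (zeroI S) 1 = zeroI S by apply: ideal_ext => x; rewrite colE mulr1.
  by apply; apply/eqP; exact: oner_neq0.
pose xs : seq S := [seq 'X_i | i <- enum 'I_n].
have pxs : posforms xs by move=> f /mapP[i _ ->]; exists 1%N => //; exact: formX.
have [h le] := hp_adjs_size R hom_zeroI pxs; apply: leq_trans le _.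
rewrite size_map size_enum_ord -add1n leq_add2r -[1%N](size_poly1 R) -(hp_mI R K n).
apply: hp_mono => //; first exact: hom_mI.
apply: mI_sub => i; apply: adjs_mem; apply/mapP; exists i => //; exact: mem_enum.
Qed.

End GradedRegular.

(** * Maximal regular sequences and systems of parameters *)

Section SystemsOfParameters.
Variables (R : realType) (K : fieldType) (n : nat).
Local Notation S := {mpoly K[n]}.
Local Notation hc := (pihomog mdeg).
Local Notation form d f := (f \is d.-homog for mdeg).
Local Notation mI := (mI K n).
Local Notation hp := (@hp R K n).
Implicit Types (J q : ideal S) (ys zs : seq S).

Lemma adjs_adj J y zs : adjs (adj J y) zs = adj (adjs J zs) y.
Proof.
rewrite -adjs_rcons; apply: (eq_adjs J (s1 := y :: zs)) => x.
by rewrite mem_rcons.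
Qed.

Lemma regseq_move J y zs : hom J -> posform y -> posforms zs ->
  regseq J (y :: zs) <-> regseq J zs /\ regular (adjs J zs) y.
Proof.
elim: zs J => [|z zs IH] J hJ py pzs /=; first by split=> -[].
have [pz pzs'] := (posforms_cons _ _).1 pzs; have := IH _ (hom_adj_pos hJ pz) py pzs' => /= E.
split=> [[ry [rz rs]]|[[rz rs] ry]].
  have [r1 r2] := regular_swap hJ py pz ry rz.
  by have [] := E.1 _; [rewrite adjC | ].
have [r1 r2] := E.2 (conj rs ry); have [r3 r4] := regular_swap hJ pz py rz r1.
by rewrite -adjC.
Qed.

Lemma regseq_rcons J ys v : regseq J (rcons ys v) <-> regseq J ys /\ regular (adjs J ys) v.
Proof. by elim: ys J => [|y ys IH] J /=; [split=> -[] | rewrite IH and_assoc]. Qed.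

Lemma regular_exp J y k : regular J y -> regular J (y ^+ k).
Proof.
move=> ry; elim: k => [|k IH] a; first by rewrite expr0 mulr1.
by rewrite exprS mulrA => /IH /ry.
Qed.

Lemma posform_exp (y : S) k : posform y -> posform (y ^+ k.+1).
Proof. by move=> [e hy e0]; exists (e * k.+1)%N; [exact: dhomogMn | rewrite muln_gt0 e0]. Qed.

Lemma posforms_exp ys k : posforms ys -> posforms [seq y ^+ k.+1 | y <- ys].
Proof. by move=> h f /mapP[y /h py ->]; exact: posform_exp. Qed.

Lemma regseq_exp J ys k : hom J -> posforms ys -> regseq J ys -> regseq J [seq y ^+ k.+1 | y <- ys].
Proof.
elim: ys J => [|y ys IH] J //= hJ /posforms_cons[py pys] [ry rys].
have h := IH _ (hom_adj_pos hJ py) pys rys; have pz := posforms_exp (k := k) pys.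
have [h1 h2] := (regseq_move hJ py pz).1 (conj ry h).
apply/(regseq_move hJ (posform_exp k py) pz); split=> //; exact: regular_exp.
Qed.

(** Multiplication by the product of the [y ^+ k] embeds S/(J, ys) into the quotient by the powers
    [y ^+ k.+1], each y being regular modulo J and the powers of the others. It carries the socle
    along. *)
Lemma notin_exp J ys sigma k : hom J -> posforms ys -> regseq J ys -> ~ adjs J ys sigma ->
  ~ adjs J [seq y ^+ k.+1 | y <- ys] (sigma * \prod_(y <- ys) y ^+ k).
Proof.
elim: ys J => [|y ys IH] J /= hJ; first by rewrite big_nil mulr1.
move=> /posforms_cons[py pys] [ry rys] ns.
have hA := hom_adj_pos hJ py; have pz := posforms_exp (k := k) pys.
have := IH _ hA pys rys ns; rewrite !adjs_adj big_cons => n1 [a Ja]; apply: n1.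
have [_ reg] := (regseq_move hJ py pz).1 (conj ry (regseq_exp k hA pys rys)).
exists a; apply: (regular_exp (k := k) reg); move: Ja; congr (_ _).
by rewrite exprS; set P := \prod_(_ <- _) _; ring.
Qed.

Lemma adjs_exp_prod J ys k x : adjs J ys x ->
  adjs J [seq y ^+ k.+1 | y <- ys] (x * \prod_(y <- ys) y ^+ k).
Proof.
move: x; apply: (@adjs_sub _ J (col _ _)) => [x Jx|y yin]; rewrite colE.
  by apply: adjs_le; exact: idMr.
rewrite (big_rem y) //= mulrA -exprS; apply/idMr/adjs_mem/mapP; by exists y.
Qed.

Lemma dimension_primes J : hom J -> (1 < size (hp J))%N -> exists qs : seq (ideal S),
  (forall q, List.In q qs -> [/\ hom q, isprime q & ~ ideal_le mI q]) /\
  forall v, posform v -> (forall q, List.In q qs -> ~ q v) -> (size (hp (adj J v)) < size (hp J))%N.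
Proof.
move=> hJ s2; have [qs hqs] := pfilt_ex hJ.
have [tops htops] := In_filter (fun q => size (hp q) = size (hp J)) qs.
exists tops; split=> [q /htops[qin sq]|v [k hv k0] nv].
  have [hq pq _] := pfilt_in hqs qin; split=> // le.
  by have := hp_mono R (@hom_mI K n) hq le; rewrite hp_mI size_poly1 sq leqNgt s2.
rewrite -(ltn_predK s2) ltnS; apply: (pfilt_adj hqs hv hJ) => q qin.
have [hq pq Jq] := pfilt_in hqs qin.
have [e|ne] := eqVneq (size (hp q)) (size (hp J)).
  have nq : ~ q v by apply/nv/htops.
  by rewrite (hp_adj_prime R hq pq hv nq) size_dlE // e.
apply: leq_trans (hp_mono R hq (hom_adj hq hv) (@adj_le _ q v)) _.
by have := hp_mono R hJ hq Jq; rewrite leq_eqVlt (negPf ne) /= => lt; rewrite -ltnS (ltn_predK s2).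
Qed.

Lemma primary_socle J N : hom J -> (forall t f, (N <= t)%N -> form t f -> J f) -> no_socle J -> J 1.
Proof.
move=> hJ hN ns; suff H k : forall t f, (N <= t + k)%N -> form t f -> J f.
  by apply: (H N 0%N); [rewrite add0n | exact: dhomog1].
elim: k => [|k IH] t f le hf; first by apply: hN hf; rewrite -(addn0 t).
apply: ns; apply: (@mI_sub K n (col J f)) => i; rewrite colE.
by apply: (IH (1 + t)%N); [lia | apply: dhomogM => //; exact: formX].
Qed.

Lemma socle_form J : hom J -> ~ no_socle J -> exists e sigma,
  [/\ form e sigma, ~ J sigma & forall x, mI x -> J (x * sigma)].
Proof.
move=> hJ /existsNP[f /not_implyP[hf nf]]; have [d nd] := hom_notin hJ nf.
exists d, (hc d f); split=> //; first exact: pihomogP.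
apply: (@mI_sub K n (col J (hc d f))) => i; rewrite colE.
have mX : mI 'X_i by exact: (form_mI (formX K i)).
by have := hJ _ d.+1 (hf _ mX); rewrite mulrC (hcMf _ _ (formX K i)) ltnS leq0n subn1 mulrC.
Qed.

Lemma posforms_sub_mI J ys : ideal_le J mI -> posforms ys -> ideal_le (adjs J ys) mI.
Proof. by move=> h pys; apply: adjs_sub => // f /pys[k hf k0]; exact: form_mI hf k0. Qed.

Lemma posforms_rcons ys v : posforms ys -> posform v -> posforms (rcons ys v).
Proof. by move=> h1 h2 f; rewrite mem_rcons => /((posforms_cons v ys).2 (conj h2 h1)). Qed.

(* Choosing the regular elements to cut down the dimension of S as well makes them extend to a
   system of parameters of S. *)
Lemma regular_parameters (I : ideal S) : hom I -> ~ I 1 -> exists ys e sigma,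
  [/\ posforms ys, regseq I ys, (size (hp (adjs (zeroI S) ys)) + size ys <= n.+1)%N, form e sigma
   & ~ adjs I ys sigma /\ forall x, mI x -> adjs I ys (x * sigma)].
Proof.
move=> hI I1; have Im := hom_sub_mI hI I1; have h0 := @hom_zeroI K n.
(* N bounds the dimension of S/(ys), which drops with each new form; so the construction stops, and
   it can only stop at a socle element. *)
suff H N : forall ys, (size (hp (adjs (zeroI S) ys)) <= N)%N -> posforms ys -> regseq I ys ->
    (size (hp (adjs (zeroI S) ys)) + size ys <= n.+1)%N -> exists ys e sigma,
  [/\ posforms ys, regseq I ys, (size (hp (adjs (zeroI S) ys)) + size ys <= n.+1)%N, form e sigma
   & ~ adjs I ys sigma /\ forall x, mI x -> adjs I ys (x * sigma)].
  by apply: (H n.+1 [::]) => //=; rewrite size_hp_zero // addn0.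
elim: N => [|N IH] ys le pys rys lys.
  have hJ := hom_adjs_pos h0 pys.
  have J1 : ~ adjs (zeroI S) ys 1 by move/(posforms_sub_mI (@zeroI_le _ mI) pys); exact: mI1.
  by have := leq_trans (hp_gt0 R hJ J1) le.
have hJ := hom_adjs_pos hI pys; have hJ0 := hom_adjs_pos h0 pys.
have [ns|/(socle_form hJ)[e [sigma [hs n1 s1]]]] := pselect (no_socle (adjs I ys)); last first.
  by exists ys, e, sigma.
have J1 : ~ adjs I ys 1 by move/(posforms_sub_mI Im pys); exact: mI1.
have s2 : (1 < size (hp (adjs (zeroI S) ys)))%N.
  rewrite ltnNge; apply/negP => /(hp1_primary hJ0)[N' hN']; apply: J1.
  apply: (primary_socle (N := N') hJ) => // t f Nt hf.
  by apply: adjs_mono (hN' t f Nt hf); exact: zeroI_le.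
have [qs [h1 h2]] := dimension_primes hJ0 s2.
have [|v [pv rv nv]] := @regular_form K n [:: adjs I ys] qs _ h1; first by move=> J [<-|[]].
have lt := h2 v pv nv; apply: (IH (rcons ys v)).
- by rewrite adjs_rcons -ltnS; exact: leq_trans lt le.
- exact: posforms_rcons.
- by apply/regseq_rcons; split=> //; apply: rv; left.
- by rewrite adjs_rcons size_rcons addnS -addSn; apply: leq_trans lys; rewrite leq_add2r.
Qed.

Lemma parameters_extend ys : posforms ys -> (size (hp (adjs (zeroI S) ys)) + size ys <= n.+1)%N ->
  exists zs, [/\ posforms (ys ++ zs), size (ys ++ zs) = n & (size (hp (adjs (zeroI S) (ys ++ zs))) <= 1)%N].
Proof.
have h0 := @hom_zeroI K n.
suff H N : forall ys, (size (hp (adjs (zeroI S) ys)) <= N)%N -> posforms ys ->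
    (size (hp (adjs (zeroI S) ys)) + size ys <= n.+1)%N ->
    exists zs, [/\ posforms (ys ++ zs), size (ys ++ zs) = n & (size (hp (adjs (zeroI S) (ys ++ zs))) <= 1)%N].
  exact: H (leqnn _).
elim: N => [|N IH] {}ys le pys lys; have hJ := hom_adjs_pos h0 pys.
  have J1 : ~ adjs (zeroI S) ys 1 by move/(posforms_sub_mI (@zeroI_le _ mI) pys); exact: mI1.
  by have := leq_trans (hp_gt0 R hJ J1) le.
have J1 : ~ adjs (zeroI S) ys 1 by move/(posforms_sub_mI (@zeroI_le _ mI) pys); exact: mI1.
have [s1|s2] := leqP (size (hp (adjs (zeroI S) ys))) 1.
  exists [::]; rewrite cats0; split=> //; apply/eqP; rewrite eqn_leq; apply/andP; split.
    by rewrite -ltnS; apply: leq_trans lys; rewrite -add1n leq_add2r; exact: hp_gt0.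
  have [_] := hp_adjs_size R h0 pys; rewrite size_hp_zero => le'.
  by rewrite -ltnS; apply: (leq_trans le'); rewrite -[X in (_ <= X)%N]add1n leq_add2r.
have [qs [h1 h2]] := dimension_primes hJ s2.
have [|v [pv _ nv]] := @regular_form K n [::] qs _ h1; first by [].
have lt := h2 v pv nv; have [|||zs [z1 z2 z3]] := IH (rcons ys v).
- by rewrite adjs_rcons -ltnS; exact: leq_trans lt le.
- exact: posforms_rcons.
- by rewrite adjs_rcons size_rcons addnS -addSn; apply: leq_trans lys; rewrite leq_add2r.
by exists (v :: zs); rewrite -cat_rcons.
Qed.

(** * Finite length and socle degree from duality *)

Section Gorenstein.
Variables (I : idealr S) (ys : seq S) (e : nat) (sigma : S).
Local Notation I0 := (of_idealr I).
Local Notation J := (adjs I0 ys).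
Hypothesis gor : gorenstein {ideal_quot I}.
Hypothesis hI : hom I0.
Hypothesis pys : posforms ys.
Hypothesis rys : regseq I0 ys.
Hypothesis hs : form e sigma.
Hypothesis ns : ~ J sigma.
Hypothesis ss : forall x, mI x -> J (x * sigma).

Lemma graded_duality (a : ideal S) mu : hom a -> ideal_le J a -> ~ a mu ->
  exists2 r, (forall x, a x -> J (x * r)) & ~ J (r * mu).
Proof.
move=> ha Ja nmu; apply: (gorenstein_duality gor hI _ rys ns ss ha Ja nmu).
by move=> f /pys[k hf _]; exists k.
Qed.

(** The ideals (J : forms of degree at least j) become stationary. Duality for the elements whose
    components up to degree j lie in J gives an r killing all forms of degree above j modulo J,
    hence also those of degree j. *)
Lemma graded_primary : exists N, forall t f, (N <= t)%N -> form t f -> J f.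
Proof.
have hJ := hom_adjs_pos hI pys.
have [|j hj] := @mpoly_acc K n (fun j => colI J (fun f => exists2 t, (j <= t)%N & form t f)).
  by move=> j r hr f [t jt hf]; apply: hr; exists t => //; exact: ltnW.
exists j; apply: forms_up => f hf.
have ida : is_ideal (fun g => forall d, (d <= j)%N -> J (hc d g)).
  split=> [d _|x y hx hy d dj|a x hx d dj]; first by rewrite raddf0; exact: id0.
    by rewrite raddfD; apply: idD; [exact: hx | exact: hy].
  rewrite {1}(pihomog_partitionE (leqnn (msize x))) mulr_sumr raddf_sum /=; apply: id_sum => i _.
  rewrite (hcMf _ _ (pihomogP _ _ _)); case: leqP => [id'|_]; last exact: id0.
  by apply/idM/hx; exact: leq_trans id' dj.
have hcc d d' (g : S) : hc d (hc d' g) = if d == d' then hc d' g else 0.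
  case: eqP => [->|/eqP ne]; first exact/pihomog_dE/pihomogP.
  by rewrite (pihomog_ne0 _ (pihomogP mdeg d' g)) // eq_sym.
pose a := Ideal ida; have hoa : hom a.
  by move=> g d ag d' d'j /=; rewrite hcc; case: eqP => // [<-|_]; [exact: ag | exact: id0].
have Ja : ideal_le J a by move=> g Jg d _; exact: hJ.
have [/(_ j (leqnn _))|na] := pselect (a f); first by rewrite (pihomog_dE hf).
have [r hr nr] := graded_duality hoa Ja na; case: nr.
apply: (hj r) => [g [t jt hg]|]; last by exists j.
rewrite mulrC; apply: hr => d dj; rewrite (pihomog_ne0 _ hg); first exact: id0.
by apply/eqP => E; move: jt; rewrite E ltnNge dj.
Qed.

(** If sigma were outside (J, tau), duality would give r with r tau in J and r sigma outside J; such
    an r is not in the irrelevant ideal, so tau would be in J. Hence sigma is a constant multiple of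
    tau modulo J. *)
Lemma socle_degree k tau : form k tau -> ~ J tau -> (forall x, mI x -> J (x * tau)) -> k = e.
Proof.
move=> ht nt st; have hJ := hom_adjs_pos hI pys.
have [[a /(hJ _ e)]|na] := pselect (adj J tau sigma).
  rewrite raddfB /= (pihomog_dE hs) (hcMf _ _ ht); case: (ltngtP k e) => // lt.
    move=> H; case: ns; apply: id_trans H _; apply: st.
    by apply: form_mI (pihomogP _ _ _) _; lia.
  by rewrite subr0 => /ns.
have [r hr nr] := graded_duality (hom_adj hJ ht) (@adj_le _ J tau) na.
case: nt; apply: (hom_saturated hJ (s := r)); last by rewrite mulrC; apply/hr/adj_self.
by move/ss.
Qed.

End Gorenstein.

End SystemsOfParameters.

(** * Top degrees modulo a system of parameters *)

Section TopForms.
Variables (R : realType) (K : fieldType) (n : nat).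
Local Notation S := {mpoly K[n]}.
Local Notation form d f := (f \is d.-homog for mdeg).
Local Notation mI := (mI K n).
Local Notation hp := (@hp R K n).
Implicit Types (J : ideal S) (zs : seq S) (es : seq nat).

Definition degs es zs := all2 (fun e z => form e z && (0 < e)%N) es zs.

Lemma degs_size es zs : degs es zs -> size es = size zs.
Proof. by rewrite /degs all2E => /andP[/eqP]. Qed.

Lemma degs_nth es zs i : degs es zs -> (i < size zs)%N -> form (nth 0%N es i) zs`_i /\ (0 < nth 0%N es i)%N.
Proof. by elim: es zs i => [|e es IH] [|z zs] [|i] //= /andP[/andP[h1 h2] h3] lt //; exact: IH. Qed.

Lemma degs_cat es1 es2 zs1 zs2 : degs es1 zs1 -> degs es2 zs2 -> degs (es1 ++ es2) (zs1 ++ zs2).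
Proof. by elim: es1 zs1 => [|e es IH] [|z zs] //= /andP[h1 h2] h3; apply/andP; split=> //; exact: IH. Qed.

Lemma posforms_degs zs : posforms zs -> exists es, degs es zs.
Proof.
elim: zs => [|z zs IH]; first by exists [::].
move=> /posforms_cons[[e hz e0] /IH[es h]]; exists (e :: es).
by apply/andP; rewrite hz e0.
Qed.

Lemma degs_posforms es zs : degs es zs -> posforms zs.
Proof.
elim: es zs => [|e es IH] [|z zs] // /andP[/andP[h1 h2] h3].
by apply/posforms_cons; split; [exists e | exact: IH].
Qed.

(* The Hilbert function of J shifted by c agrees with p from a on, negative degrees included. *)
Definition postulates J c a (p : {poly R}) := forall u, (a <= u)%N ->
  (if (c <= u)%N then hilb J (u - c) else 0)%:R = p.[u%:R].

(** Summing p determines q up to a constant, fixed by the value 0 at u = 0. Raising c by one makes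
    the agreement start at 0 again. *)
Lemma postulates_linear J c x p : hom J -> form 1%N x -> regular J x ->
  postulates (adj J x) c 0 p -> exists q, postulates J c.+1 0 q.
Proof.
move=> hJ hx rx h; have [q hq] := dl1_surj p.
have cJ : col J x = J by apply: ideal_ext; [exact: rx | exact: col_le].
exists (shift 1 q - ((shift 1 q).[0])%:P) => u _; elim: u => [|u IH].
  by rewrite hornerD hornerN hornerC subrr.
have -> : (if (c < u.+1)%N then hilb J (u.+1 - c.+1) else 0)%:R =
    (if (c < u)%N then hilb J (u - c.+1) else 0)%:R + p.[u%:R] :> R.
  rewrite -(h u (leq0n u)) ltnS subSS; case: (ltngtP c u) => [lt|lt|->].
  - rewrite (hilb_adj (u - c) hJ hx) cJ subn_gt0 lt subn1 -subnS natrD addrC; congr (_ + _).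
  - by rewrite addr0.
  by rewrite subnn (hilb_adj 0%N hJ hx) /= addn0 add0r.
have e1 : (shift 1 q).[u.+1%:R] = q.[u%:R] by rewrite horner_shift // subn1.
rewrite IH -hq horner_dl !hornerD !hornerN !hornerC e1.
have -> : (shift 1 q).[u%:R] = q.[u%:R - 1] by rewrite /shift horner_comp hornerD hornerN hornerX hornerC.
by ring.
Qed.

(** The polynomial is the binomial coefficient C(u, n), which vanishes for 0 <= u < n. *)
Lemma postulates_zero : exists p, postulates (zeroI S) n 0 p.
Proof.
pose xs : seq S := [seq 'X_i | i <- enum 'I_n].
suff H l J : hom J -> (forall x, x \in l -> form 1%N x) -> regseq J l -> adjs J l = mI ->
    exists p, postulates J (size l) 0 p.
  have [|||p hp] := H xs (zeroI S) (@hom_zeroI K n).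
  - by move=> x /mapP[i _ ->]; exact: formX.
  - by rewrite -varI_nil; apply: var_regseq; exact: enum_uniq.
  - apply: ideal_ext; last first.
      by apply: mI_sub => i; apply: adjs_mem; apply/mapP; exists i => //; exact: mem_enum.
    apply: adjs_sub => [x ->|x /mapP[i _ ->]]; [exact: id0 | exact: form_mI (formX K i) _].
  by exists p; move: hp; rewrite size_map size_enum_ord.
elim: l J => [|x l IH] J hJ hl /=.
  by move=> _ ->; exists 1 => u _; rewrite /= subn0 hilb_mI hornerC.
move=> [rx rl] e; have hx := hl x (mem_head _ _).
have [|p hp] := IH (adj J x) (hom_adj hJ hx) _ rl e.
  by move=> y yl; apply: hl; rewrite inE yl orbT.
exact: postulates_linear hp.
Qed.

Lemma postulates_adjs J c a p es zs : hom J -> degs es zs -> regseq J zs -> postulates J c a p ->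
  exists q, postulates (adjs J zs) c (a + sumn es) q.
Proof.
elim: es zs J a p => [|e es IH] [|z zs] J a p //= hJ.
  by move=> _ _ h; rewrite addn0; exists p.
move=> /andP[/andP[hz e0] hzs] [rz rzs] h; rewrite addnA.
apply: (IH _ _ _ (dl e p)) => //; first exact: hom_adj hz.
move=> u le; rewrite horner_dl -natrB; last by lia.
rewrite -h; last by lia.
rewrite -h; last by lia.
have cJ : col J z = J by apply: ideal_ext; [exact: rz | exact: col_le].
case: (leqP c u) => [cu|uc]; last by rewrite leqNgt (leq_ltn_trans (leq_subr e u) uc) subrr.
rewrite (hilb_adj (u - c) hJ hz) cJ; have -> : (e <= u - c)%N = (c <= u - e)%N by lia.
have -> : (u - c - e = u - e - c)%N by lia.
by rewrite natrD addrK.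
Qed.

(** Each form of degree e delays the agreement of [postulates_zero] by e, so the Hilbert function is
    constant from degree [sumn es - n] on, and [hilb_stable] applies beyond it. *)
Lemma top_forms es zs t f : degs es zs -> size zs = n -> (size (hp (adjs (zeroI S) zs)) <= 1)%N ->
  form t f -> (sumn es < t + n)%N -> adjs (zeroI S) zs f.
Proof.
move=> hd sz s1 hf lt; have h0 := @hom_zeroI K n; have pz := degs_posforms hd.
have hJ := hom_adjs_pos h0 pz; have rz : regseq (zeroI S) zs.
  by apply: (depth_regseq h0) s1 => //; rewrite sz; exact: depth_zero.
have [p hp0] := postulates_zero; have [q hq] := postulates_adjs h0 hd rz hp0.
rewrite add0n in hq; have [N hN] := hp1_primary hJ s1.
have ev u : (N + n <= u)%N -> hilb (adjs (zeroI S) zs) (u - n) = hilb (adjs (zeroI S) zs) N.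
  move=> le; have -> : (u - n = N + (u - n - N))%N by lia.
  elim: (u - n - N)%N => [|k IH]; first by rewrite addn0.
  by rewrite addnS hilb_stable_conv // => g hg; apply: hN hg; lia.
have eq : q = ((hilb (adjs (zeroI S) zs) N)%:R)%:P.
  apply: (@poly_eventually_eq _ _ _ (N + n + sumn es)) => u le; rewrite -hq; last by lia.
  rewrite hornerC ifT; last by lia.
  by rewrite ev //; lia.
have st u : (sumn es <= u + n)%N -> hilb (adjs (zeroI S) zs) u = hilb (adjs (zeroI S) zs) N.
  move=> le; have := hq (u + n)%N le; rewrite leq_addl addnK eq hornerC => /eqP.
  by rewrite eqr_nat => /eqP.
case: t hf lt => [|t] hf lt; last by apply: hilb_stable hf => //; rewrite !st //; lia.
have : (size es <= sumn es)%N.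
  elim: (es) (zs) hd => [|e es' IH] [|z zs'] //= /andP[/andP[_ e0] h].
  by have := IH _ h; lia.
by rewrite (degs_size hd) sz; lia.
Qed.

End TopForms.

(** * Socle degree and the free resolution *)

Section ResolutionShift.
Variables (R : realType) (K : fieldType) (n : nat).
Local Notation S := {mpoly K[n]}.
Local Notation hc := (pihomog mdeg).
Local Notation form d f := (f \is d.-homog for mdeg).
Local Notation mI := (mI K n).
Local Notation hp := (@hp R K n).
Variables (I : idealr S) (F : min_free_resolution I).
Local Notation I0 := (of_idealr I).
Local Notation rk := (res_rank F).
Local Notation D := (res_diff F).
Local Notation dg := (@res_deg K n I F _).
Variables (es : seq nat) (zs : seq S) (t : nat).
Hypothesis hzs : degs es zs.
Hypothesis szs : size zs = n.
Hypothesis zs_primary : (size (hp (adjs (zeroI S) zs)) <= 1)%N.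
Hypothesis tn : (t <= n)%N.
Hypothesis regI : regseq I0 (take t zs).
Local Notation J j := (adjs (zeroI S) (take j zs)).

Definition vanishes_mod (Q : ideal S) r (v : 'rV[S]_r) := forall k, Q (v 0 k).

Lemma vmZ Q r a (v : 'rV[S]_r) : vanishes_mod Q v -> vanishes_mod Q (a *: v).
Proof. by move=> hv k; rewrite mxE; exact: idM. Qed.
Lemma vmM Q r s (v : 'rV[S]_r) (A : 'M_(r, s)) : vanishes_mod Q v -> vanishes_mod Q (v *m A).
Proof. by move=> hv k; rewrite mxE; apply: id_sum => l _; exact: idMr. Qed.
Lemma vm_adj Q z r (v : 'rV[S]_r) : vanishes_mod (adj Q z) v -> exists u, vanishes_mod Q (v - z *: u).
Proof.
move=> /choice[u hu]; exists (\row_k u k) => k; rewrite !mxE mulrC; exact: hu.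
Qed.
Lemma vm_adjZ Q z r (v u : 'rV[S]_r) : vanishes_mod Q (v - z *: u) -> vanishes_mod (adj Q z) v.
Proof. by move=> h k; exists (u 0 k); have := h k; rewrite !mxE mulrC. Qed.
Lemma vm_regular Q z r (u : 'rV[S]_r) : regular Q z -> vanishes_mod Q (z *: u) -> vanishes_mod Q u.
Proof. by move=> rz h k; apply: rz; have := h k; rewrite mxE mulrC. Qed.
Lemma vm_trans Q r (u v w : 'rV[S]_r) : vanishes_mod Q (u - v) -> vanishes_mod Q (v - w) -> vanishes_mod Q (u - w).
Proof. by move=> h1 h2 k; have := idD (h1 k) (h2 k); rewrite !mxE addrA subrK. Qed.
Lemma vm_sym Q r (u v : 'rV[S]_r) : vanishes_mod Q (u - v) -> vanishes_mod Q (v - u).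
Proof. by move=> h k; have := idN (h k); rewrite !mxE opprB. Qed.

Lemma adjs_split (Q : ideal S) (s : seq S) x : adjs Q s x <-> exists2 a, Q a & adjs (zeroI S) s (x - a).
Proof.
split=> [/adjsP[c hc]|[a Qa h]].
  exists (x - \sum_i c i * s`_i) => //; apply/adjsP; exists c.
  by rewrite subKr /= subrr.
rewrite -(subrK a x); apply: idD; last exact: adjs_le.
by apply: adjs_mono h; exact: zeroI_le.
Qed.

Lemma JS j : (j < n)%N -> J j.+1 = adj (J j) zs`_j.
Proof. by move=> jn; rewrite (take_nth 0) ?szs // adjs_rcons. Qed.

Lemma regseq_nth (Q : ideal S) s j : regseq Q s -> (j < size s)%N -> regular (adjs Q (take j s)) s`_j.
Proof. by elim: s Q j => [|z s IH] Q [|j] //= [rz rs] lt //; exact: IH. Qed.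

Lemma regJ j : (j < n)%N -> regular (J j) zs`_j.
Proof.
move=> jn; apply: regseq_nth; last by rewrite szs.
apply: (depth_regseq (@hom_zeroI K n)) zs_primary; first by rewrite szs; exact: depth_zero.
exact: degs_posforms hzs.
Qed.

Lemma regIJ j : (j < t)%N -> regular (adjs I0 (take j zs)) zs`_j.
Proof.
move=> jt; have st : size (take t zs) = t by rewrite size_take szs; case: ltngtP tn => // ->.
have := @regseq_nth I0 (take t zs) j regI; rewrite st => /(_ jt).
by rewrite take_takel 1?ltnW // nth_take.
Qed.

Lemma homJ j : hom (J j).
Proof.
apply: (hom_adjs_pos (@hom_zeroI K n)) => f /mem_take; exact: (degs_posforms hzs).
Qed.

Lemma augmentation (v : 'rV[S]_(rk 0)) : (forall k, I0 (v 0 k)) <-> exists w, v = w *m D 0.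
Proof. exact: res_augmentation. Qed.

Lemma res_dd i (v : 'rV[S]_(rk i.+2)) : v *m D i.+1 *m D i = 0.
Proof. by apply/res_exact; exists v. Qed.

(* Exactness of F modulo the first j parameters: Tor_i(S/I, S/J_j) = 0 for i > j - t. *)
Lemma exact_mod j i (v : 'rV[S]_(rk i.+1)) : (j <= n)%N -> (j <= t + i)%N ->
  vanishes_mod (J j) (v *m D i) -> exists w, vanishes_mod (J j) (v - w *m D i.+1).
Proof.
elim: j i v => [|j IH] i v jn jti.
  rewrite take0 => h; have /res_exact[w ->] : v *m D i = 0 by apply/rowP => k; rewrite (h k) mxE.
  by exists w; rewrite subrr => k; rewrite mxE; exact: id0.
rewrite JS // => hv; have [u hu] := vm_adj hv; set z := zs`_j in hu hv *.
have [w' hw'] : exists w', vanishes_mod (J j) (u - w' *m D i).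
  case: i v u jti hv hu => [|i] v u jti hv hu; last first.
    apply: (IH i u) => //; [exact: ltnW | by rewrite -ltnS -addnS |].
    apply: (vm_regular (regJ jn)).
    have := vmM (D i) hu; rewrite mulmxBl res_dd -scalemxAl => /vm_sym.
    by rewrite subr0.
  have jt : (j < t)%N by rewrite addn0 in jti.
  have /choice[a ha] k : exists a, I0 a /\ J j (u 0 k - a).
    have /adjs_split[a] : adjs I0 (take j zs) (u 0 k); last by exists a.
    apply: (regIJ jt); rewrite -/z mulrC.
    have IvD : I0 ((v *m D 0) 0 k).
      exact: ((augmentation (v *m D 0)).2 (ex_intro _ v erefl) k).
    rewrite -[z * _](subKr ((v *m D 0) 0 k)); apply: idB; first exact: adjs_le.
    by have := hu k; rewrite !mxE; apply: adjs_mono; exact: zeroI_le.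
  have [|w ew] := (augmentation (\row_k a k)).1 _.
    by move=> k; rewrite mxE; case: (ha k).
  by exists w; rewrite -ew => k; rewrite !mxE; case: (ha k).
have [|w hw] := IH i (v - z *: w') (ltnW jn) (ltnW jti).
  by rewrite mulmxBl -scalemxAl; apply: (vm_trans hu); rewrite -scalerBr; exact: vmZ.
by exists w; apply: (vm_adjZ (u := w')); rewrite addrAC.
Qed.

(** Degree d in the i-th graded free module; the alternative [v 0 k = 0] covers generators of degree
    above d. *)
Definition homvec i d (v : 'rV[S]_(rk i)) := forall k,
  v 0 k = 0 \/ ((dg k <= d)%N /\ form (d - dg k) (v 0 k)).

Definition vec_hc i d (v : 'rV[S]_(rk i)) : 'rV[S]_(rk i) :=
  \row_k if (dg k <= d)%N then hc (d - dg k) (v 0 k) else 0.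

Lemma homvec_hc i d (v : 'rV[S]_(rk i)) : homvec d (vec_hc d v).
Proof.
move=> k; rewrite mxE; case: ifP => h; last by left.
by right; split=> //; exact: pihomogP.
Qed.

Lemma vm_hc Q i d (v : 'rV[S]_(rk i)) : hom Q -> vanishes_mod Q v -> vanishes_mod Q (vec_hc d v).
Proof. by move=> hQ h k; rewrite mxE; case: ifP => _; [exact: hQ | exact: id0]. Qed.

Lemma vec_hcB i d (v w : 'rV[S]_(rk i)) : vec_hc d (v - w) = vec_hc d v - vec_hc d w.
Proof. by apply/rowP => k; rewrite !mxE; case: ifP => _; rewrite ?raddfB ?subrr. Qed.

Lemma vec_hcZ i d e z (v : 'rV[S]_(rk i)) : form e z -> homvec d v -> vec_hc (d + e) (z *: v) = z *: v.
Proof.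
move=> hz hv; apply/rowP => k; rewrite !mxE; have [->|[le hk]] := hv k.
  by rewrite mulr0; case: ifP => _; rewrite ?raddf0.
rewrite (leq_trans le (leq_addr _ _)); apply: pihomog_dE; rewrite addnC -addnBA //.
exact: dhomogM.
Qed.

Lemma vec_hcM i d (w : 'rV[S]_(rk i.+1)) : vec_hc d (w *m D i) = vec_hc d w *m D i.
Proof.
have D0 l k : (dg l < dg k)%N -> D i l k = 0.
  move=> lt; apply/eqP; rewrite -msupp_eq0; apply/eqP; case E : (msupp _) => [//|m s].
  have := @res_graded _ _ _ F i l k m; rewrite E mem_head => /(_ isT) e.
  by move: lt; rewrite -e ltnNge leq_addl.
have Df l k : form (dg l - dg k) (D i l k).
  by apply/dhomogP => m mf; rewrite -(res_graded mf) addnK.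
apply/rowP => k; rewrite !mxE; case: leqP => kd; last first.
  rewrite big1 // => l _; rewrite mxE; case: ifP => ld; last by rewrite mul0r.
  by rewrite D0 ?mulr0 //; exact: leq_ltn_trans ld kd.
rewrite raddf_sum; apply: eq_bigr => l _ /=; rewrite mxE.
have [lk|kl] := ltnP (dg l) (dg k); first by rewrite D0 // !mulr0 raddf0.
rewrite (hcMf _ _ (Df l k)) leq_sub2rE // subnBA // subnK //.
by case: ifP; rewrite ?mul0r.
Qed.

Lemma sumn_takeS j : (j < n)%N -> sumn (take j.+1 es) = (sumn (take j es) + nth 0%N es j)%N.
Proof. by move=> jn; rewrite (take_nth 0%N) ?(degs_size hzs) ?szs // sumn_rcons. Qed.

Section Socle.
Variables (e : nat) (sigma : S).
Hypothesis hs : form e sigma.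
Hypothesis ns : ~ adjs I0 (take t zs) sigma.
Hypothesis ss : forall x, mI x -> adjs I0 (take t zs) (x * sigma).

(* The class of sigma in Tor_0(S/I, S/J_t) is moved to Tor_i(S/I, S/J_{t+i}). *)
Lemma socle_shift i : (t + i <= n)%N -> exists (v : 'rV[S]_(rk i)) d,
  [/\ homvec d v, (d + sumn (take t es) = e + sumn (take (t + i) es))%N,
      forall w, ~ vanishes_mod (J (t + i)) (v - w *m D i)
    & forall x, mI x -> exists w, vanishes_mod (J (t + i)) (x *: v - w *m D i)].
Proof.
elim: i => [|i IH] tin.
  exists (const_mx sigma), e; rewrite addn0; split=> //.
  - by move=> k; right; rewrite mxE res_deg0 subn0.
  - move=> w h; apply: ns; have k : 'I_(rk 0) by rewrite res_rank0; exact: ord0.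
    apply/adjs_split; exists ((w *m D 0) 0 k); last by have := h k; rewrite !mxE.
    exact: ((augmentation (w *m D 0)).2 (ex_intro _ w erefl) k).
  - move=> x /ss /adjs_split[a Ia Ja].
    have [|w ew] := (augmentation (const_mx a)).1 _; first by move=> k; rewrite mxE.
    by exists w => k; rewrite -ew !mxE.
have ltn : (t + i < n)%N by rewrite -addnS.
have [v [d [hv ed nv kv]]] := IH (ltnW ltn).
set z := zs`_(t + i); have [hz z0] := @degs_nth _ _ es zs (t + i) hzs (eq_ind_r (fun N => (t + i < N)%N) ltn szs).
have [w0 hw0] := kv z (form_mI hz z0); set E := nth 0%N es (t + i) in hz z0.
have rz := regJ ltn; rewrite -/z in rz.
pose w := vec_hc (d + E) w0.
have hw : vanishes_mod (J (t + i)) (z *: v - w *m D i).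
  have := vm_hc (d + E) (@homJ (t + i)) hw0.
  by rewrite vec_hcB vec_hcM (vec_hcZ hz hv).
exists w, (d + E)%N; rewrite addnS JS // -/z; split.
- exact: homvec_hc.
- by rewrite sumn_takeS // addnAC ed addnA.
- move=> u /vm_adj[c hc']; apply: (nv c); apply: (vm_regular rz); rewrite scalerBr.
  apply: vm_trans hw _; rewrite scalemxAl -mulmxBl.
  have := vmM (D i) hc'; rewrite !mulmxBl res_dd subr0.
  by rewrite -mulmxBl.
- move=> x mx; have [wx hwx] := kv x mx.
  have [|u hu] := @exact_mod (t + i) i (x *: w - z *: wx) (ltnW ltn) (leqnn _).
    rewrite mulmxBl -!scalemxAl; apply: (@vm_trans _ _ _ (x *: (z *: v))).
      by apply: vm_sym; rewrite -scalerBr; exact: vmZ.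
    by rewrite scalerA [x * z]mulrC -scalerA -scalerBr; exact: vmZ.
  by exists u; apply: (vm_adjZ (u := wx)); rewrite addrAC.
Qed.

(** At i = n - t the shifted class is nonzero modulo J_n in some component k. That entry has degree
    at most [sumn es - n] by [top_forms], and the k-th generator has degree at most m + n - t; their
    sum is the degree d of the class. *)
Lemma socle_degree_bound m : (forall i j, betti F i j != 0%N -> j%:Z - i%:Z <= m) ->
  e%:Z <= m + (sumn (take t es))%:Z - t%:Z.
Proof.
move=> hm; have [|v [d [hv ed nv _]]] := @socle_shift (n - t); first by rewrite subnKC.
rewrite subnKC // in ed nv.
have [k nk] : exists k, ~ J n (v 0 k).
  by apply/existsNP => h; apply: (nv 0); rewrite mul0mx subr0.
have [v0|[le hk]] := hv k; first by case: nk; rewrite v0; exact: id0.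
have ez : take n zs = zs by apply: take_oversize; rewrite szs.
have ee : take n es = es by apply: take_oversize; rewrite (degs_size hzs) szs.
rewrite ez in nk; rewrite ee in ed.
have bk : betti F (n - t) (dg k) != 0%N.
  by rewrite -lt0n; apply/card_gt0P; exists k; rewrite inE.
have dk : (d - dg k + n <= sumn es)%N.
  by rewrite leqNgt; apply/negP => lt; apply/nk/(top_forms hzs szs zs_primary hk lt).
have := hm _ _ bk; move: (dg k) le dk => b le dk; lia.
Qed.

End Socle.
End ResolutionShift.

(** * Top degrees of Frobenius powers *)

Section FrobeniusTop.
Variables (R : realType) (K F : fieldType) (fr : {rmorphism {poly K} -> F}).
Hypothesis fr_inj : forall a, fr a = 0 -> a = 0.
Hypothesis fr_frac : forall c : F, exists d a, d != 0 /\ fr d * c = fr a.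
Variables (n p : nat).
Hypothesis charK : p \in [pchar K].
Local Notation S := {mpoly K[n]}.
Local Notation S' := {mpoly F[n]}.
Local Notation form d f := (f \is d.-homog for mdeg).
Local Notation ext := (ext fr_frac).

Lemma exprB_pchar (A : comNzRingType) b (x y : A) : p \in [pchar A] ->
  (x - y) ^+ (p ^ b) = x ^+ (p ^ b) - y ^+ (p ^ b).
Proof.
move=> cA; elim: b => [|b IH]; first by rewrite !expr1.
rewrite expnSr !exprM IH -!(pFrobenius_autE cA).
exact: (pFrobenius_autB_comm cA (mulrC _ _)).
Qed.

Lemma expr_sum_pchar (A : comNzRingType) b I (r : seq I) (f : I -> A) : p \in [pchar A] ->
  (\sum_(i <- r) f i) ^+ (p ^ b) = \sum_(i <- r) f i ^+ (p ^ b).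
Proof.
move=> cA; have p0 : (0 < p ^ b)%N by rewrite expn_gt0 (prime_gt0 (pcharf_prime cA)).
have e0 : (0 : A) ^+ (p ^ b) = 0 by rewrite expr0n (gtn_eqF p0).
have eD x y : (x + y) ^+ (p ^ b) = x ^+ (p ^ b) + y ^+ (p ^ b) :> A.
  have eN : (- y) ^+ (p ^ b) = - y ^+ (p ^ b).
    by have := exprB_pchar b 0 y cA; rewrite e0 !sub0r.
  by have := exprB_pchar b x (- y) cA; rewrite eN !opprK.
exact: (big_morph _ eD e0).
Qed.

Lemma pchar_mpoly (L : fieldType) : p \in [pchar L] -> p \in [pchar {mpoly L[n]}].
Proof.
by move=> cL; rewrite inE (pcharf_prime cL) /= -mpolyC_nat (pcharf0 cL) mpolyC0.
Qed.

Lemma adjs_pchar (P : ideal S) zs x b : adjs P zs x -> adjs P [seq z ^+ (p ^ b) | z <- zs] (x ^+ (p ^ b)).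
Proof.
have cS := pchar_mpoly charK.
have p0 : (0 < p ^ b)%N by rewrite expn_gt0 (prime_gt0 (pcharf_prime charK)).
move=> /adjsP[c Pc]; have := exprB_pchar b x (\sum_i c i * zs`_i) cS.
rewrite expr_sum_pchar // => e.
have : adjs P [seq z ^+ (p ^ b) | z <- zs] (x ^+ (p ^ b) - \sum_i (c i * zs`_i) ^+ (p ^ b)).
  by apply: adjs_le; rewrite -e -(prednK p0) exprS; exact: idMr.
move=> h; apply: id_trans h _; apply: id_sum => i _; rewrite exprMn; apply/idM/adjs_mem/mapP.
by exists zs`_i => //; exact: mem_nth.
Qed.

(* Raising to the q-th power after reducing to d linear parameters costs at most d(q-1) degrees. *)
Lemma frobenius_top (P : ideal S) d zs D : hom P -> (size (hp R P) <= d.+1)%N ->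
  (forall f, form D.+1 f -> adjs P zs f) ->
  exists N, forall b t f, (N + (p ^ b * D + d * (p ^ b).-1).+1 <= t)%N -> form t f ->
    adjs P [seq z ^+ (p ^ b) | z <- zs] f.
Proof.
move=> hP sP hD; pose P' := ext P; have hP' : hom P' := @hom_ext _ _ _ fr_frac _ _ hP.
have [|cs [scs sQ]] := @lsop R F n (fr_inf fr_inj) P' d hP'; first by rewrite (hp_ext fr_inj).
pose ls := map (@lin F n) cs; have sls : size ls = d by rewrite size_map.
have fls l : l \in ls -> form 1%N l by move=> /mapP[c _ ->]; exact: form_lin.
have [hQ _] := @hp_adjs_size R F n P' ls hP' (fun l h => ex_intro2 _ _ 1%N (fls l h) isT).
have [N hN] := hp1_primary hQ sQ; exists N => b t f le hf; set q := (p ^ b)%N in le *.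
have q0 : (0 < q)%N by rewrite expn_gt0 (prime_gt0 (pcharf_prime charK)).
set Q := adjs P _; pose Q' := ext Q.
have charF : p \in [pchar F].
  rewrite inE (pcharf_prime charK) /=.
  have := pcharf0 charK => e; rewrite -(rmorph_nat fr) -polyC_natr e.
  by rewrite polyC0 rmorph0.
(* Monomials of degree above D lie in (P, zs), so their q-th powers lie in Q; over F the q-th power
   of x is a combination of these. *)
have powQ t' (x : S') : form t' x -> (D < t')%N -> Q' (x ^+ q).
  move=> hx Dt; rewrite [x]mpolyE expr_sum_pchar ?pchar_mpoly // big_seq.
  apply: id_sum => m mx; rewrite exprZn; apply: idZ.
  have -> : 'X_[m] = emb fr ('X_[m] : S) by rewrite /emb map_mpolyX.
  rewrite -rmorphXn; apply/(ext_emb fr_inj); apply: adjs_pchar.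
  apply: (forms_up hD Dt); rewrite dhomogX; apply/eqP.
  by move/dhomogP: hx; apply.
have := @products_top F n P' Q' (size ls) (fun i => ls`_i) (q * D + d * q.-1) N hP'.
move=> /(_ _ _ _ _ (q * D + d * q.-1).+1 (fun _ => 0%N) _ t (emb fr f)).
rewrite [\prod_(i < size ls) _]big1 ?mul1r => [|i _]; last by rewrite expr0.
move=> H; apply/(ext_emb fr_inj fr_frac Q f); apply: H => //.
- by move=> i; exact/fls/mem_nth.
- by move=> t' g Nt hg; apply/adjsP; apply: hN hg; exact: ltnW.
- by apply: ext_mono; exact: adjs_le.
- move=> al hal.
  (* Exponents are divided by q: the remainders account for at most d (q - 1), so the quotients add
     up to more than D. *)
  have -> : \prod_(i < size ls) ls`_i ^+ al i =
      (\prod_(i < size ls) ls`_i ^+ (al i %/ q)) ^+ q * \prod_(i < size ls) ls`_i ^+ (al i %% q).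
    rewrite -prodrXl -big_split; apply: eq_bigr => i _.
    by rewrite /= -exprM -exprD -divn_eq.
  apply/idMr/(powQ (\sum_(i < size ls) 1 * (al i %/ q))%N).
    elim/big_rec2: _ => [|i m y _ hy]; first exact: dhomog1.
    by apply: dhomogM => //; apply/dhomogMn/fls/mem_nth.
  rewrite ltnNge; apply/negP => leD; move: hal; rewrite ltnNge => /negP[].
  have -> : (\sum_(i < size ls) al i = \sum_(i < size ls) (q * (1 * (al i %/ q)) + al i %% q))%N.
    by apply: eq_bigr => i _; rewrite mul1n [(q * _)%N]mulnC -divn_eq.
  rewrite big_split /= -big_distrr /=; apply: leq_add; first by rewrite leq_mul2l leD orbT.
  have -> : (d * q.-1 = \sum_(i < size ls) q.-1)%N by rewrite sum_nat_const card_ord sls.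
  by apply: leq_sum => i _; rewrite -ltnS prednK // ltn_mod.
- by rewrite big1 // add0n.
- exact: form_emb.
Qed.

End FrobeniusTop.

(** * The bound by the regularity *)

Section RegularityBound.
Variables (R : realType) (K : fieldType) (p n : nat) (I : idealr {mpoly K[n]}).
Local Notation S := {mpoly K[n]}.
Local Notation hc := (pihomog mdeg).
Local Notation form d f := (f \is d.-homog for mdeg).
Local Notation mI := (mI K n).
Local Notation hp := (@hp R K n).
Local Notation I0 := (of_idealr I).
Hypothesis charK : p \in [pchar K].
Hypothesis hI : hom I0.
Hypothesis radI : isradical I0.
Hypothesis gor : gorenstein {ideal_quot I}.

Lemma form_prod_exp es (ys : seq S) k : degs es ys -> form (sumn es * k) (\prod_(y <- ys) y ^+ k).
Proof.
elim: es ys => [|e es IH] [|y ys] //=; first by rewrite big_nil dhomog1.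
move=> /andP[/andP[hy _] h]; rewrite big_cons mulnDl; apply: dhomogM; last exact: IH.
exact: dhomogMn.
Qed.

(** Each [y ^+ k.+1] has degree at least k + 1, so below that degree only J contributes. *)
Lemma adjs_exp_low (J : ideal S) es ys k s f : hom J -> degs es ys -> form s f -> (s < k.+1)%N ->
  adjs J [seq y ^+ k.+1 | y <- ys] f -> J f.
Proof.
move=> hJ hd hf sk /adjsP[c /(hJ _ s)]; rewrite pihomogB (raddf_sum (pihomog mdeg s)) (pihomog_dE hf) /= big1 ?subr0 //.
move=> i _ /=; have lt : (i < size ys)%N by have := ltn_ord i; rewrite [X in (_ < X)%N]size_map.
rewrite (nth_map 0) //; have [hy y0] := degs_nth hd lt.
rewrite (hcMf _ _ (dhomogMn k.+1 hy)) leqNgt (leq_trans sk) //.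
by rewrite leq_pmull.
Qed.

Lemma socle_above (J : ideal S) N s f : hom J -> (forall t g, (N <= t)%N -> form t g -> J g) ->
  form s f -> ~ J f -> exists w g, [/\ form w g, ~ J (g * f) & forall x, mI x -> J (x * (g * f))].
Proof.
move=> hJ hN hf nf; have hC := hom_col hJ hf.
have [|w [g [hg ng sg]]] := @socle_form K n (col J f) hC.
  move=> ns; suff : col J f 1 by rewrite colE mul1r.
  by apply: (@primary_socle K n _ N hC) ns => t g Nt hg; apply: col_le; exact: hN hg.
by exists w, g; split=> // x mx; have := sg x mx; rewrite colE mulrA.
Qed.

Lemma reg_index_le_reg r m : is_regularity_index R I r -> is_cm_regularity I m -> r%:Z <= m.
Proof.
move=> hr [F [_ hm]].
have m0 : 0 <= m.
  have := hm 0%N 0%N; rewrite subrr; apply; rewrite -lt0n; apply/card_gt0P.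
  have k : 'I_(res_rank F 0) by rewrite res_rank0; exact: ord0.
  by exists k; rewrite inE res_deg0.
suff : (r <= `|m|)%N by move: m0; clear; lia.
apply: (reg_index_le hI radI _ hr) => k1 f1 hf1 nf1 pf1 sP.
set P := col I0 f1 in pf1 sP *; have hP : hom P := hom_col hI hf1.
have [ys [e [sigma [pys rys lys hs [ns ss]]]]] := regular_parameters R hI (@of_idealr1 _ I).
have [es hes] := posforms_degs pys.
have [zs [pz sz z1]] := parameters_extend pys lys.
have pzs : posforms zs by move=> f fz; apply: pz; rewrite mem_cat fz orbT.
have [es' hes'] := posforms_degs pzs.
set t := size ys; set E := sumn es; set d := hdim R I0.
have tn : (t <= n)%N by rewrite -sz size_cat leq_addr.
have et : (e + t)%:Z <= m + E%:Z.
  have := @socle_degree_bound R K n I F (es ++ es') (ys ++ zs) t (degs_cat hes hes') sz z1 tn.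
  rewrite take_size_cat // => /(_ rys e sigma hs ns ss m hm).
  by rewrite take_size_cat ?(degs_size hes) // /E /t; move: (sumn es) (size ys) => a b; clear; lia.
(* The quotient by ys has finite length, so t forms cut S/I down to dimension 0. *)
have dt : (d <= t)%N.
  have [N hN] := graded_primary gor hI pys rys ns ss.
  have hJ := hom_adjs_pos hI pys; have s1 := primary_hp1 R hJ hN.
  have [_] := hp_adjs_size R hI pys; rewrite size_hdim //; last exact: of_idealr1.
  by move=> h; rewrite -ltnS; apply: (leq_trans h); rewrite -[X in (_ <= X)%N]add1n leq_add2r.
pose ysk k := [seq y ^+ k.+1 | y <- ys]; pose J k := adjs I0 (ysk k).
pose sk k := sigma * \prod_(y <- ys) y ^+ k.
have pk k : posforms (ysk k) by exact: posforms_exp.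
have rk k : regseq I0 (ysk k) by exact: regseq_exp.
have hsk k : form (e + E * k) (sk k) by apply: dhomogM => //; exact: form_prod_exp.
have nsk k : ~ J k (sk k) by exact: notin_exp.
have ssk k x : mI x -> J k (x * sk k) by move=> mx; rewrite /sk mulrA; apply/adjs_exp_prod/ss.
have hJ k : hom (J k) by exact: hom_adjs_pos.
(* A form outside J_k has a nonzero multiple in the socle, which is concentrated in degree e + E
   k. *)
have above k s f : form s f -> ~ J k f -> exists w g, [/\ form w g, ~ J k (g * f) & (w + s = e + E * k)%N].
  move=> hf nf; have [N hN] := graded_primary gor hI (pk k) (rk k) (nsk k) (ssk k).
  have [w [g [hg ng sg]]] := socle_above (hJ k) hN hf nf.
  exists w, g; split=> //.
  exact: (socle_degree gor hI (pk k) (rk k) (hsk k) (nsk k) (ssk k) (dhomogM hg hf) ng sg).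
have sPd : size (hp P) = d.+1 by rewrite sP size_hdim //; exact: of_idealr1.
have Pm : ideal_le P mI := hom_sub_mI hP pf1.1.
have IP : ideal_le I0 P := @col_le _ I0 f1.
have star k : exists s mu, [/\ form s mu, (E * k.+1 <= s + d)%N & ~ adjs P (ysk k) mu].
  case eD : (E * k.+1 - d)%N => [|D].
    exists 0%N, 1; split; [exact: dhomog1 | by lia |].
    by move/(posforms_sub_mI Pm (pk k)); exact: mI1.
  apply: contrapT => nstar.
  have hD f : form D.+1 f -> adjs P (ysk k) f.
    by move=> hf; apply: contrapT => nf; apply: nstar; exists D.+1, f; split=> //; lia.
  have [N hN] := frobenius_top (@frX_inj K) (@frX_frac K) charK hP (eq_leq sPd) hD.
  (* With (k + 1) q = M + 1, the form g below has degree e + E M - k1. As E (k + 1) = D + d + 1,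
     this exceeds q D + d (q - 1) by at least q - E - k1, so q > N + E + k1 + 1 meets the bound of
     [frobenius_top]. *)
  pose b := (N + E + k1).+1; set q := (p ^ b)%N.
  have qb : (b < q)%N by apply: ltn_expl; exact/prime_gt1/(pcharf_prime charK).
  have [M eM] : exists M, (k.+1 * q = M.+1)%N.
    by exists (k.+1 * q).-1; rewrite prednK // muln_gt0 (leq_ltn_trans _ qb).
  have kM : (k1 < M.+1)%N.
    by rewrite -eM; apply: leq_trans (leq_pmull q (ltn0Sn k)); rewrite /b in qb; lia.
  have nfM : ~ J M f1 by move/(adjs_exp_low hI hes hf1 kM).
  have [w [g [hg ng ew]]] := above M _ _ hf1 nfM.
  case: ng; have : adjs P (ysk M) g.
    have -> : ysk M = [seq z ^+ q | z <- ysk k].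
      by rewrite /ysk -map_comp; apply: eq_map => y; rewrite /= -exprM eM.
    apply: (hN b w g _ hg); rewrite -/q.
    have e1 : (E * M.+1 = q * D + q * d + q)%N.
      have e2 : (E * k.+1 = D + d + 1)%N by lia.
      by rewrite -eM mulnA e2; lia.
    rewrite mulnS in e1; have dq : (d * q.-1 + d = q * d)%N.
      by rewrite addnC -mulnS prednK 1?mulnC // (leq_ltn_trans _ qb).
    rewrite /b in qb; lia.
  rewrite -colE; apply: adjs_sub => [x Px|x xin]; first by rewrite colE; apply: adjs_le.
  by rewrite colE; apply: idMr; exact: adjs_mem.
have [gs hgs] := acc_fg (@mpoly_acc K n) P.
(* For f of degree at most |m|, the products of f with the components of generators of P have degree
   at most k, where membership in J_k implies membership in I. *)
pose G := \max_(i < size gs) msize gs`_i; pose k := (`|m| + G)%N.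
have [s [mu [hmu le nmu]]] := star k.
have hA := hom_adjs_pos hP (pk k).
have [r0 hr0 nr0] := graded_duality gor hI (pk k) (rk k) (nsk k) (ssk k) hA
  (adjs_mono IP) nmu.
have [j nj] : exists j, ~ J k (hc j r0 * mu).
  apply/existsNP => h; apply: nr0; rewrite [r0](pihomog_partitionE (leqnn (msize r0))) mulr_suml.
  by apply: id_sum => i _; exact: h.
pose f := hc j r0; have hf : form j f by exact: pihomogP.
have Cf : colI (J k) (adjs P (ysk k)) f.
  by apply: (hom_colI (hJ k) hA) => x hx; rewrite mulrC; exact: hr0.
(* The socle degree e + E k bounds j + s, while s is at least E (k + 1) - d; hence j <= e + d - E <=
   e + t - E <= m. *)
have jm : (j <= `|m|)%N.
  have [w [g [_ _ ew]]] := above k _ _ (dhomogM hf hmu) nj.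
  rewrite mulnS in le; lia.
have nIf : ~ I0 f by move=> If; apply: nj; apply: idMr; exact: adjs_le.
have If x : P x -> I0 (f * x).
  move=> /hgs[c ->]; rewrite mulr_sumr; apply: id_sum => i _; rewrite mulrCA; apply: idM.
  apply: id_hc => s'; rewrite mulrC (hcMf _ _ hf); case: leqP => [js|_]; last exact: id0.
  have [big|small] := leqP (msize gs`_i) (s' - j); first by rewrite hc_ge // mul0r; exact: id0.
  have lt : (s' < k.+1)%N.
    have : (msize gs`_i <= G)%N by exact: (leq_bigmax i).
    by rewrite /k ltnS; move: small js jm; move: (mmeasure _ _) (G) => a b; clear; lia.
  have Pg : P gs`_i.
    apply/hgs; exists (fun l => (l == i)%:R).
    by rewrite (bigD1 i) //= eqxx mul1r big1 ?addr0 // => l /negPf ->; rewrite mul0r.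
  have hx : form s' (hc (s' - j) gs`_i * f).
    by have := dhomogM (pihomogP mdeg (s' - j) gs`_i) hf; rewrite subnK.
  apply: (adjs_exp_low hI hes hx lt); rewrite mulrC; apply: Cf; apply: adjs_le; exact: hP.
exists j, f; split=> //.
by move=> Pf; apply: nIf; apply: radI; exact: If.
Qed.

End RegularityBound.

Theorem theorem4 (R : realType) (K : fieldType) (p : nat)
    (charK : p \in [pchar K]) (n : nat) (I : idealr {mpoly K[n]})
    (I_nonzero : exists2 f, f \in I & f != 0)
    (I_homogeneous : homogeneous_ideal I)
    (SI_fpure : fpure {ideal_quot I} p) :
  (forall r, is_regularity_index R I r -> (r <= krull_dim {ideal_quot I})%N) /\
  (gorenstein {ideal_quot I} ->
   forall r, is_regularity_index R I r ->
   forall m, is_cm_regularity I m -> r%:Z <= m).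
Proof.
have hI : hom (of_idealr I) by move=> f d; exact: I_homogeneous.
split=> [r|gor r hr m hm]; first exact: (reg_index_le_dim charK hI SI_fpure).
exact: (reg_index_le_reg charK hI (fpure_radical charK SI_fpure) gor hr hm).
Qed.
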